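(* Let $\theta>1$. The set of functions $f\in L^2(\mathbb{R},e^{-x^2}dx)$ (identified up to equality almost everywhere) whose Fourier–Hermite coefficients $$f_k=\int_{-\infty}^{\infty} f(x)\,h_k(x)\,e^{-x^2}\,dx,\qquad k=0,1,2,\dots,$$ satisfy $$\sum_{k=0}^{\infty}|f_k|^2\theta^k<\infty$$ is exactly the set of restrictions to $\mathbb{R}$ of entire functions $F:\mathbb{C}\to\mathbb{C}$ such that $$\int_{\mathbb{C}}|F(z)|^2\exp\left[-2\left(\frac{(\operatorname{Re} z)^2}{\theta+1}+\frac{(\operatorname{Im} z)^2}{\theta-1}\right)\right]d\sigma(z)<\infty .$$
   Context: $h_k$ denotes the $k$-th orthonormal Hermite polynomial, i.e. the polynomial of degree $k$ with positive leading coefficient such that $\int_{-\infty}^{\infty}h_k(x)h_m(x)e^{-x^2}dx=\delta_{k,m}$. $d\sigma$ is Lebesgue area measure on $\mathbb{C}$. Saying that $f$ is the restriction of an entire function means that $f$ agrees with that restriction almost everywhere. *)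

(* Defs.v *)
From HB Require Import structures.
From mathcomp Require Import all_boot all_order all_algebra.
From mathcomp Require Import complex.
From mathcomp Require Import all_classical all_reals all_analysis.

Set Implicit Arguments.
Unset Strict Implicit.
Unset Printing Implicit Defensive.

Import Order.TTheory GRing.Theory Num.Theory.
Import numFieldNormedType.Exports.

Local Open Scope classical_set_scope.
Local Open Scope ring_scope.
Local Open Scope complex_scope.

(* The condition [size (h k) = k.+1] says that [h k] has degree exactly [k];
   together the three clauses determine [h] uniquely. *)
Definition orthonormal_hermite (R : realType) (h : nat -> {poly R}) : Prop :=
  [/\ forall k, size (h k) = k.+1,
      forall k, 0 < lead_coef (h k) &
      forall k m, (\int[@lebesgue_measure R]_x
        ((h k).[x] * (h m).[x] * expR (- x ^+ 2))%:E = ((k == m)%:R)%:E)%E].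

(* Qualified names: [Re] and [Im] without qualification denote the
   [R[i]]-valued real and imaginary parts of a closed field. *)
Definition cmod (R : realType) (z : R[i]) : R := complex.Re `|z|.

(* Measurability is with respect to the Borel sets; every Lebesgue measurable
   function is almost everywhere equal to a Borel one, so restricting to Borel
   representatives loses no almost-everywhere class. *)
Definition measurable_cfun (R : realType) (f : R -> R[i]) : Prop :=
  measurable_fun [set: R] (fun x : R => complex.Re (f x)) /\
  measurable_fun [set: R] (fun x : R => complex.Im (f x)).

Definition gaussian_L2 (R : realType) (f : R -> R[i]) : Prop :=
  measurable_cfun f /\
  (\int[@lebesgue_measure R]_x
     (cmod (f x) ^+ 2 * expR (- x ^+ 2))%:E < +oo)%E.

(* The integral of a complex-valued function is taken componentwise; [h k] is
   real-valued. *)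
Definition hermite_coef (R : realType) (h : nat -> {poly R}) (f : R -> R[i])
    (k : nat) : R[i] :=
  (\int[@lebesgue_measure R]_x
     (complex.Re (f x) * (h k).[x] * expR (- x ^+ 2))) +i*
  (\int[@lebesgue_measure R]_x
     (complex.Im (f x) * (h k).[x] * expR (- x ^+ 2))).

(* Complex differentiability: [R[i]^o] is [R[i]] as a normed space over
   itself, so the increment in the difference quotient ranges over [R[i]]. *)
Definition entire (R : realType) (F : R[i] -> R[i]) : Prop :=
  forall z : R[i], derivable (F : R[i]^o -> R[i]^o) z 1.

(* The area measure on [R[i]] is the product Lebesgue measure in the
   coordinates [(Re z, Im z)]. *)
Definition weighted_area_integral (R : realType) (theta : R)
    (F : R[i] -> R[i]) : \bar R :=
  (\int[@lebesgue_measure R \x @lebesgue_measure R]_p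
     (cmod (F (p.1 +i* p.2)) ^+ 2 *
      expR (- (2 * (p.1 ^+ 2 / (theta + 1) + p.2 ^+ 2 / (theta - 1)))))%:E)%E.

(* Main.v *)
Require Import Defs.
From HB Require Import structures.
From mathcomp Require Import all_boot all_order all_algebra.
From mathcomp Require Import complex.
From mathcomp Require Import all_classical all_reals all_analysis.
From mathcomp Require Import measurable_realfun.
From mathcomp Require Import ring lra.

Set Implicit Arguments.
Unset Strict Implicit.
Unset Printing Implicit Defensive.

Import Order.TTheory GRing.Theory Num.Theory.
Import numFieldNormedType.Exports.

Local Open Scope classical_set_scope.
Local Open Scope ring_scope.
Local Open Scope complex_scope.

(* Write a = 2/(theta+1), b = 2/(theta-1) and w(x+iy) = exp(-a x^2 - b y^2). The heart is the
   identity, for F entire with finite norm |F|_w^2 = int |F|^2 w,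
     int_C F conj(h_k) w = c theta^k int_R F h_k exp(-x^2) dx,  c = int exp(-4t^2/(theta^2-1)) dt.
   For fixed y the integrand on the left is, up to the factor exp(-b y^2), the restriction to
   Im z = y of the entire function F(z) h_k(z-2iy) exp(-a(z-iy)^2). Cauchy's theorem moves that
   line to the real axis, and the integral over y is then computed by a Mehler-type formula.
   Bessel's inequality for w gives c sum theta^k |f_k|^2 <= |F|_w^2.
   Conversely, the partial sums S_n of sum f_k h_k have |S_n|_w^2 = c sum_{k<n} theta^k |f_k|^2
   and, by the three-term recurrence, converge locally to an entire F. Fatou's lemma bounds
   |F|_w and shows |F - S_n|_w -> 0, so Bessel's inequality for F - S_n identifies the
   coefficients of F as the f_k, and completeness of the h_k gives f = F almost everywhere. *)

(** * Entire functions *)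

Section complex_modulus.
Context {R : realType}.
Implicit Types z w : R[i].

(** The obstacle is that F is controlled only in area mean: the weighted norm gives no pointwise
    decay with which to close a contour at infinity, and says nothing directly about the real line,
    a null set of the plane. Fubini replaces decay in both respects: almost every horizontal line
    carries an integrable function, and vertical sides are taken at abscissae where they are small.
    The constants fit because a b = b - a = 4/(theta^2 - 1). The modulus of exp(-a (x - iy)^2) costs
    a factor exp(a y^2), so exp(-(b - a) y^2) is left for the y-integral, and completing the square
    there gives x^2 the coefficient a + a^2/(b - a) = a b/(b - a) = 1, which is the weight of the
    line. Integrals are kept real: an identity is proved for real parts and applied to scalar
    multiples of F to recover complex coefficients. For the growth of h_k a bound O(rho^k) with rho
    > 1 close to 1 suffices, since theta > 1 leaves geometric room. Completeness is reached without
    Fourier transforms: polynomials in a Gaussian approximate indicators of intervals, and Lebesgue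
    differentiation concludes. *)

Lemma cmodE z : cmod z = Num.sqrt (complex.Re z ^+ 2 + complex.Im z ^+ 2).
Proof. by rewrite /cmod normc_def. Qed.

Lemma normC_cmod z : `|z| = (cmod z)%:C.
Proof. by rewrite /cmod normc_def. Qed.

Lemma sqr_cmod z : cmod z ^+ 2 = complex.Re z ^+ 2 + complex.Im z ^+ 2.
Proof. by rewrite cmodE sqr_sqrtr// addr_ge0// sqr_ge0. Qed.

Lemma cmod_ge0 z : 0 <= cmod z.
Proof. by rewrite cmodE sqrtr_ge0. Qed.

Lemma cmodM z w : cmod (z * w) = cmod z * cmod w.
Proof. by apply: (@complexI R); rewrite rmorphM/= -!normC_cmod normrM. Qed.

Lemma cmodN z : cmod (- z) = cmod z.
Proof. by apply: (@complexI R); rewrite -!normC_cmod normrN. Qed.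

Lemma cmod0 : cmod (0 : R[i]) = 0.
Proof. by apply: (@complexI R); rewrite -normC_cmod normr0. Qed.

Lemma cmod_eq0 z : (cmod z == 0) = (z == 0).
Proof. by rewrite -(inj_eq (@complexI R)) -normC_cmod normr_eq0. Qed.

Lemma cmodD_le z w : cmod (z + w) <= cmod z + cmod w.
Proof. by rewrite -lecR rmorphD/= -!normC_cmod ler_normD. Qed.

Lemma cmodB_le z w : cmod (z - w) <= cmod z + cmod w.
Proof. by rewrite -lecR rmorphD/= -!normC_cmod ler_normB. Qed.

Lemma cmod_real (x : R) : cmod x%:C = `|x|.
Proof. by rewrite cmodE/= expr0n addr0 sqrtr_sqr. Qed.

Lemma cmod_conj z : cmod z^*%C = cmod z.
Proof. by case: z => x y; rewrite !cmodE/= sqrrN. Qed.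

Lemma Re_le_cmod z : `|complex.Re z| <= cmod z.
Proof. by rewrite cmodE -sqrtr_sqr ler_wsqrtr// lerDl sqr_ge0. Qed.

Lemma Im_le_cmod z : `|complex.Im z| <= cmod z.
Proof. by rewrite cmodE -sqrtr_sqr ler_wsqrtr// lerDr sqr_ge0. Qed.

Lemma cmod_le_ReIm z : cmod z <= `|complex.Re z| + `|complex.Im z|.
Proof.
rewrite -(ler_pXn2r (n := 2))// ?nnegrE ?addr_ge0 ?cmod_ge0//.
by rewrite sqr_cmod sqrrD !real_normK ?num_real// lerD2r lerDl mulrn_wge0// mulr_ge0.
Qed.

Lemma Re_mulc z w : complex.Re (z * w) =
  complex.Re z * complex.Re w - complex.Im z * complex.Im w.
Proof. by case: z w => ? ? [? ?]. Qed.

Lemma Im_mulc z w : complex.Im (z * w) =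
  complex.Re z * complex.Im w + complex.Im z * complex.Re w.
Proof. by case: z w => ? ? [? ?]. Qed.

Lemma Re_addc z w : complex.Re (z + w) = complex.Re z + complex.Re w.
Proof. by case: z w => ? ? [? ?]. Qed.

Lemma Im_addc z w : complex.Im (z + w) = complex.Im z + complex.Im w.
Proof. by case: z w => ? ? [? ?]. Qed.

Lemma Re_oppc z : complex.Re (- z) = - complex.Re z.
Proof. by case: z. Qed.

Lemma Im_oppc z : complex.Im (- z) = - complex.Im z.
Proof. by case: z. Qed.

Lemma Re_conjc z : complex.Re z^*%C = complex.Re z.
Proof. by case: z. Qed.

Lemma Im_conjc z : complex.Im z^*%C = - complex.Im z.
Proof. by case: z. Qed.

End complex_modulus.

Section entire_functions.
Context {R : realType}.
Implicit Types F G : R[i] -> R[i].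

(** Division-free form of the derivative, stated with the real-valued modulus: increments h = 0 need
    no separate case and estimates stay in [R]. *)
Definition cdiff_at F (z l : R[i]) := forall e : R, 0 < e ->
  exists2 d : R, 0 < d & forall h, cmod h < d ->
    cmod (F (z + h) - F z - l * h) <= e * cmod h.

Lemma entireP F : entire F <-> forall z, exists l, cdiff_at F z l.
Proof.
split=> [eF z|eF z].
  pose l : R[i] := 'D_1 (F : R[i]^o -> R[i]^o) z.
  exists l => e e0; have /cvgrPdist_le/(_ e%:C) := eF z.
  rewrite ltcR => /(_ e0); case=> [d /=]; rewrite ltcE/= => /andP[/eqP d0 d1] H.
  exists (complex.Re d) => // h hd.
  have [->|hn0] := eqVneq h 0; first by rewrite mulr0 addr0 subrr subr0 cmod0 mulr0.
  have := H h; rewrite /= sub0r normrN.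
  have -> : d = (complex.Re d)%:C by case: (d) d0 => ? ? /= ->.
  rewrite normC_cmod ltcR => /(_ hd hn0).
  rewrite -/l normC_cmod lecR => /(ler_wpM2r (cmod_ge0 h)).
  rewrite -cmodM; congr (_ <= _); rewrite -cmodN; congr (cmod _).
  rewrite /GRing.scale/= mulr1 mulrBl mulrAC mulVf// mul1r opprB [h + z]addrC.
  by [].
have [l Hl] := eF z.
apply/cvg_ex; exists l; apply/cvgrPdist_le => e.
rewrite ltcE/= => /andP[/eqP ei e0].
have -> : e = (complex.Re e)%:C by case: (e) ei => ? ? /= ->.
have [d d0 Hd] := Hl _ e0.
exists d%:C => /=; first by rewrite ltcR.
move=> h; rewrite /= sub0r normrN normC_cmod ltcR => hd hn0.
have h0 : 0 < cmod h by rewrite lt_neqAle cmod_ge0 eq_sym cmod_eq0 hn0.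
rewrite normC_cmod lecR -(ler_pM2r h0) -cmodM.
apply: le_trans (Hd h hd); rewrite -cmodN le_eqVlt; apply/orP; left; apply/eqP; congr (cmod _).
by rewrite /GRing.scale/= mulr1 mulrBl mulrAC mulVf// mul1r opprB [h + z]addrC.
Qed.

End entire_functions.

Section entire_closure.
Context {R : realType}.
Implicit Types F G : R[i] -> R[i].

Lemma entire_cst (c : R[i]) : entire (fun=> c).
Proof. by move=> z; exact: derivable_cst. Qed.

Arguments entire_cst : clear implicits.

Lemma entire_id : entire (@id R[i]).
Proof. by move=> z; exact: derivable_id. Qed.

Lemma entireD F G : entire F -> entire G -> entire (fun z => F z + G z).
Proof. by move=> eF eG z; exact: (@derivableD R[i] R[i]^o R[i]^o F G). Qed.

Lemma entireM F G : entire F -> entire G -> entire (fun z => F z * G z).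
Proof. by move=> eF eG z; exact: (@derivableM R[i] R[i]^o F G). Qed.

Lemma entire_horner (p : {poly R[i]}) : entire (horner p).
Proof.
elim/poly_ind: p => [|p c IH].
  by rewrite (_ : horner _ = fun=> 0) ?funeqE => [|z]; [exact: entire_cst|rewrite horner0].
rewrite (_ : horner _ = fun z => p.[z] * z + c).
  exact: (entireD (entireM IH entire_id) (entire_cst c)).
by apply/funext => z; rewrite hornerMXaddC.
Qed.

Lemma cdiff_atM_bound G z m : cdiff_at G z m ->
  exists2 d : R, 0 < d & forall h, cmod h < d ->
    cmod (G (z + h) - G z) <= (cmod m + 1) * cmod h.
Proof.
move=> /(_ 1 ltr01)[d d0 Hd]; exists d => // h /Hd; rewrite mul1r => H.
rewrite -[G _ - _](subrK (m * h)) mulrDl mul1r -cmodM addrC.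
by apply: le_trans (cmodD_le _ _) _; rewrite lerD2l.
Qed.

Lemma entire_comp F G : entire F -> entire G -> entire (F \o G).
Proof.
move=> /entireP eF /entireP eG; apply/entireP => z.
have [m Hm] := eG z; have [l Hl] := eF (G z).
exists (l * m) => e e0.
have m1 : 0 < cmod m + 1 by rewrite ltr_wpDl ?cmod_ge0.
have l1 : 0 < cmod l + 1 by rewrite ltr_wpDl ?cmod_ge0.
have e20 : 0 < e / 2 by rewrite divr_gt0.
have [d1 d10 H1] := cdiff_atM_bound Hm.
have [d2 d20 H2] := Hl _ (divr_gt0 e20 m1).
have [d3 d30 H3] := Hm _ (divr_gt0 e20 l1).
exists (Num.min d1 (Num.min (d2 / (cmod m + 1)) d3)).
  by rewrite !lt_min d10 divr_gt0// d30.
move=> h; rewrite !lt_min => /and3P[h1 h2 h3] /=.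
pose k := G (z + h) - G z.
have kE : G (z + h) = G z + k by rewrite /k [RHS]addrC subrK.
have kh : cmod k <= (cmod m + 1) * cmod h by exact: H1.
have kd : cmod k < d2.
  by apply: le_lt_trans kh _; rewrite mulrC -ltr_pdivlMr.
rewrite kE.
have -> : F (G z + k) - F (G z) - l * m * h =
  (F (G z + k) - F (G z) - l * k) + l * (k - m * h) by ring.
apply: le_trans (cmodD_le _ _) _.
have -> : e = e / 2 + e / 2 by rewrite -splitr.
rewrite mulrDl lerD//.
  apply: le_trans (H2 k kd) _.
  apply: le_trans (ler_wpM2l _ kh) _; first by rewrite ltW// divr_gt0.
  by rewrite mulrA divfK ?gt_eqF.
rewrite cmodM; apply: le_trans (_ : (cmod l + 1) * (e / 2 / (cmod l + 1) * cmod h) <= _).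
  by apply: ler_pM; rewrite ?cmod_ge0// ?lerDl//; exact: H3.
by rewrite mulrA [(cmod l + 1) * _]mulrC divfK ?gt_eqF.
Qed.

Lemma entireX F n : entire F -> entire (fun z => F z ^+ n).
Proof.
move=> eF; elim: n => [|n IH]; first exact: entire_cst.
rewrite (_ : (fun _ => _) = fun z => F z * F z ^+ n); first exact: entireM.
by apply/funext => z; rewrite exprS.
Qed.

Lemma entireN F : entire F -> entire (fun z => - F z).
Proof. by move=> eF z; exact: (@derivableN R[i] R[i]^o R[i]^o F). Qed.

(** Conjugating the difference quotient preserves its modulus. The product of F with this reflection
    is an entire extension of |F|^2 from the real line. *)
Lemma entire_reflect F : entire F -> entire (fun z => ((F z^*)^*)%C).
Proof.
move=> /entireP eF; apply/entireP => z; have [l Hl] := eF (z^*%C).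
exists (l^*%C) => e e0; have [d d0 Hd] := Hl e e0; exists d => // h hd.
rewrite -[cmod h]cmod_conj -[cmod (_ - _)]cmod_conj !rmorphB rmorphM !rmorphD/= !conjcK.
by apply: Hd; rewrite cmod_conj.
Qed.

End entire_closure.

Arguments entire_cst {R} c.
Arguments entire_id {R}.
Arguments entireD {R F G} _ _.
Arguments entireM {R F G} _ _.
Arguments entireX {R F} n _.
Arguments entireN {R F} _.
Arguments entire_comp {R F G} _ _.
Arguments entire_horner {R} p.
Arguments entire_reflect {R F} _.

(** * The complex exponential *)

Section complex_exponential.
Context {R : realType}.
Implicit Types z w : R[i].

Definition cexp z : R[i] :=
  (expR (complex.Re z) * cos (complex.Im z)) +i* (expR (complex.Re z) * sin (complex.Im z)).

Lemma cexpD z w : cexp (z + w) = cexp z * cexp w.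
Proof.
case: z w => a b [c d]; rewrite /cexp/= expRD cosD sinD.
by apply/eqP; rewrite eq_complex/=; apply/andP; split; apply/eqP; ring.
Qed.

Lemma cmod_cexp z : cmod (cexp z) = expR (complex.Re z).
Proof.
by rewrite cmodE/= !exprMn -mulrDr cos2Dsin2 mulr1 sqrtr_sqr ger0_norm// expR_ge0.
Qed.

Lemma cexp_real (x : R) : cexp x%:C = (expR x)%:C.
Proof. by rewrite /cexp/= cos0 sin0 mulr1 mulr0. Qed.

Lemma is_derive_small (f : R -> R) (x df e : R) : is_derive x 1 f df -> 0 < e ->
  exists2 d : R, 0 < d & forall h, `|h| < d ->
    `|f (x + h) - f x - df * h| <= e * `|h|.
Proof.
move=> [dvf <-] e0; have /cvgrPdist_le/(_ e e0) := dvf.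
case=> [d /= d0 H]; exists d => // h hd.
have [->|hn0] := eqVneq h 0; first by rewrite mulr0 addr0 subrr subr0 normr0 mulr0.
have := H h; rewrite /= sub0r normrN => /(_ hd hn0).
move=> /(ler_wpM2r (normr_ge0 h)); rewrite -normrM; congr (_ <= _).
rewrite -normrN; congr (`| _ |).
rewrite /GRing.scale/= mulr1 mulrBl mulrAC mulVf// mul1r opprB [h + x]addrC.
by [].
Qed.

Lemma cdiff_cexp0 : cdiff_at cexp 0 1.
Proof.
move=> e e0.
(* The real and imaginary errors cost at most 3 e1 |h| each, so e/8 is enough. With e1 <= 1 and |h|
   < e1/2 one also gets |exp s - 1| <= e1, hence exp s <= 2. *)
pose e1 := Num.min 1 (e / 8).
have e10 : 0 < e1 by rewrite lt_min ltr01 divr_gt0.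
have e11 : e1 <= 1 by rewrite ge_min lexx.
have e1e : e1 * 8 <= e by rewrite -ler_pdivlMr// ge_min lexx orbT.
have [d1 d10 H1] := is_derive_small (is_derive_expR 0) e10.
have [d2 d20 H2] := is_derive_small (is_derive_cos 0) e10.
have [d3 d30 H3] := is_derive_small (is_derive_sin 0) e10.
exists (Num.min (e1 / 2) (Num.min d1 (Num.min d2 d3))).
  by rewrite !lt_min divr_gt0// d10 d20.
move=> h; rewrite !lt_min => /and4P[h0 h1 h2 h3].
have Rh := Re_le_cmod h; have Ih := Im_le_cmod h.
have := H1 _ (le_lt_trans Rh h1); have := H2 _ (le_lt_trans Ih h2).
have := H3 _ (le_lt_trans Ih h3); move: Rh Ih.
rewrite /cexp !add0r /= !expR0 !sin0 !cos0 !mulr1 mulr0 oppr0 mul0r !subr0 !mul1r.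
case: h h0 {h1 h2 h3} => s t /=.
set m := cmod _ => h0 sm tm st ct es.
have m0 : 0 <= m by exact: cmod_ge0.
set A := expR s in es *.
have A1 : `|A - 1| <= e1.
  rewrite -[A - 1](subrK s) (le_trans (ler_normD _ _))//.
  have := ler_wpM2r (normr_ge0 s) e11; rewrite mul1r => ?; lra.
have A2 : `|A| <= 2.
  by rewrite -[A](subrK 1) (le_trans (ler_normD _ _))// normr1; lra.
have em := ler_wpM2l (ltW e10).
apply: le_trans (cmod_le_ReIm _) _ => /=; rewrite subr0.
have -> : A * cos t - 1 - s = (A - 1 - s) + A * (cos t - 1) by ring.
have -> : A * sin t - t = A * (sin t - t) + (A - 1) * t by ring.
have r1 : `|A - 1 - s + A * (cos t - 1)| <= e1 * m + 2 * (e1 * m).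
  apply: le_trans (ler_normD _ _) _; rewrite normrM; apply: lerD.
    by apply: le_trans es _; exact: em.
  by apply: ler_pM => //; apply: le_trans ct _; exact: em.
rewrite addr0 in st.
have r2 : `|A * (sin t - t) + (A - 1) * t| <= 2 * (e1 * m) + e1 * m.
  apply: le_trans (ler_normD _ _) _; rewrite !normrM; apply: lerD.
    by apply: ler_pM => //; apply: le_trans st _; exact: em.
  exact: ler_pM.
have em0 : 0 <= e1 * m by rewrite mulr_ge0// ltW.
have := ler_wpM2r m0 e1e; lra.
Qed.

(** The functional equation carries the derivative at 0 to every other point. *)
Lemma entire_cexp : entire cexp.
Proof.
apply/entireP => z; exists (cexp z) => e e0.
have A0 : 0 < cmod (cexp z) by rewrite cmod_cexp expR_gt0.
have [d d0 Hd] := cdiff_cexp0 (divr_gt0 e0 A0).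
exists d => // h /Hd; rewrite add0r.
have -> : cexp 0 = 1 by rewrite -[X in cexp X](_ : 0%:C = 0)// cexp_real expR0.
have -> : cexp (z + h) - cexp z - cexp z * h = cexp z * (cexp h - 1 - 1 * h).
  by rewrite cexpD; ring.
by rewrite cmodM mulrAC ler_pdivlMr// mulrC.
Qed.
End complex_exponential.

Arguments entire_cexp {R}.

(** * Joint measurability from separate regularity *)

Section caratheodory_measurable.
Context {R : realType}.
Local Open Scope ring_scope.

(** Round x down to the grid of mesh 1/(n+1). The rounded function is measurable, each preimage
    being a countable union of rectangles indexed by grid points, and it converges pointwise to f by
    continuity in x. *)
Lemma measurable_fun_caratheodory (f : R -> R -> R) :
  (forall x, measurable_fun setT (f x)) -> (forall y, continuous (f ^~ y)) ->
  measurable_fun setT (fun p : R * R => f p.1 p.2).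
Proof.
move=> mf cf.
pose r n (x : R) : R := (Num.floor (n.+1%:R * x))%:~R / n.+1%:R.
apply: (@measurable_fun_cvg _ _ _ _
  (fun n (p : R * R) => f (r n p.1) p.2)) => [n _ B mB|p _]; last first.
  apply: (@continuous_cvg _ _ _ _ _ _ (f ^~ p.2)); first exact: cf.
  apply/cvgrPdist_le => e e0; near=> n.
  have n0 : (0 : R) < n.+1%:R by [].
  have /andP[h1 h2] := floor_itv (n.+1%:R * p.1).
  have -> : p.1 - r n p.1 = (n.+1%:R * p.1 - (Num.floor (n.+1%:R * p.1))%:~R) / n.+1%:R.
    by rewrite /r; field; rewrite gt_eqF.
  rewrite normrM.
  rewrite [`|_^-1|]gtr0_norm ?invr_gt0// ler_pdivrMr//.
  rewrite ger0_norm ?subr_ge0//; apply: (@le_trans _ _ 1).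
    by rewrite lerBlDl; move: h2; rewrite intrD => /ltW.
  rewrite mulrC -ler_pdivrMr// mul1r -[n.+1%:R]natr1.
  apply: le_trans (_ : n%:R <= _); last by rewrite lerDl.
  by near: n; exact: nbhs_infty_ger.
rewrite setTI (_ : _ @^-1` _ = \bigcup_(k in @setT int)
  ([set x : R | Num.floor (n.+1%:R * x) == k] `*`
   [set y | B (f (k%:~R / n.+1%:R) y)])); last first.
  apply/seteqP; split => [[x y] /= Bf|[x y] [k _ [/= /eqP <-]]//].
  by exists (Num.floor (n.+1%:R * x)) => //; split => /=.
apply: countable_bigcupT_measurable; first exact: countableP.
move=> k; apply: measurableX; last by rewrite -[X in measurable X]setTI; exact: mf.
rewrite (_ : [set _ | _] = `[k%:~R / n.+1%:R, (k + 1)%:~R / n.+1%:R[%classic)//.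
apply/seteqP; split => x /=; rewrite floor_eq in_itv/= ler_pdivrMr// ltr_pdivlMr//.
  by rewrite mulrC.
by rewrite mulrC.
Unshelve. all: by end_near. Qed.

End caratheodory_measurable.

(** * Entire functions along horizontal and vertical lines *)

Section entire_paths.
Context {R : realType}.
Implicit Types H : R[i] -> R[i].

Lemma entire_cmod_continuous H z (e : R) : entire H -> 0 < e ->
  exists2 d : R, 0 < d & forall h, cmod h < d -> cmod (H (z + h) - H z) <= e.
Proof.
move=> /entireP/(_ z)[l /cdiff_atM_bound[d d0 Hd]] e0.
have l0 : 0 < cmod l + 1 by rewrite ltr_wpDl ?cmod_ge0.
exists (Num.min d (e / (cmod l + 1))); first by rewrite lt_min d0 divr_gt0.
move=> h; rewrite lt_min => /andP[/Hd h1 h2]; apply: le_trans h1 _.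
by rewrite mulrC -ler_pdivlMr// ltW.
Qed.

Lemma entire_path_continuous H (g : R -> R[i]) : entire H ->
  (forall s t, cmod (g s - g t) <= `|s - t|) ->
  continuous (fun t => complex.Re (H (g t))) /\
  continuous (fun t => complex.Im (H (g t))).
Proof.
move=> eH lg.
have key t (e : R) : 0 < e -> \forall s \near t, cmod (H (g s) - H (g t)) <= e.
  move=> e0; have [d d0 Hd] := entire_cmod_continuous (g t) eH e0.
  exists d => //= s /=; rewrite distrC => std.
  have -> : g s = g t + (g s - g t) by rewrite addrC subrK.
  by apply: Hd; apply: le_lt_trans (lg _ _) std.
split=> t; apply/cvgrPdist_le => e e0; near=> s; rewrite distrC.
  apply: (@le_trans _ _ (cmod (H (g s) - H (g t)))); last by near: s; exact: key.
  by rewrite -Re_oppc -Re_addc; exact: Re_le_cmod.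
apply: (@le_trans _ _ (cmod (H (g s) - H (g t)))); last by near: s; exact: key.
by rewrite -Im_oppc -Im_addc; exact: Im_le_cmod.
Unshelve. all: by end_near. Qed.

Lemma entire_horizontal_continuous H (y : R) : entire H ->
  continuous (fun x => complex.Re (H (x +i* y))) /\
  continuous (fun x => complex.Im (H (x +i* y))).
Proof.
move=> eH; apply: (entire_path_continuous eH) => s t.
by rewrite cmodE/= subrr expr0n addr0 sqrtr_sqr.
Qed.

Lemma entire_vertical_continuous H (x : R) : entire H ->
  continuous (fun y => complex.Re (H (x +i* y))) /\
  continuous (fun y => complex.Im (H (x +i* y))).
Proof.
move=> eH; apply: (entire_path_continuous eH) => s t.
by rewrite cmodE/= subrr expr0n add0r sqrtr_sqr.
Qed.

Lemma entire_measurable H : entire H ->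
  measurable_fun setT (fun p : R * R => complex.Re (H (p.1 +i* p.2))) /\
  measurable_fun setT (fun p : R * R => complex.Im (H (p.1 +i* p.2))).
Proof.
move=> eH; split.
  apply: (@measurable_fun_caratheodory _ (fun x y => complex.Re (H (x +i* y)))).
    by move=> x; apply: continuous_measurable_fun; exact: (entire_vertical_continuous x eH).1.
  by move=> y; exact: (entire_horizontal_continuous y eH).1.
apply: (@measurable_fun_caratheodory _ (fun x y => complex.Im (H (x +i* y)))).
  by move=> x; apply: continuous_measurable_fun; exact: (entire_vertical_continuous x eH).2.
by move=> y; exact: (entire_horizontal_continuous y eH).2.
Qed.

End entire_paths.

(** * Cauchy's theorem for rectangles *)

Section bisection.
Context {R : realType}.
(* [I x y s t] is attached to the rectangle [x, x+s] x [y, y+t]. *)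
Variable I : R -> R -> R -> R -> R.
Hypothesis Isplit : forall x y s t, 0 <= s -> 0 <= t ->
  I x y s t = I x y (s / 2) (t / 2) + I (x + s / 2) y (s / 2) (t / 2) +
    I x (y + t / 2) (s / 2) (t / 2) + I (x + s / 2) (y + t / 2) (s / 2) (t / 2).
Hypothesis Ismall : forall x0 y0 e, 0 < e -> exists2 d, 0 < d &
  forall x y s t, 0 <= s < d -> 0 <= t < d -> x <= x0 <= x + s ->
    y <= y0 <= y + t -> `|I x y s t| <= e * (s + t) ^+ 2.

(** By additivity and the triangle inequality the four quarters cannot all be smaller than one
    fourth of the whole. *)
Let quarter (x y s t : R) : 0 <= s -> 0 <= t -> exists q : R * R,
  [/\ x <= q.1, q.1 + s / 2 <= x + s, y <= q.2, q.2 + t / 2 <= y + t &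
    `|I x y s t| <= 4 * `|I q.1 q.2 (s / 2) (t / 2)|].
Proof.
move=> s0 t0; pose P x' y' := `|I x y s t| <= 4 * `|I x' y' (s / 2) (t / 2)|.
have [h1|h1] := boolP (P x y); first by exists (x, y); split => //=; lra.
have [h2|h2] := boolP (P (x + s / 2) y); first by exists (x + s / 2, y); split => //=; lra.
have [h3|h3] := boolP (P x (y + t / 2)); first by exists (x, y + t / 2); split => //=; lra.
have [h4|h4] := boolP (P (x + s / 2) (y + t / 2)).
  by exists (x + s / 2, y + t / 2); split => //=; lra.
exfalso; move: h1 h2 h3 h4; rewrite /P -!ltNge (Isplit x y s0 t0).
set a := I x y _ _; set b := I (x + _) y _ _; set c := I x (y + _) _ _.
set d := I (x + _) (y + _) _ _ => h1 h2 h3 h4.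
have := ler_normD (a + b + c) d; have := ler_normD (a + b) c; have := ler_normD a b; lra.
Qed.

(** Iterating [quarter] gives nested rectangles shrinking to a point and losing at most a factor 4
    at each stage. Near that point I is at most e times a quantity quadratic in the side lengths,
    which also shrinks by 4, so |I| is at most a multiple of every e. *)
Lemma bisection_eq0 (x y s t : R) : 0 <= s -> 0 <= t -> I x y s t = 0.
Proof.
move=> s0 t0.
pose sz (a : R) n : R := a / 2 ^+ n.
have sz0 a n : 0 <= a -> 0 <= sz a n by move=> a0; rewrite divr_ge0// exprn_ge0.
have szS a n : sz a n.+1 = sz a n / 2 by rewrite /sz exprSr invfM mulrA.
have /choice[q Hq] : forall np : nat * (R * R), exists q : R * R,
  [/\ np.2.1 <= q.1, q.1 + sz s np.1.+1 <= np.2.1 + sz s np.1,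
      np.2.2 <= q.2, q.2 + sz t np.1.+1 <= np.2.2 + sz t np.1 &
    `|I np.2.1 np.2.2 (sz s np.1) (sz t np.1)| <=
      4 * `|I q.1 q.2 (sz s np.1.+1) (sz t np.1.+1)|].
  by move=> [n p]; rewrite !szS; apply: quarter; exact: sz0.
pose c := fix c n : R * R := if n is m.+1 then q (m, c m) else (x, y).
have c1 n : (c n).1 <= (c n.+1).1 by case: (Hq (n, c n)).
have c1' n : (c n.+1).1 + sz s n.+1 <= (c n).1 + sz s n by case: (Hq (n, c n)).
have c2 n : (c n).2 <= (c n.+1).2 by case: (Hq (n, c n)).
have c2' n : (c n.+1).2 + sz t n.+1 <= (c n).2 + sz t n by case: (Hq (n, c n)).
have Ic n : `|I x y s t| <= 4 ^+ n * `|I (c n).1 (c n).2 (sz s n) (sz t n)|.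
  elim: n => [|n IH]; first by rewrite /sz expr0 !divr1 mul1r.
  apply: le_trans IH _; rewrite exprSr -mulrA ler_wpM2l ?exprn_ge0//.
  by case: (Hq (n, c n)).
have nested (u v : nat -> R) : (forall n, u n <= u n.+1) -> (forall n, v n.+1 <= v n) ->
    (forall n, u n <= v n) -> exists z, forall n, u n <= z <= v n.
  move=> uS vS uv.
  have um : {homo u : m n / (m <= n)%N >-> m <= n} by apply: homo_leq => //; exact: le_trans.
  have vm : {homo v : m n / (m <= n)%N >-> n <= m}.
    by apply: homo_leq => // a b d ab bd; exact: le_trans bd ab.
  have uvmn m n : u m <= v n.
    by apply: le_trans (um _ _ (leq_maxl m n)) _; apply: le_trans (uv _) (vm _ _ (leq_maxr m n)).
  exists (sup (range u)) => n; apply/andP; split.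
    apply: ub_le_sup; last by exists n.
    by exists (v 0%N) => _ [m _ <-].
  apply: ge_sup; first by exists (u 0%N), 0%N.
  by move=> _ [m _ <-].
have [x0 Hx0] := nested _ _ c1 c1' (fun n => ltac:(by rewrite lerDl sz0)).
have [y0 Hy0] := nested _ _ c2 c2' (fun n => ltac:(by rewrite lerDl sz0)).
apply/eqP; rewrite -normr_eq0; apply/eqP/le_anti; rewrite normr_ge0 andbT.
apply/ler_addgt0Pr => e e0; rewrite add0r.
(* The added 1 keeps the divisor positive for the degenerate rectangle s = t = 0. *)
have K0 : 0 < (s + t) ^+ 2 + 1 by rewrite ltr_wpDl// sqr_ge0.
have [d d0 Hd] := Ismall x0 y0 (divr_gt0 e0 K0).
have [n Hn] : exists n, sz (s + t) n < d.
  exists (Num.bound ((s + t) / d)); rewrite /sz ltr_pdivrMr ?exprn_gt0// mulrC.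
  rewrite -ltr_pdivrMr//; apply: lt_trans (archi_boundP _) _.
    by rewrite divr_ge0 ?addr_ge0// ltW.
  by rewrite -natrX ltr_nat ltn_expl.
have szd a : 0 <= a -> a <= s + t -> 0 <= sz a n < d.
  move=> a0 ast; rewrite sz0//=; apply: le_lt_trans Hn.
  by rewrite /sz ler_wpM2r// invr_ge0 exprn_ge0.
apply: le_trans (Ic n) _.
have := Hd (c n).1 (c n).2 (sz s n) (sz t n).
move=> /(_ (szd _ s0 ltac:(lra)) (szd _ t0 ltac:(lra)) (Hx0 n) (Hy0 n)).
have p4 : 0 < 4 ^+ n :> R by rewrite exprn_gt0.
move=> /(ler_wpM2l (ltW p4)) H; apply: le_trans H _.
have -> : 4 ^+ n * (e / ((s + t) ^+ 2 + 1) * (sz s n + sz t n) ^+ 2) =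
   e / ((s + t) ^+ 2 + 1) * (s + t) ^+ 2.
  have -> : 4 = 2 ^+ 2 :> R by rewrite expr2; lra.
  rewrite /sz -mulrDl exprAC.
  have : 2 ^+ n != 0 :> R by rewrite expf_neq0.
  by move: (2 ^+ n) => P P0; field; rewrite P0 gt_eqF.
by rewrite mulrAC ler_pdivrMr// ler_wpM2l ?(ltW e0)// lerDl.
Qed.

End bisection.

Section goursat.
Context {R : realType}.
Local Notation mu := (@lebesgue_measure R).

Lemma continuous_itv_integrable (f : R -> R) (a b : R) : continuous f ->
  mu.-integrable `[a, b] (EFin \o f).
Proof.
move=> cf; apply: continuous_compact_integrable; first exact: segment_compact.
exact: continuous_subspaceT.
Qed.

Lemma Rintegral_itv_split (f : R -> R) (a b c : R) : continuous f -> a <= b -> b <= c ->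
  \int[mu]_(x in `[a, c]) f x = \int[mu]_(x in `[a, b]) f x + \int[mu]_(x in `[b, c]) f x.
Proof.
move=> cf ab bc; apply/eqP; rewrite addrC -subr_eq; apply/eqP.
have i1 := continuous_itv_integrable a c cf.
rewrite Rintegral_itvB// Rintegral_itv_obnd_cbnd//.
by apply: integrableS (continuous_itv_integrable b c cf) => //; exact: subset_itv_oc_cc.
Qed.

Lemma Rintegral_itv_near_cst (f : R -> R) (a s k M : R) : continuous f -> 0 <= s ->
  (forall x, a <= x <= a + s -> `|f x - k| <= M) ->
  `|\int[mu]_(x in `[a, a + s]) f x - k * s| <= M * s.
Proof.
move=> cf s0 fk.
have muE : fine (mu `[a, a + s]) = s.
  rewrite lebesgue_measure_itv/= lte_fin ltrDl; case: ifPn => [_|].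
    by rewrite -EFinB /= addrC addKr.
  by rewrite -leNgt => s0'; apply/esym/le_anti; rewrite s0 s0'.
have cfk : continuous (fun x => f x - k).
  by move=> x; apply: continuousB; [exact: cf|exact: cst_continuous].
have ck (r : R) : continuous (fun _ : R => r) by exact: cst_continuous.
have -> : k * s = \int[mu]_(x in `[a, a + s]) k.
  by rewrite Rintegral_cst ?muE.
have -> : M * s = \int[mu]_(x in `[a, a + s]) M.
  by rewrite Rintegral_cst ?muE.
rewrite -RintegralB//; [|exact: continuous_itv_integrable..].
apply: le_trans (le_normr_Rintegral _ _) _ => //; first exact: (continuous_itv_integrable _ _ cfk).
apply: le_Rintegral => //.
- apply: (@continuous_itv_integrable (fun x => `|f x - k|)).
  by move=> x; apply: cvg_norm; exact: cfk.
- exact: continuous_itv_integrable.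
Qed.

Variable H : R[i] -> R[i].
Hypothesis eH : entire H.
Let u x y := complex.Re (H (x +i* y)).
Let v x y := complex.Im (H (x +i* y)).

(** Real part of the counterclockwise contour integral of H over the rectangle, with opposite sides
    paired in one integrand. *)
Let boundary x y s t :=
  \int[mu]_(r in `[x, x + s]) (u r y - u r (y + t)) -
  \int[mu]_(r in `[y, y + t]) (v (x + s) r - v x r).

Let cu (y1 y2 : R) : continuous (fun r => u r y1 - u r y2).
Proof. by move=> x; apply: cvgB; exact: (entire_horizontal_continuous _ eH).1. Qed.

Let cv (x1 x2 : R) : continuous (fun r => v x1 r - v x2 r).
Proof. by move=> x; apply: cvgB; exact: (entire_vertical_continuous _ eH).2. Qed.

Let boundary_split x y s t : 0 <= s -> 0 <= t ->
  boundary x y s t = boundary x y (s / 2) (t / 2) + boundary (x + s / 2) y (s / 2) (t / 2) +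
    boundary x (y + t / 2) (s / 2) (t / 2) +
    boundary (x + s / 2) (y + t / 2) (s / 2) (t / 2).
Proof.
move=> s0 t0; rewrite /boundary.
have half (a b : R) : a + b / 2 + b / 2 = a + b by rewrite -addrA -splitr.
rewrite !half.
have Hu a b : 0 <= b -> \int[mu]_(r in `[a, a + b]) (u r y - u r (y + t)) =
   \int[mu]_(r in `[a, a + b]) (u r y - u r (y + t / 2)) +
   \int[mu]_(r in `[a, a + b]) (u r (y + t / 2) - u r (y + t)).
  move=> b0; rewrite -RintegralD//; try exact: (continuous_itv_integrable _ _ (@cu _ _)).
  by apply: eq_Rintegral => r _; ring.
have Hv a b : 0 <= b -> \int[mu]_(r in `[a, a + b]) (v (x + s) r - v x r) =
   \int[mu]_(r in `[a, a + b]) (v (x + s / 2) r - v x r) +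
   \int[mu]_(r in `[a, a + b]) (v (x + s) r - v (x + s / 2) r).
  move=> b0; rewrite -RintegralD//; try exact: (continuous_itv_integrable _ _ (@cv _ _)).
  by apply: eq_Rintegral => r _; ring.
rewrite (Rintegral_itv_split (b := x + s / 2) (@cu _ _)); [|lra..].
rewrite [X in _ - X = _](Rintegral_itv_split (b := y + t / 2) (@cv _ _)); [|lra..].
have s20 : 0 <= s / 2 by rewrite divr_ge0.
have t20 : 0 <= t / 2 by rewrite divr_ge0.
have := Hu (x + s / 2) _ s20; have := Hv (y + t / 2) _ t20; rewrite !half => -> ->.
rewrite (Hu _ _ s20) (Hv _ _ t20); ring.
Qed.

(** With derivative p + iq at the point, the affine part of H contributes q t to the horizontal
    difference and q s to the vertical one, by the Cauchy-Riemann equations. After integration both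
    become q s t and cancel; only the o(|h|) error times the side lengths remains. *)
Let boundary_small x0 y0 e : 0 < e -> exists2 d, 0 < d &
  forall x y s t, 0 <= s < d -> 0 <= t < d -> x <= x0 <= x + s ->
    y <= y0 <= y + t -> `|boundary x y s t| <= e * (s + t) ^+ 2.
Proof.
move=> e0; have /entireP/(_ (x0 +i* y0))[[p q] Hl] := eH.
have e20 : 0 < e / 2 by rewrite divr_gt0.
have [d d0 Hd] := Hl _ e20.
exists (d / 2); first by rewrite divr_gt0.
move=> x y s t /andP[s0 sd] /andP[t0 td] xx0 yy0.
have key a b : x <= a <= x + s -> y <= b <= y + t ->
    `|u a b - u x0 y0 - (p * (a - x0) - q * (b - y0))| <= e / 2 * (s + t) /\
    `|v a b - v x0 y0 - (p * (b - y0) + q * (a - x0))| <= e / 2 * (s + t).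
  move=> xa yb; pose h : R[i] := (a - x0) +i* (b - y0).
  have hst : cmod h <= s + t.
    apply: le_trans (cmod_le_ReIm _) _ => /=.
    by apply: lerD; rewrite ler_norml; lra.
  have hd : cmod h < d by apply: le_lt_trans hst _; lra.
  have := Hd h hd; have -> : x0 +i* y0 + h = a +i* b.
    by apply/eqP; rewrite eq_complex /=; apply/andP; split; apply/eqP; ring.
  move=> /le_trans/(_ (ler_wpM2l (ltW e20) hst)) Hh; split.
    apply: le_trans Hh; apply: le_trans (Re_le_cmod _).
    by rewrite !Re_addc !Re_oppc Re_mulc.
  apply: le_trans Hh; apply: le_trans (Im_le_cmod _).
  by rewrite !Im_addc !Im_oppc Im_mulc.
have Mu : `|\int[mu]_(r in `[x, x + s]) (u r y - u r (y + t)) - (q * t) * s| <=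
    e * (s + t) * s.
  apply: (Rintegral_itv_near_cst (@cu _ _) s0) => r xr.
  have [||k1 _] := key r y; [by []|lra|].
  have [||k2 _] := key r (y + t); [by []|lra|].
  move: k1 k2; rewrite !ler_norml => /andP[a1 a2] /andP[a3 a4]; apply/andP; split; lra.
have Mv : `|\int[mu]_(r in `[y, y + t]) (v (x + s) r - v x r) - (q * s) * t| <=
    e * (s + t) * t.
  apply: (Rintegral_itv_near_cst (@cv _ _) t0) => r xr.
  have [||_ k1] := key (x + s) r; [lra|by []|].
  have [||_ k2] := key x r; [lra|by []|].
  move: k1 k2; rewrite !ler_norml => /andP[a1 a2] /andP[a3 a4]; apply/andP; split; lra.
rewrite /boundary.
set A := Rintegral _ _ _ in Mu *; set B := Rintegral _ _ _ in Mv *.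
have -> : A - B = (A - q * t * s) - (B - q * s * t) by ring.
apply: le_trans (ler_normB _ _) _; apply: le_trans (lerD Mu Mv) _.
by rewrite le_eqVlt; apply/orP; left; apply/eqP; ring.
Qed.

(** Real part of Cauchy's theorem; applied to scalar multiples of H it carries the full complex
    statement. *)
Lemma goursat_rectangle (a b c d : R) : a <= b -> c <= d ->
  \int[mu]_(r in `[a, b]) (complex.Re (H (r +i* c)) - complex.Re (H (r +i* d))) =
  \int[mu]_(r in `[c, d]) (complex.Im (H (b +i* r)) - complex.Im (H (a +i* r))).
Proof.
move=> ab cd; apply/eqP; rewrite -subr_eq0; apply/eqP.
have := bisection_eq0 boundary_split boundary_small a c (s := b - a) (t := d - c).
by rewrite !subr_ge0 /boundary ![_ + (_ - _)]addrC !subrK; exact.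
Qed.

End goursat.

(** * Integrability and exhaustion of the line by intervals *)

Section integration_complements.
Context {R : realType}.
Local Notation mu := (@lebesgue_measure R).

Lemma integrable_dominated d (T : measurableType d) (m : {measure set T -> \bar R})
    (D : set T) (f g : T -> R) : measurable D -> measurable_fun D f ->
  (forall x, D x -> `|f x| <= g x) -> m.-integrable D (EFin \o g) ->
  m.-integrable D (EFin \o f).
Proof.
move=> mD mf fg; apply: le_integrable => //; first exact/measurable_EFinP.
by move=> x Dx /=; rewrite lee_fin (le_trans (fg x Dx))// ler_norm.
Qed.

Lemma integrable_measurable_real d (T : measurableType d) (m : {measure set T -> \bar R})
    (D : set T) (f : T -> R) : m.-integrable D (EFin \o f) -> measurable_fun D f.
Proof. by move=> /measurable_int/measurable_EFinP. Qed.

Lemma ge0_integrableP d (T : measurableType d) (m : {measure set T -> \bar R})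
    (f : T -> R) : measurable_fun setT f -> (forall x, 0 <= f x) ->
  m.-integrable setT (EFin \o f) <-> (\int[m]_x (f x)%:E < +oo)%E.
Proof.
move=> mf f0; split=> [/integrableP[_]|h]; last (apply/integrableP; split; first exact/measurable_EFinP).
  by under eq_integral do rewrite /= ger0_norm//.
by under eq_integral do rewrite /= ger0_norm//.
Qed.

Lemma integrable_realZ d (T : measurableType d) (m : {measure set T -> \bar R})
    (D : set T) (c : R) (f : T -> R) : measurable D -> m.-integrable D (EFin \o f) ->
  m.-integrable D (EFin \o (fun x => c * f x)).
Proof. by move=> mD /(integrableZl mD c). Qed.

Lemma integrable_realD d (T : measurableType d) (m : {measure set T -> \bar R})
    (D : set T) (f g : T -> R) : measurable D -> m.-integrable D (EFin \o f) ->
  m.-integrable D (EFin \o g) -> m.-integrable D (EFin \o (fun x => f x + g x)).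
Proof. by move=> mD fi gi; have := integrableD mD fi gi. Qed.

Lemma integrable_realB d (T : measurableType d) (m : {measure set T -> \bar R})
    (D : set T) (f g : T -> R) : measurable D -> m.-integrable D (EFin \o f) ->
  m.-integrable D (EFin \o g) -> m.-integrable D (EFin \o (fun x => f x - g x)).
Proof. by move=> mD fi gi; have := integrableB mD fi gi. Qed.

Lemma measurable_cmod d (T : measurableType d) (f : T -> R[i]) :
  measurable_fun setT (fun x => complex.Re (f x)) ->
  measurable_fun setT (fun x => complex.Im (f x)) ->
  measurable_fun setT (fun x => cmod (f x)).
Proof.
move=> mR mI; rewrite (_ : (fun _ => _) = @Num.sqrt R \o
  (fun x => complex.Re (f x) ^+ 2 + complex.Im (f x) ^+ 2)); last first.
  by apply/funext => x /=; rewrite cmodE.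
apply: measurableT_comp; first by apply: continuous_measurable_fun; exact: sqrt_continuous.
by apply: measurable_funD; exact: measurable_funX.
Qed.

Lemma ae_exists (P : R -> Prop) : {ae mu, forall x, P x} -> exists x, P x.
Proof.
move=> aP; have : ProperFilter (almost_everywhere mu).
  apply: ae_properfilter_algebraOfSetsType.
  have E : mu setT = +oo%E by have := @lebesgue_measure_itv R `]-oo, +oo[; rewrite set_itvNyy/= => ->.
  by change (0%R < mu setT)%E; rewrite E ltry.
by move=> PF; exact: (@filter_ex _ _ PF _ aP).
Qed.

(** A half-line has infinite measure, so N cannot exceed e on all of it. Extended real values are
    allowed because N will be the inner integral in Fubini's theorem. *)
Lemma integrable_small_value (N : R -> \bar R) (e r : R) : (forall x, 0 <= N x)%E ->
  mu.-integrable setT N -> 0 < e ->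
  (exists2 x, r <= x & (N x <= e%:E)%E) /\ (exists2 x, x <= r & (N x <= e%:E)%E).
Proof.
move=> N0 iN e0.
have big (D : set R) : measurable D -> mu D = +oo%E -> exists2 x, D x & (N x <= e%:E)%E.
  move=> mD Doo; apply/not_exists2P => H.
  have : (\int[mu]_(x in D) e%:E <= \int[mu]_x N x)%E.
    apply: le_trans (_ : \int[mu]_(x in D) N x <= _)%E; last first.
      by apply: ge0_subset_integral => //; exact: (measurable_int mu).
    apply: ge0_le_integral => //.
    - by move=> x _; rewrite lee_fin ltW.
    - by apply: measurable_funTS; exact: (measurable_int mu).
    - by move=> x Dx; case: (H x) => // /negP; rewrite -ltNge => /ltW.
  have -> : (\int[mu]_(x in D) e%:E = e%:E * mu D)%E :=
    @integral_cst _ (measurableTypeR R) R mu D mD e%:E.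
  rewrite Doo gt0_muley ?lte_fin// leye_eq => /eqP ioo.
  move/integrableP : iN => [_]; under eq_integral do rewrite gee0_abs//.
  by rewrite ioo.
split.
  have [|x /=] := big `[r, +oo[%classic (measurable_itv _).
    by rewrite lebesgue_measure_itv/= ltry.
  by rewrite in_itv/= andbT => rx ?; exists x.
have [|x /=] := big `]-oo, r]%classic (measurable_itv _).
  by rewrite lebesgue_measure_itv/= ltNyr.
by rewrite in_itv/= => rx ?; exists x.
Qed.

(** Dominated convergence with endpoints that are not prescribed: they will be points where some
    auxiliary function is small, known only to lie beyond n and -n. *)
Lemma Rintegral_cvg_setT (g : R -> R) (A B : nat -> R) : mu.-integrable setT (EFin \o g) ->
  (forall n, A n <= - n%:R) -> (forall n, n%:R <= B n) ->
  \int[mu]_(x in `[A n, B n]) g x @[n --> \oo] --> \int[mu]_x g x.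
Proof.
move=> ig An Bn; apply: fine_cvg; rewrite fineK; last exact: integrable_fin_num.
rewrite (_ : (fun n => _) = (fun n => \int[mu]_x ((g \_ `[A n, B n]) x)%:E)%E); last first.
  by apply/funext => n; rewrite integral_mkcond restrict_EFin.
apply: (@dominated_cvg _ (measurableTypeR R) R mu setT measurableT
  (fun n x => ((g \_ `[A n, B n]) x)%:E) (EFin \o g) (fun x => `|(g x)%:E|%E)) => //.
- move=> n; apply/measurable_EFinP; apply/(measurable_restrictT _ _).1 => //.
  by apply: measurable_funTS; exact: integrable_measurable_real ig.
- move=> x _; apply/fine_cvgP; split; first by near=> n.
  apply: cvg_near_cst; near=> n; rewrite /= patchE ifT// inE/= in_itv/=.
  have : `|x| <= n%:R by near: n; exact: nbhs_infty_ger.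
  by rewrite ler_norml => /andP[h1 h2]; rewrite (le_trans (An n))// (le_trans h2).
- exact: integrable_abse.
- move=> n x _; rewrite lee_fin patchE; case: ifP => // _.
  by rewrite normr0.
Unshelve. all: by end_near. Qed.

(** Each [-n, n] sits inside an interval on which the integral is at most M; monotone convergence
    then applies on the symmetric intervals. *)
Lemma ge0_integrable_bounded (g : R -> R) (M : R) : measurable_fun setT g ->
  (forall x, 0 <= g x) ->
  (forall n : nat, exists A B, [/\ A <= - n%:R, n%:R <= B, mu.-integrable `[A, B] (EFin \o g) &
     \int[mu]_(x in `[A, B]) g x <= M]) ->
  mu.-integrable setT (EFin \o g).
Proof.
move=> mg g0 H; apply/ge0_integrableP => //.
pose S n : set R := `[- n%:R, n%:R]%classic.
have ST : \bigcup_n S n = setT.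
  rewrite -subTset => x _; exists (Num.bound `|x|) => //=.
  by rewrite /S/= in_itv/= -ler_norml ltW// archi_boundP.
rewrite -ST; apply: le_lt_trans (ltry M).
have mS n : measurable (S n) by exact: measurable_itv.
have cS := @ge0_nondecreasing_set_cvg_integral _ (measurableTypeR R) _ S (EFin \o g) mu.
have {}cS : (\int[mu]_(x in S n) (g x)%:E @[n --> \oo] --> \int[mu]_(x in \bigcup_n S n) (g x)%:E)%E.
  apply: cS => //.
  - move=> m n mn; apply/subsetPset; apply: subset_itv; rewrite bnd_simp ?lerN2 ler_nat//.
  - by move=> n; apply: measurable_funTS; exact/measurable_EFinP.
  - by move=> n x _; rewrite lee_fin.
rewrite -(cvg_lim _ cS)//; apply: lime_le; first by apply/cvg_ex; eexists; exact: cS.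
near=> n; have [A [B [An Bn ig IM]]] := H n.
apply: (@le_trans _ _ (\int[mu]_(x in `[A, B]) (g x)%:E)%E).
  apply: ge0_subset_integral => //=; first exact: mS.
  - by apply: measurable_funTS; exact/measurable_EFinP.
  - by move=> x _; rewrite lee_fin.
  - by apply: subset_itv; rewrite bnd_simp.
rewrite -[X in (X <= _)%E]fineK ?lee_fin//; exact: integrable_fin_num.
Unshelve. all: by end_near. Qed.

End integration_complements.

(** * Shifting the line of integration *)

Section contour_shift.
Context {R : realType}.

Lemma sqr_le_max (c d y : R) : c <= y -> y <= d -> y ^+ 2 <= Num.max (c ^+ 2) (d ^+ 2).
Proof.
move=> cy yd; rewrite le_max; have [y0|y0] := leP 0 y; apply/orP; [right|left].
  by rewrite ler_pXn2r// nnegrE// (le_trans y0).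
by rewrite -[y ^+ 2]sqrrN -[c ^+ 2]sqrrN ler_pXn2r ?nnegrE//; lra.
Qed.

Local Notation mu := (@lebesgue_measure R).
Variables (H : R[i] -> R[i]) (k : R).
Hypothesis eH : entire H.
Hypothesis iH : (mu \x mu)%E.-integrable setT
  (EFin \o (fun p : R * R => cmod (H (p.1 +i* p.2)) * expR (- k * p.2 ^+ 2))).

Lemma ae_line_integrable : {ae mu, forall y, mu.-integrable setT
  (EFin \o (fun x => complex.Re (H (x +i* y))))}.
Proof.
apply: filterS (ae_integrable2 iH) => y /= iy.
have : mu.-integrable setT (EFin \o (fun x => expR (k * y ^+ 2) *
    (cmod (H (x +i* y)) * expR (- k * y ^+ 2)))).
  exact: (integrableZl measurableT _ iy).
apply: integrable_dominated => //.
  apply: continuous_measurable_fun.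
  exact: (entire_horizontal_continuous _ eH).1.
move=> x _; rewrite mulrCA -expRD mulNr subrr expR0 mulr1; exact: Re_le_cmod.
Qed.

Let N x := (\int[mu]_y (cmod (H (x +i* y)) * expR (- k * y ^+ 2))%:E)%E.

Let N0 x : (0 <= N x)%E.
Proof. by apply: integral_ge0 => y _; rewrite lee_fin mulr_ge0 ?cmod_ge0 ?expR_ge0. Qed.

Let iN : mu.-integrable setT N.
Proof. exact: (integrable_fubini_F iH). Qed.

Let vertical_segment_le c d : exists2 K, 0 < K & forall x e, (N x <= e%:E)%E ->
  `|\int[mu]_(y in `[c, d]) complex.Im (H (x +i* y))| <= K * e.
Proof.
pose m := Num.max (c ^+ 2) (d ^+ 2).
(* k may have either sign; since y^2 <= m on [c, d], this constant dominates exp(k y^2), the inverse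
   of the weight. *)
exists (expR (`|k| * m)); first exact: expR_gt0.
move=> x e Ne; set K := expR _.
have [cR cI] := entire_vertical_continuous x eH.
apply: le_trans (le_normr_Rintegral _ _) _ => //; first exact: continuous_itv_integrable.
have mw : measurable_fun setT (fun y => cmod (H (x +i* y)) * expR (- k * y ^+ 2)).
  apply: measurable_funM.
    by apply: measurable_cmod; exact: continuous_measurable_fun.
  apply: measurableT_comp => //; apply: measurable_funM => //; exact: measurable_funX.
have iI : mu.-integrable `[c, d] (EFin \o (fun y => `|complex.Im (H (x +i* y))|)).
  by apply: continuous_itv_integrable => y; apply: cvg_norm; exact: cI.
rewrite -lee_fin fineK; last exact: integrable_fin_num.
apply: (@le_trans _ _ (\int[mu]_y (K * (cmod (H (x +i* y)) * expR (- k * y ^+ 2)))%:E)%E); last first.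
  under eq_integral do rewrite EFinM.
  rewrite ge0_integralZl_EFin//; last 3 first.
  - by move=> y _; rewrite lee_fin mulr_ge0 ?cmod_ge0 ?expR_ge0.
  - exact/measurable_EFinP.
  - exact: expR_ge0.
  by rewrite EFinM; apply: lee_wpmul2l => //; rewrite lee_fin expR_ge0.
apply: (@le_trans _ _ (\int[mu]_(y in `[c, d]) (K * (cmod (H (x +i* y)) * expR (- k * y ^+ 2)))%:E)%E); last first.
  apply: ge0_subset_integral => //.
    by apply/measurable_EFinP; exact: measurable_funM.
  by move=> y _; rewrite lee_fin !mulr_ge0 ?cmod_ge0 ?expR_ge0.
apply: ge0_le_integral => //.
- exact: (measurable_int mu).
- by apply: measurable_funTS; apply/measurable_EFinP; exact: measurable_funM.
move=> y /=; rewrite in_itv/= => /andP[cy yd]; rewrite lee_fin mulrCA -expRD.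
apply: le_trans (Im_le_cmod _) _; rewrite ler_peMr ?cmod_ge0// -expR0 ler_expR.
rewrite mulNr subr_ge0; apply: le_trans (ler_wpM2r (sqr_ge0 _) (ler_norm k)) _.
by apply: ler_wpM2l => //; exact: sqr_le_max.
Qed.

Let line_diff_integrable a b y1 y2 : mu.-integrable `[a, b]
  (EFin \o (fun r => complex.Re (H (r +i* y1)) - complex.Re (H (r +i* y2)))).
Proof.
apply: continuous_itv_integrable => r; apply: cvgB;
  exact: (entire_horizontal_continuous _ eH).1.
Qed.

(* By Fubini the vertical integrals of |H| are integrable in the abscissa, hence small along
   abscissae tending to both infinities: the vertical sides can be chosen negligible. *)
Lemma horizontal_lines_close y1 y2 (e r : R) : 0 < e -> exists A B,
  [/\ A <= - r, r <= B & `|\int[mu]_(x in `[A, B])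
     (complex.Re (H (x +i* y1)) - complex.Re (H (x +i* y2)))| <= e].
Proof.
wlog y12 : y1 y2 / y1 <= y2 => [W|] e0.
  have [|/ltW y21] := leP y1 y2; first by move=> /W; exact.
  have [A [B [Ar rB AB]]] := W _ _ y21 e0; exists A, B; split => //.
  rewrite -normrN; congr (_ <= _): AB; congr (`| _ |).
  rewrite -mulN1r -RintegralZl//; apply: eq_Rintegral => x _.
  by rewrite mulN1r opprB.
have [K K0 HK] := vertical_segment_le y1 y2.
have e1 : 0 < e / 2 / K by rewrite !divr_gt0.
(* Cutting at 0 as well gives A <= 0 <= B, hence A <= B, whatever the sign of r. *)
have [_ [A Ar NA]] := integrable_small_value (Num.min (- r) 0) N0 iN e1.
have [[B rB NB] _] := integrable_small_value (Num.max r 0) N0 iN e1.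
move: Ar rB; rewrite le_min ge_max => /andP[Ar A0] /andP[rB B0].
exists A, B; split => //.
rewrite goursat_rectangle ?(le_trans A0)//.
have iv x : mu.-integrable `[y1, y2] (EFin \o (fun s => complex.Im (H (x +i* s)))).
  by apply: continuous_itv_integrable; exact: (entire_vertical_continuous _ eH).2.
rewrite RintegralB//; apply: le_trans (ler_normB _ _) _.
apply: le_trans (lerD (HK _ _ NB) (HK _ _ NA)) _.
by rewrite [K * _]mulrC divfK ?gt_eqF// -splitr.
Qed.

(** Along intervals exhausting the line the two integrals differ by at most e. Integrability in the
    plane and on the two lines stands in for pointwise decay of H. *)
Lemma contour_shift y1 y2 :
  mu.-integrable setT (EFin \o (fun x => complex.Re (H (x +i* y1)))) ->
  mu.-integrable setT (EFin \o (fun x => complex.Re (H (x +i* y2)))) ->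
  \int[mu]_x complex.Re (H (x +i* y1)) = \int[mu]_x complex.Re (H (x +i* y2)).
Proof.
move=> i1 i2; apply/eqP; rewrite -subr_eq0 -normr_eq0; apply/eqP/le_anti.
rewrite normr_ge0 andbT; apply/ler_addgt0Pr => e e0; rewrite add0r -RintegralB//.
have i12 := integrable_realB measurableT i1 i2.
have /choice[AB HAB] : forall n : nat, exists AB : R * R,
  [/\ AB.1 <= - n%:R, n%:R <= AB.2 & `|\int[mu]_(x in `[AB.1, AB.2])
     (complex.Re (H (x +i* y1)) - complex.Re (H (x +i* y2)))| <= e].
  by move=> n; have [A [B ?]] := horizontal_lines_close y1 y2 n%:R e0; exists (A, B).
have cAB : `|\int[mu]_(x in `[(AB n).1, (AB n).2])
    (complex.Re (H (x +i* y1)) - complex.Re (H (x +i* y2)))| @[n --> \oo] -->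
    `|\int[mu]_x (complex.Re (H (x +i* y1)) - complex.Re (H (x +i* y2)))|.
  apply: cvg_norm; apply: (Rintegral_cvg_setT i12) => n; by case: (HAB n).
rewrite -(cvg_lim _ cAB)//; apply: limr_le; first by apply/cvg_ex; eexists; exact: cAB.
by apply: nearW => n; case: (HAB n).
Qed.

(** Fubini provides some line Im z = y with an integrable real part. On arbitrarily large intervals
    the integral over the real axis differs from the one over that line by at most 1, so it stays
    bounded, and positivity turns boundedness into integrability. This is how a plane integral
    controls the null set formed by the real line. *)
Lemma ge0_real_line_integrable : (forall x : R, 0 <= complex.Re (H (x +i* 0))) ->
  mu.-integrable setT (EFin \o (fun x => complex.Re (H (x +i* 0)))).
Proof.
move=> H0; have [y iy] := ae_exists ae_line_integrable.
apply: (ge0_integrable_bounded (M := \int[mu]_x `|complex.Re (H (x +i* y))| + 1)) => //.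
  by apply: continuous_measurable_fun; exact: (entire_horizontal_continuous _ eH).1.
move=> n; have [A [B [An nB AB]]] := horizontal_lines_close 0 y n%:R ltr01.
have iAB s : mu.-integrable `[A, B] (EFin \o (fun x => complex.Re (H (x +i* s)))).
  by apply: continuous_itv_integrable; exact: (entire_horizontal_continuous _ eH).1.
exists A, B; split => //.
move: AB; rewrite RintegralB// => /(le_trans (ler_norm _)); rewrite lerBlDl => /le_trans; apply.
rewrite lerD2r; apply: le_trans (ler_norm _) _.
apply: le_trans (le_normr_Rintegral _ _) _ => //.
rewrite fine_le//.
- by apply: integrable_fin_num => //; have := integrable_abse (iAB y).
- by apply: integrable_fin_num => //; have := integrable_abse iy.
apply: ge0_subset_integral => //; first by have := integrable_abse iy => /measurable_int.
Qed.

End contour_shift.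

(** * Hermite polynomials *)

Section gaussian_weights.
Context {R : realType}.
Local Notation mu := (@lebesgue_measure R).
Local Notation gauss b := (fun x : R => expR (- (b * x ^+ 2))).

Lemma measurable_gauss b : measurable_fun setT (gauss b).
Proof.
apply: measurableT_comp => //; apply: measurableT_comp => //.
by apply: measurable_funM => //; exact: measurable_funX.
Qed.

Lemma measurable_gauss1 : measurable_fun setT (fun x : R => expR (- x ^+ 2)).
Proof.
have := measurable_gauss 1; congr (measurable_fun _ _).
by apply/funext => x; rewrite mul1r.
Qed.

Lemma integrable_gauss b : 0 < b -> mu.-integrable setT (EFin \o gauss b).
Proof.
move=> b0; pose s := Num.sqrt (2 * b)^-1.
have b20 : 0 < (2 * b)^-1 by rewrite invr_gt0 mulr_gt0.
have s0 : s != 0 by rewrite gt_eqF// sqrtr_gt0.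
have ss : s ^+ 2 = (2 * b)^-1 by rewrite sqr_sqrtr// ltW.
have p0 : 0 < normal_peak s by exact: normal_peak_gt0.
have := integrable_realZ (normal_peak s)^-1 measurableT (integrable_normal_pdf 0 s).
congr (integrable _ _ _); apply/funext => x /=; congr (_%:E).
rewrite normal_pdfE// mulrA mulVf ?gt_eqF// mul1r /normal_fun subr0 ss.
by congr expR; field; rewrite gt_eqF.
Qed.

Lemma horner_cmod_le (p : {poly R[i]}) (e : R) : 0 < e -> exists2 C : R, 0 <= C &
  forall z, cmod p.[z] <= C * expR (e * cmod z ^+ 2).
Proof.
elim/poly_ind: p e => [|p c IH] e e0.
  by exists 0 => // z; rewrite horner0 cmod0 mul0r.
have e20 : 0 < e / 2 by rewrite divr_gt0.
have [C C0 HC] := IH _ e20.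
(* The factor 1 + 2/e bounds |z| exp(-e/2 |z|^2), through exp u >= 1 + u and w <= 1 + w^2. *)
exists (C * (1 + 2 / e) + cmod c).
  by rewrite addr_ge0 ?cmod_ge0// mulr_ge0// addr_ge0// divr_ge0// ltW.
move=> z; rewrite hornerMXaddC; apply: le_trans (cmodD_le _ _) _.
have z2 : 0 <= cmod z ^+ 2 by rewrite sqr_ge0.
rewrite mulrDl; apply: lerD; last first.
  rewrite ler_peMr ?cmod_ge0// -expR0 ler_expR mulr_ge0// ltW//.
have -> : e * cmod z ^+ 2 = e / 2 * cmod z ^+ 2 + e / 2 * cmod z ^+ 2.
  by rewrite -mulrDl -splitr.
rewrite cmodM expRD mulrACA; apply: ler_pM; rewrite ?cmod_ge0//.
set w := cmod z in z2 *.
have h1 := expR_ge1Dx (e / 2 * w ^+ 2).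
apply: (@le_trans _ _ ((1 + 2 / e) * (1 + e / 2 * w ^+ 2))); last first.
  by rewrite ler_wpM2l// addr_ge0// divr_ge0// ltW.
have -> : (1 + 2 / e) * (1 + e / 2 * w ^+ 2) = 1 + w ^+ 2 + 2 / e + e / 2 * w ^+ 2.
  by field; rewrite gt_eqF.
have e1 : 0 <= 2 / e by rewrite divr_ge0// ltW.
have e3 : 0 <= e / 2 * w ^+ 2 by rewrite mulr_ge0// ltW.
have := sqr_ge0 (w - 1); rewrite sqrrB1; lra.
Qed.

Lemma horner_real (p : {poly R}) (x : R) :
  (map_poly (real_complex R) p).[x%:C] = (p.[x])%:C.
Proof. by rewrite horner_map. Qed.

Lemma horner_norm_le (p : {poly R}) (e : R) : 0 < e -> exists2 C : R, 0 <= C &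
  forall x, `|p.[x]| <= C * expR (e * x ^+ 2).
Proof.
move=> /(horner_cmod_le (map_poly (real_complex R) p))[C C0 HC]; exists C => // x.
by have := HC x%:C; rewrite horner_real !cmod_real real_normK// num_real.
Qed.

Lemma measurable_horner (p : {poly R}) : measurable_fun setT (horner p).
Proof. by apply: continuous_measurable_fun; exact: continuous_horner. Qed.

Lemma expR_absorb (a b t : R) : expR (a * t) * expR (- (b * t)) = expR (- ((b - a) * t)).
Proof. by rewrite -expRD; congr expR; ring. Qed.

Lemma integrable_horner_gauss (p : {poly R}) b : 0 < b ->
  mu.-integrable setT (EFin \o (fun x => p.[x] * expR (- (b * x ^+ 2)))).
Proof.
move=> b0; have b20 : 0 < b / 2 by rewrite divr_gt0.
have [C C0 HC] := horner_norm_le p b20.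
apply: (integrable_dominated _ _ _ (integrable_realZ C measurableT (integrable_gauss b20))) => //.
  by apply: measurable_funM; [exact: measurable_horner|exact: measurable_gauss].
move=> x _; rewrite normrM [`|expR _|]ger0_norm ?expR_ge0//.
apply: le_trans (ler_wpM2r (expR_ge0 _) (HC x)) _.
by rewrite -[leLHS]mulrA expR_absorb (_ : b - b / 2 = b / 2)//; field.
Qed.

(** The fundamental theorem of calculus on [A, B], with endpoints chosen where the integrable
    function F is small, so that no limit of F at infinity has to be established. *)
Lemma Rintegral_derive_eq0 (F f : R -> R) : (forall x : R, is_derive x (1 : R) F (f x)) ->
  continuous f -> mu.-integrable setT (EFin \o F) ->
  mu.-integrable setT (EFin \o f) -> \int[mu]_x f x = 0.
Proof.
move=> dF cf iF if_; apply/eqP; rewrite -normr_eq0; apply/eqP/le_anti.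
rewrite normr_ge0 andbT; apply/ler_addgt0Pr => e e0; rewrite add0r.
have cF : continuous F.
  by move=> x; apply: differentiable_continuous; apply/derivable1_diffP; case: (dF x).
have iN : mu.-integrable setT (fun x => `|(F x)%:E|)%E by exact: integrable_abse.
have e20 : 0 < e / 2 by rewrite divr_gt0.
have /choice[AB HAB] : forall n : nat, exists AB : R * R,
  [/\ AB.1 <= - n%:R, n%:R <= AB.2 & `|\int[mu]_(x in `[AB.1, AB.2]) f x| <= e].
  move=> n.
  (* The shift by 1 ensures A < B also for n = 0. *)
  have [_ [A Ar NA]] := integrable_small_value (- (n%:R + 1)) (fun x => abse_ge0 (F x)%:E) iN e20.
  have [[B rB NB] _] := integrable_small_value (n%:R + 1) (fun x => abse_ge0 (F x)%:E) iN e20.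
  have n0 : 0 <= n%:R :> R by [].
  exists (A, B); split => /=; [lra|lra|].
  have AltB : A < B by lra.
  rewrite /Rintegral (@continuous_FTC2 _ f F)//=.
  - apply: le_trans (ler_normB _ _) _; rewrite [leRHS]splitr.
    by apply: lerD; rewrite -lee_fin.
  - exact: continuous_subspaceT.
  - split.
    + by move=> x _; case: (dF x).
    + by apply: cvg_at_right_filter; exact: cF.
    + by apply: cvg_at_left_filter; exact: cF.
  - by move=> x _; rewrite derive1E; have [_ ->] := dF x.
have cAB : `|\int[mu]_(x in `[(AB n).1, (AB n).2]) f x| @[n --> \oo] -->
    `|\int[mu]_x f x|.
  apply: cvg_norm; apply: (Rintegral_cvg_setT if_) => n; by case: (HAB n).
rewrite -(cvg_lim _ cAB)//; apply: limr_le; first by apply/cvg_ex; eexists; exact: cAB.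
by apply: nearW => n; case: (HAB n).
Qed.

(** The integrand is the derivative of p(x) exp(-b x^2). *)
Lemma gauss_by_parts (p : {poly R}) b : 0 < b ->
  \int[mu]_x ((p^`() - (2 * b) *: ('X * p)).[x] * expR (- (b * x ^+ 2))) = 0.
Proof.
move=> b0.
apply: (@Rintegral_derive_eq0 (fun x => p.[x] * expR (- (b * x ^+ 2)))).
- move=> x.
  have dg : is_derive x 1 (fun x : R => expR (- (b * x ^+ 2))) (- (2 * b) * x * expR (- (b * x ^+ 2))).
    have dq : is_derive x 1 (fun x : R => - (b * x ^+ 2)) (- (2 * b) * x).
      have := is_derive_poly (- b *: 'X^2) x.
      rewrite derivZ derivXn !hornerE/= => H.
      have -> : (fun x : R => - (b * x ^+ 2)) = horner (- b *: 'X^2).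
        by apply/funext => y; rewrite hornerZ hornerXn mulNr.
      by move: H; congr (is_derive _ _ _ _); ring.
    have := @is_derive1_comp _ expR (fun x : R => - (b * x ^+ 2)) x _ _ (is_derive_expR _) dq.
    by congr (is_derive _ _ _ _); rewrite mulrC.
  have := is_deriveM (is_derive_poly p x) dg.
  congr (is_derive _ _ _ _).
  by rewrite /GRing.scale/= hornerD hornerN hornerZ hornerM hornerX; ring.
- move=> x; apply: continuousM; first exact: continuous_horner.
  apply: (@continuous_comp _ _ _ (fun x : R => - (b * x ^+ 2)) expR); last exact: continuous_expR.
  have -> : (fun x : R => - (b * x ^+ 2)) = horner (- b *: 'X^2).
    by apply/funext => y; rewrite hornerZ hornerXn mulNr.
  exact: continuous_horner.
- exact: integrable_horner_gauss.
- exact: integrable_horner_gauss.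
Qed.

Lemma integrable_gauss2 a b : 0 < a -> 0 < b -> (mu \x mu)%E.-integrable setT
  (EFin \o (fun p : R * R => expR (- (a * p.1 ^+ 2)) * expR (- (b * p.2 ^+ 2)))).
Proof.
move=> a0 b0; apply/integrable12ltyP.
  apply/measurable_EFinP; apply: measurable_funM.
    exact: (measurableT_comp (measurable_gauss a) measurable_fst).
  exact: (measurableT_comp (measurable_gauss b) measurable_snd).
have [ia ib] := (integrable_gauss a0, integrable_gauss b0).
pose I := (\int[mu]_y (expR (- (b * y ^+ 2)))%:E)%E.
have If : I \is a fin_num by exact: integrable_fin_num.
rewrite (_ : (\int[_]_x _)%E = (\int[mu]_x ((expR (- (a * x ^+ 2)))%:E * (fine I)%:E))%E).
  rewrite integralZr// -[X in (X * _)%E]fineK; last exact: integrable_fin_num.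
  by rewrite -EFinM ltry.
apply: eq_integral => x _; rewrite fineK//.
under eq_integral => y _ do rewrite /= ger0_norm ?mulr_ge0 ?expR_ge0// EFinM.
by rewrite integralZl.
Qed.

End gaussian_weights.

(** * Recurrence and derivative of the orthonormal Hermite polynomials *)

Section hermite_recurrences.
Context {R : realType}.
Local Notation mu := (@lebesgue_measure R).

Definition gauss_mean (p : {poly R}) : R := \int[mu]_x (p.[x] * expR (- x ^+ 2)).
Local Notation E := gauss_mean.

Lemma integrable_horner_gauss1 (p : {poly R}) :
  mu.-integrable setT (EFin \o (fun x => p.[x] * expR (- x ^+ 2))).
Proof.
have := integrable_horner_gauss p (@ltr01 R); congr (integrable _ _ _).
by apply/funext => x /=; rewrite mul1r.
Qed.

Lemma gauss_meanD p q : E (p + q) = E p + E q.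
Proof.
rewrite /E -RintegralD//; [|exact: integrable_horner_gauss1..].
by apply: eq_Rintegral => x _; rewrite hornerD mulrDl.
Qed.

Lemma gauss_meanZ c p : E (c *: p) = c * E p.
Proof.
rewrite /E -RintegralZl//; last exact: integrable_horner_gauss1.
by apply: eq_Rintegral => x _; rewrite hornerZ mulrA.
Qed.

Lemma gauss_meanB p q : E (p - q) = E p - E q.
Proof. by rewrite -scaleN1r gauss_meanD gauss_meanZ mulN1r. Qed.

Lemma gauss_mean_deriv p : E p^`() = 2 * E ('X * p).
Proof.
apply/eqP; rewrite -subr_eq0 -gauss_meanZ -gauss_meanB; apply/eqP.
rewrite -[RHS](gauss_by_parts p (@ltr01 R)).
by apply: eq_Rintegral => x _; rewrite mul1r mulr1.
Qed.

Variable h : nat -> {poly R}.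
Hypothesis hh : orthonormal_hermite h.

Let sz k : size (h k) = k.+1. Proof. by case: hh. Qed.
Let lead_gt0 k : 0 < lead_coef (h k). Proof. by case: hh. Qed.

Lemma hermite_orthonormal k m : E (h k * h m) = (k == m)%:R.
Proof.
have [_ _ ort] := hh; rewrite /E /Rintegral.
by under eq_integral do rewrite hornerM; rewrite ort.
Qed.

Let peel n (q : {poly R}) : (size q <= n.+1)%N ->
  exists c r, q = c *: h n + r /\ (size r <= n)%N.
Proof.
move=> qn; exists (q`_n / lead_coef (h n)), (q - (q`_n / lead_coef (h n)) *: h n).
split; first by rewrite addrC subrK.
apply/leq_sizeP => j; rewrite leq_eqVlt => /predU1P[<-|nj].
  rewrite coefB coefZ /lead_coef sz/= divfK ?subrr//.
  by have := lead_gt0 n; rewrite /lead_coef sz/= => /gt_eqF ->.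
rewrite coefB coefZ [(h n)`_j]nth_default ?sz// mulr0 subr0 nth_default//.
exact: leq_trans qn nj.
Qed.

Let low k (q : {poly R}) : (size q <= k)%N -> E (h k * q) = 0.
Proof.
suff H n : (n <= k)%N -> forall q : {poly R}, (size q <= n)%N -> E (h k * q) = 0 by exact: H.
elim: n => [_ {}q|n IH nk {}q qn].
  rewrite leqn0 size_poly_eq0 => /eqP ->.
  by rewrite mulr0 -(scale0r 0) gauss_meanZ mul0r.
have [c [r [-> rn]]] := peel qn.
rewrite mulrDr -scalerAr gauss_meanD gauss_meanZ hermite_orthonormal gtn_eqF// mulr0 add0r.
by apply: IH => //; exact: ltnW.
Qed.

(** Pairing with the top polynomial isolates its coefficient, which must vanish; the degree then
    drops. *)
Let ortho_eq0 n (q : {poly R}) : (size q <= n)%N ->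
  (forall j, (j < n)%N -> E (h j * q) = 0) -> q = 0.
Proof.
elim: n q => [q|n IH q qn Hq]; first by rewrite leqn0 size_poly_eq0 => /eqP.
have [c [r [qE rn]]] := peel qn.
have : E (h n * q) = 0 by exact: Hq.
rewrite qE mulrDr -scalerAr gauss_meanD gauss_meanZ hermite_orthonormal eqxx mulr1.
rewrite low// addr0 => c0; rewrite c0 scale0r add0r in qE *.
by apply: IH => // j jn; rewrite -qE Hq// ltnS ltnW.
Qed.

(* [(h k.+1)^`()] is orthogonal to [h j] for [j < k], by parts, hence equals [c k *: h k]. *)
Let c k := E (h k * (h k.+1)^`()).

Let size_deriv k : (size (h k)^`() <= k)%N.
Proof. by have := lt_size_deriv (p := h k); rewrite -size_poly_eq0 sz ltnS; exact. Qed.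

Let by_parts p q : E (p * q^`()) = 2 * E ('X * p * q) - E (q * p^`()).
Proof.
have := gauss_mean_deriv (p * q); rewrite derivM gauss_meanD mulrA => <-.
by rewrite [p^`() * q]mulrC; ring.
Qed.

Let derivE k : (h k.+1)^`() = c k *: h k.
Proof.
apply/eqP; rewrite -subr_eq0; apply/eqP; apply: (@ortho_eq0 k.+1).
  rewrite (leq_trans (size_polyD _ _))// geq_max size_deriv size_polyN.
  by rewrite (leq_trans (size_scale_leq _ _))// sz.
move=> j; rewrite ltnS leq_eqVlt => /predU1P[->|jk].
  by rewrite mulrBr -scalerAr gauss_meanB gauss_meanZ hermite_orthonormal eqxx mulr1 subrr.
rewrite mulrBr -scalerAr gauss_meanB gauss_meanZ hermite_orthonormal ltn_eqF// mulr0 subr0.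
rewrite by_parts low; last by rewrite (leq_trans (size_deriv _))// ltnW// ltnW.
rewrite subr0 [_ * h k.+1]mulrC low ?mulr0//.
by rewrite (leq_trans (size_polyMleq _ _))// size_polyX sz /= addnS/=.
Qed.

(** The off-diagonal Jacobi coefficients of the weight exp(-x^2). The value at 0 is 0, which
    silences the term in [h k.-1] when k = 0. *)
Definition hermite_alpha (k : nat) : R := Num.sqrt (k%:R / 2).
Local Notation al := hermite_alpha.

Let a k := if k is k'.+1 then c k' / 2 else 0.

(** Both sides have degree at most k + 1, so it suffices to pair them with h_j for j <= k + 1.
    Multiplication by X is symmetric, which disposes of j < k - 1; the diagonal term E(x h_k^2)
    vanishes by parts, h_k being orthogonal to its derivative. *)
Let rec0 k : 'X * h k = a k.+1 *: h k.+1 + a k *: h k.-1.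
Proof.
have XE j : E ('X * h j * h j.+1) = a j.+1.
  have := by_parts (h j) (h j.+1); rewrite -/(c j) low; last first.
    exact: leq_trans (size_deriv _) _.
  by rewrite subr0 /= => ->; field.
apply/eqP; rewrite -subr_eq0; apply/eqP; apply: (@ortho_eq0 k.+2).
  have s2 : (size (a k *: h k.-1) <= k.+2)%N.
    rewrite (leq_trans (size_scale_leq _ _))// sz; by case: (k) => // ?; exact: leqW.
  rewrite (leq_trans (size_polyD _ _))// geq_max size_polyN.
  rewrite (leq_trans (size_polyD _ _)) ?andbT//; last first.
    by rewrite geq_max s2 (leq_trans (size_scale_leq _ _))// sz.
  by rewrite (leq_trans (size_polyMleq _ _))// size_polyX sz.
move=> j jk; rewrite mulrBr mulrDr -!scalerAr gauss_meanB gauss_meanD !gauss_meanZ.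
rewrite !hermite_orthonormal.
have XEk : E ('X * h k * h k) = 0.
  have := by_parts (h k) (h k); rewrite low//; lra.
have nk2 (i : nat) : (i == i.+2) = false by rewrite ltn_eqF.
move: jk; rewrite ltnS leq_eqVlt => /predU1P[->|].
  have -> : h k.+1 * ('X * h k) = 'X * h k * h k.+1 by ring.
  have -> : (k.+1 == k.-1) = false by case: (k) => // ?; rewrite gtn_eqF.
  by rewrite XE eqxx; rewrite /= !(mulr1, mulr0, mul0r, addr0, add0r) ?subrr ?subr0//.
rewrite ltnS leq_eqVlt => /predU1P[->|jk].
  have -> : h k * ('X * h k) = 'X * h k * h k by ring.
  rewrite XEk ltn_eqF//; case: (k) => [|m]; first by rewrite mul0r mulr0 addr0 subrr.
  have -> : (m.+1 == m.+1.-1) = false by rewrite gtn_eqF.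
  by rewrite !mulr0 addr0 subrr.
have [k0 kE] : exists m, k = m.+1 by case: (k) jk => // m _; exists m.
rewrite kE /= in jk *; move: jk; rewrite ltnS leq_eqVlt => /predU1P[->|jk].
  have -> : h k0 * ('X * h k0.+1) = 'X * h k0 * h k0.+1 by ring.
  by rewrite XE nk2 eqxx; rewrite /= !(mulr1, mulr0, mul0r, addr0, add0r) ?subrr ?subr0//.
have -> : h j * ('X * h k0.+1) = h k0.+1 * ('X * h j) by ring.
rewrite low; last first.
  by rewrite (leq_trans (size_polyMleq _ _))// size_polyX sz.
rewrite /= (ltn_eqF jk) (_ : (j == k0.+2) = false); first by rewrite !mulr0 addr0 subrr.
by rewrite ltn_eqF// ltnW// ltnW.
Qed.

(** Leading coefficients in the recurrence and in the derivative formula give l_k = a l_{k+1} and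
    (k+1) l_{k+1} = 2 a l_k with a = a_{k+1}. Hence a^2 = (k+1)/2, and the positive leading
    coefficients fix the sign. *)
Let aE k : a k = al k.
Proof.
case: k => [|k]; first by rewrite /al mul0r sqrtr0.
have L1 : lead_coef (h k) = a k.+1 * lead_coef (h k.+1).
  have := congr1 (fun p : {poly R} => p`_k.+1) (rec0 k).
  rewrite coefXM coefD !coefZ /lead_coef !sz /= => ->.
  rewrite [X in _ + _ * X](_ : _ = 0) ?mulr0 ?addr0//.
  by apply: nth_default; rewrite sz; case: (k) => // m; exact: leqW.
have L2 : lead_coef (h k.+1) * k.+1%:R = c k * lead_coef (h k).
  have := congr1 (fun p : {poly R} => p`_k) (derivE k).
  by rewrite coef_deriv coefZ /lead_coef !sz /= => <-; rewrite mulr_natr.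
have l1 := lead_gt0 k.+1; have l0 := lead_gt0 k.
have a0 : 0 < a k.+1 by rewrite L1 (pmulr_lgt0 _ l1) in l0.
have ck : c k = 2 * a k.+1 by rewrite /a; field.
rewrite /al -[LHS](ger0_norm (ltW a0)) -sqrtr_sqr; congr Num.sqrt.
apply: (mulfI (lt0r_neq0 l1)).
have -> : lead_coef (h k.+1) * (k.+1%:R / 2) = c k * lead_coef (h k) / 2.
  by rewrite -L2 mulrA.
by rewrite L1 ck; field.
Qed.

Lemma hermite_recurrence k :
  'X * h k = hermite_alpha k.+1 *: h k.+1 + hermite_alpha k *: h k.-1.
Proof. by rewrite rec0 !aE. Qed.

Lemma hermite_derivative k : (h k)^`() = (2 * hermite_alpha k) *: h k.-1.
Proof.
case: k => [|k].
  apply/eqP; rewrite -aE /= mulr0 scale0r -size_poly_eq0 -leqn0; exact: size_deriv.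
by rewrite derivE -aE /=; congr (_ *: _); field.
Qed.

End hermite_recurrences.

(** * Gaussian means of complex polynomials *)

Section complex_poly_gauss.
Context {R : realType}.
Local Notation mu := (@lebesgue_measure R).
Implicit Types (p q : {poly R[i]}) (b : R).

Lemma Re_natmul (z : R[i]) n : complex.Re (z *+ n) = complex.Re z *+ n.
Proof. by elim: n => [|n IH]; rewrite ?mulr0n// !mulrS Re_addc IH. Qed.

Lemma horner_Re p (t : R) : complex.Re p.[t%:C] = (map_poly (@complex.Re R) p).[t].
Proof.
rewrite horner_coef (@horner_coef_wide _ (size p)); last exact: size_poly.
rewrite (big_morph (@complex.Re R) (@Re_addc R) (erefl _)).
apply: eq_bigr => i _; rewrite coef_map_id0// -rmorphXn Re_mulc/= mulr0 subr0.
by [].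
Qed.

Lemma integrable_hornerC_gauss p b : 0 < b ->
  mu.-integrable setT (EFin \o (fun t => complex.Re p.[t%:C] * expR (- (b * t ^+ 2)))).
Proof.
move=> b0; have := integrable_horner_gauss (map_poly (@complex.Re R) p) b0.
by congr (integrable _ _ _); apply/funext => t /=; rewrite horner_Re.
Qed.

Definition gauss_mean_Re b p : R := \int[mu]_t (complex.Re p.[t%:C] * expR (- (b * t ^+ 2))).

Lemma gauss_mean_ReD b p q : 0 < b ->
  gauss_mean_Re b (p + q) = gauss_mean_Re b p + gauss_mean_Re b q.
Proof.
move=> b0; rewrite /gauss_mean_Re -RintegralD//; [|exact: integrable_hornerC_gauss..].
by apply: eq_Rintegral => t _; rewrite hornerD Re_addc mulrDl.
Qed.

Lemma gauss_mean_ReZ b (c : R) p : 0 < b ->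
  gauss_mean_Re b (c%:C *: p) = c * gauss_mean_Re b p.
Proof.
move=> b0; rewrite /gauss_mean_Re -RintegralZl//; last exact: integrable_hornerC_gauss.
by apply: eq_Rintegral => t _; rewrite hornerZ Re_mulc/= mul0r subr0 -mulrA.
Qed.

Lemma gauss_mean_Re_by_parts b p : 0 < b ->
  gauss_mean_Re b p^`() = 2 * b * gauss_mean_Re b ('X * p).
Proof.
move=> b0; apply/eqP; rewrite -subr_eq0 -gauss_mean_ReZ// -mulN1r.
rewrite -(gauss_mean_ReZ (-1) _ b0) -gauss_mean_ReD//; apply/eqP.
rewrite -[RHS](gauss_by_parts (map_poly (@complex.Re R) p) b0).
apply: eq_Rintegral => t _; congr (_ * _).
rewrite !(hornerD, hornerZ, hornerM, hornerX) !Re_addc !Re_mulc /=.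
have -> : (map_poly (@complex.Re R) p)^`() = map_poly (@complex.Re R) p^`().
  by apply/polyP => i; rewrite coef_deriv !coef_map_id0// coef_deriv Re_natmul.
rewrite hornerN hornerZ hornerM hornerX -!horner_Re; ring.
Qed.

End complex_poly_gauss.

Section poly_gauss_shift.
Context {R : realType}.
Local Notation mu := (@lebesgue_measure R).
Variables (Q : {poly R[i]}) (b : R).
Hypothesis b0 : 0 < b.

Let H z := Q.[z] * cexp ((- b)%:C * z ^+ 2).

Let eH : entire H.
Proof.
have e1 : entire (fun z : R[i] => (- b)%:C * z ^+ 2).
  exact: (entireM (entire_cst _) (entireX 2 entire_id)).
exact: (entireM (entire_horner Q) (entire_comp entire_cexp e1)).
Qed.

Let bound : exists2 C : R, 0 <= C & forall x y : R,
  cmod (H (x +i* y)) <= C * expR (- (b / 2 * x ^+ 2)) * expR (3 * b / 2 * y ^+ 2).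
Proof.
have b20 : 0 < b / 2 by rewrite divr_gt0.
have [C C0 HC] := horner_cmod_le Q b20; exists C => // x y.
rewrite cmodM cmod_cexp; apply: le_trans (ler_wpM2r (expR_ge0 _) (HC _)) _.
rewrite sqr_cmod/= -!mulrA -!expRD; apply: ler_wpM2l => //; rewrite ler_expR.
by rewrite le_eqVlt; apply/orP; left; apply/eqP; field.
Qed.

Lemma poly_gauss_line_integrable y : mu.-integrable setT
  (EFin \o (fun x => complex.Re (Q.[x +i* y] * cexp ((- b)%:C * (x +i* y) ^+ 2)))).
Proof.
have [C C0 HC] := bound; have b20 : 0 < b / 2 by rewrite divr_gt0.
apply: (integrable_dominated _ _ _ (integrable_realZ (C * expR (3 * b / 2 * y ^+ 2))
  measurableT (integrable_gauss b20))) => //.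
  by apply: continuous_measurable_fun; exact: (entire_horizontal_continuous y eH).1.
by move=> x _; apply: le_trans (Re_le_cmod _) _; rewrite mulrAC; exact: HC.
Qed.

Lemma poly_gauss_shift (y : R) :
  \int[mu]_x (complex.Re Q.[x%:C] * expR (- (b * x ^+ 2))) =
  \int[mu]_x complex.Re (Q.[x +i* y] * cexp ((- b)%:C * (x +i* y) ^+ 2)).
Proof.
have b20 : 0 < b / 2 by rewrite divr_gt0.
have [C C0 HC] := bound.
(* Off the real axis H grows at most like exp(3b/2 t^2): b from the Gaussian and b/2 from Q. The
   weight exp(-2b t^2) leaves exp(-b/2 t^2). *)
have iH : (mu \x mu)%E.-integrable setT
    (EFin \o (fun p : R * R => cmod (H (p.1 +i* p.2)) * expR (- (2 * b) * p.2 ^+ 2))).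
  apply: (integrable_dominated _ _ _ (integrable_realZ C measurableT (integrable_gauss2 b20 b20))) => //.
    apply: measurable_funM; first exact: measurable_cmod (entire_measurable eH).1 (entire_measurable eH).2.
    apply: measurableT_comp => //; apply: measurable_funM => //.
    by apply: measurable_funX; exact: measurable_snd.
  move=> [x t] _ /=; rewrite ger0_norm ?mulr_ge0 ?cmod_ge0 ?expR_ge0//.
  apply: le_trans (ler_wpM2r (expR_ge0 _) (HC _ _)) _.
  rewrite -!mulrA -!expRD; apply: ler_wpM2l => //; rewrite ler_expR.
  by rewrite le_eqVlt; apply/orP; left; apply/eqP; field.
rewrite -(contour_shift eH iH (poly_gauss_line_integrable 0) (poly_gauss_line_integrable y)).
apply: eq_Rintegral => x _.
rewrite /H (_ : (- b)%:C * (x +i* 0) ^+ 2 = (- (b * x ^+ 2))%:C); last first.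
  by apply/eqP; rewrite eq_complex/=; apply/andP; split; apply/eqP; ring.
by rewrite cexp_real Re_mulc/= mulr0 subr0.
Qed.

End poly_gauss_shift.

(** * A Mehler-type integral *)

Section hermite_mehler.
Context {R : realType}.
Local Notation mu := (@lebesgue_measure R).
Variable h : nat -> {poly R}.
Hypothesis hh : orthonormal_hermite h.

Definition hermiteC (k : nat) : {poly R[i]} := map_poly (real_complex R) (h k).

Lemma hermiteC_recurrence k : 'X * hermiteC k =
  (@hermite_alpha R k.+1)%:C *: hermiteC k.+1 + (@hermite_alpha R k)%:C *: hermiteC k.-1.
Proof.
have := congr1 (map_poly (real_complex R)) (hermite_recurrence hh k).
by rewrite rmorphM rmorphD/= !map_polyZ map_polyX.
Qed.

Lemma hermiteC_derivative k :
  (hermiteC k)^`() = (2 * @hermite_alpha R k)%:C *: hermiteC k.-1.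
Proof.
have := congr1 (map_poly (real_complex R)) (hermite_derivative hh k).
by rewrite -deriv_map map_polyZ.
Qed.

Variable theta : R.
Hypothesis theta1 : 1 < theta.
Let beta := 4 / (theta ^+ 2 - 1).

Let beta_gt0 : 0 < beta.
Proof. by rewrite divr_gt0// subr_gt0 expr_gt1// ltW// (lt_trans ltr01). Qed.

Definition gauss_mass : R := \int[mu]_t expR (- (4 / (theta ^+ 2 - 1) * t ^+ 2)).

Variable x : R.
(** The argument theta x - 2it. At t = y + i eta with eta = -x(theta - 1)/2 it becomes x - 2iy, the
    argument of h_k in the area pairing. *)
Let l : {poly R[i]} := (theta * x)%:C%:P + (0 +i* - 2) *: 'X.
Let hl k := hermiteC k \Po l.
Let L := gauss_mean_Re beta.
Local Notation al := (@hermite_alpha R).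

Let hl_rec k : l * hl k = (al k.+1)%:C *: hl k.+1 + (al k)%:C *: hl k.-1.
Proof.
have := congr1 (comp_poly l) (hermiteC_recurrence k).
by rewrite comp_polyM comp_polyX comp_polyD !comp_polyZ.
Qed.

Let hl_deriv k : (hl k)^`() = ((0 +i* - 2) * (2 * al k)%:C) *: hl k.-1.
Proof.
rewrite /hl deriv_comp hermiteC_derivative comp_polyZ /l derivD derivC add0r derivZ derivX.
by rewrite mulrC -scalerAl mul1r scalerA.
Qed.

(* Integration by parts against exp(-beta t^2) of [i A hl_k(t)]: the result is the recurrence
   satisfied by theta^k h_k(x). *)
Let L_rec A k : al k.+1 * L (A *: hl k.+1) =
  theta * x * L (A *: hl k) - theta ^+ 2 * al k * L (A *: hl k.-1).
Proof.
pose p := ((0 +i* 1) * A) *: hl k.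
have dp : p^`() = (4 * al k)%:C *: (A *: hl k.-1).
  rewrite /p derivZ hl_deriv !scalerA; congr (_ *: _); case: (A) => A1 A2.
  by apply/eqP; rewrite eq_complex/=; apply/andP; split; apply/eqP; ring.
have xp : 'X * p = (- 2^-1 * al k.+1)%:C *: (A *: hl k.+1) +
   ((- 2^-1 * al k)%:C *: (A *: hl k.-1) + (2^-1 * (theta * x))%:C *: (A *: hl k)).
  have XE : 'X = (0 +i* 2^-1) *: (l - (theta * x)%:C%:P).
    rewrite /l addrC addKr scalerA (_ : _ * _ = 1) ?scale1r//.
    by apply/eqP; rewrite eq_complex/=; apply/andP; split; apply/eqP; field.
  rewrite {1}XE /p -scalerAr -scalerAl mulrBl hl_rec scalerA mul_polyC.
  rewrite scalerBr scalerDr !scalerA addrA; congr (_ + _ + _).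
  - by congr (_ *: _); case: (A) => A1 A2; apply/eqP; rewrite eq_complex/=; apply/andP; split; apply/eqP; field.
  - by congr (_ *: _); case: (A) => A1 A2; apply/eqP; rewrite eq_complex/=; apply/andP; split; apply/eqP; field.
  - rewrite -scaleNr; congr (_ *: _); case: (A) => A1 A2.
    by apply/eqP; rewrite eq_complex/=; apply/andP; split; apply/eqP; field.
have := gauss_mean_Re_by_parts p beta_gt0.
rewrite dp xp !gauss_mean_ReD// !gauss_mean_ReZ// -/L.
set L1 := L (_ *: hl k.+1); set L0 := L (_ *: hl k); set L2 := L (_ *: hl k.-1).
have t2 : theta ^+ 2 - 1 != 0 by rewrite gt_eqF// subr_gt0 expr_gt1// ltW// (lt_trans ltr01).
have -> : theta ^+ 2 = 1 + 4 / beta.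
  by rewrite /beta invf_div mulrC divfK// addrC subrK.
have b0 := lt0r_neq0 beta_gt0.
move=> E; apply: (mulfI b0).
rewrite mulrBr -[X in _ = _ - X](_ : (beta + 4) * (al k * L2) = _); last by field.
lra.
Qed.

(** Both sides obey the recurrence [L_rec] and agree at k = 0, where h_0 is constant. The induction
    carries two consecutive indices. *)
Let L_hermite A k : L (A *: hl k) = theta ^+ k * (h k).[x] * complex.Re A * gauss_mass.
Proof.
have rec1 k' : al k'.+1 * (h k'.+1).[x] = x * (h k').[x] - al k' * (h k'.-1).[x].
  have := congr1 (horner^~ x) (hermite_recurrence hh k'); rewrite !hornerE => ->.
  by rewrite addrK.
have al0 k' : al k'.+1 != 0 by rewrite gt_eqF// sqrtr_gt0 divr_gt0.
suff : L (A *: hl k) = theta ^+ k * (h k).[x] * complex.Re A * gauss_mass /\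
  L (A *: hl k.-1) = theta ^+ k.-1 * (h k.-1).[x] * complex.Re A * gauss_mass by case.
elim: k => [|k [IH1 IH2]].
  suff : L (A *: hl 0) = theta ^+ 0 * (h 0).[x] * complex.Re A * gauss_mass by [].
  have /size_poly1P[c _ hc] : size (h 0%N) == 1%N by case: hh => ->.
  rewrite /hl /hermiteC hc map_polyC/= comp_polyC -mul_polyC -polyCM expr0 mul1r hornerC.
  rewrite /L /gauss_mean_Re; under eq_Rintegral do rewrite hornerC Re_mulc/= mulr0 subr0.
  by rewrite RintegralZl ?[_ * c]mulrC//; exact: integrable_gauss.
split=> //; apply: (mulfI (al0 k)); rewrite L_rec IH1 IH2.
have -> : al k.+1 * (theta ^+ k.+1 * (h k.+1).[x] * complex.Re A * gauss_mass) =
  theta ^+ k.+1 * (al k.+1 * (h k.+1).[x]) * complex.Re A * gauss_mass by ring.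
(* For k = 0 the powers of theta attached to [k.-1] do not match, but [al 0] vanishes. *)
rewrite rec1; case: (k) => [|m] /=; last by rewrite !exprS; ring.
by rewrite /al mul0r sqrtr0 expr0 expr1; ring.
Qed.

(** This is the y-integral that remains at abscissa x once every horizontal line has been moved to
    the real axis, with A = F(x). A second contour shift, now in y, reduces it to [L_hermite]. *)
Lemma hermite_mehler (A : R[i]) k :
  \int[mu]_y (complex.Re (A * (hermiteC k).[x +i* (- (2 * y))] *
       cexp ((- (2 / (theta + 1)))%:C * (x +i* (- y)) ^+ 2)) *
     expR (- (2 / (theta - 1) * y ^+ 2))) =
  theta ^+ k * complex.Re A * gauss_mass * ((h k).[x] * expR (- x ^+ 2)).
Proof.
have t1 : theta + 1 != 0 by rewrite gt_eqF// (lt_trans _ (ltr_wpDr _ theta1)).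
have t2 : theta - 1 != 0 by rewrite gt_eqF// subr_gt0.
have t3 : theta ^+ 2 - 1 != 0.
  by rewrite gt_eqF// subr_gt0 expr_gt1// ltW// (lt_trans ltr01).
(* Completing the square in y turns the exponent into -beta (y + i eta)^2 - x^2. *)
pose eta := - (x * (theta - 1) / 2).
have := L_hermite A k; rewrite /L /gauss_mean_Re (poly_gauss_shift _ beta_gt0 eta) => E.
have -> : theta ^+ k * complex.Re A * gauss_mass * ((h k).[x] * expR (- x ^+ 2)) =
  expR (- x ^+ 2) * (theta ^+ k * (h k).[x] * complex.Re A * gauss_mass) by ring.
rewrite -E -RintegralZl//; last exact: poly_gauss_line_integrable.
apply: eq_Rintegral => y _.
have -> : (A *: hl k).[y +i* eta] = A * (hermiteC k).[x +i* (- (2 * y))].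
  rewrite hornerZ horner_comp !(hornerD, hornerZ, hornerC, hornerX).
  congr (_ * _.[_]); apply/eqP; rewrite eq_complex/= /eta.
  by apply/andP; split; apply/eqP; field.
have -> : expR (- x ^+ 2) * complex.Re (A * (hermiteC k).[x +i* (- (2 * y))] *
    cexp ((- beta)%:C * (y +i* eta) ^+ 2)) = complex.Re (A * (hermiteC k).[x +i* (- (2 * y))] *
    (cexp ((- beta)%:C * (y +i* eta) ^+ 2) * cexp (- x ^+ 2)%:C)).
  by rewrite [in RHS]mulrA [in RHS]Re_mulc cexp_real/= mulr0 subr0 mulrC.
have -> (w z : R[i]) (r : R) : complex.Re (w * z) * expR r = complex.Re (w * (z * cexp r%:C)).
  by rewrite [in RHS]mulrA [in RHS]Re_mulc cexp_real/= mulr0 subr0.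
congr (complex.Re (_ * _)); rewrite -!cexpD; congr cexp.
apply/eqP; rewrite eq_complex/= /eta /beta.
by apply/andP; split; apply/eqP; rewrite !expr2; field; rewrite ?t1 ?t2 ?t3//.
Qed.

End hermite_mehler.

(** * The area pairing with Hermite polynomials *)

Section plane_integration.
Context {R : realType}.
Local Notation mu := (@lebesgue_measure R).

Lemma ge0_integral_reflect (f : R -> \bar R) : measurable_fun setT f ->
  (forall x, 0 <= f x)%E -> (\int[mu]_x f (- x)%R = \int[mu]_x f x)%E.
Proof.
move=> mf f0.
have := @ge0_integral_pushforward _ _ (measurableTypeR R) (measurableTypeR R) R
  (-%R : measurableTypeR R -> measurableTypeR R) (@oppr_measurable R setT) mu setT f
  measurableT mf (fun y _ => f0 y).
rewrite preimage_setT => <-.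
by apply: eq_measure_integral => //= A mA _; exact: lebesgue_measureN.
Qed.

Lemma integrable_prod (f g : R -> R) :
  mu.-integrable setT (EFin \o f) -> mu.-integrable setT (EFin \o g) ->
  (mu \x mu)%E.-integrable setT (EFin \o (fun p : R * R => f p.1 * g p.2)).
Proof.
move=> fi gi; have mf := integrable_measurable_real fi; have mg := integrable_measurable_real gi.
apply/integrable12ltyP.
  apply/measurable_EFinP; apply: measurable_funM.
    exact: (measurableT_comp mf measurable_fst).
  exact: (measurableT_comp mg measurable_snd).
pose I := (\int[mu]_y `|(g y)%:E|)%E.
have If : I \is a fin_num by apply: integrable_fin_num => //; exact: integrable_abse gi.
rewrite (_ : (\int[_]_x _)%E = (\int[mu]_x (`|(f x)%:E| * (fine I)%:E))%E).
  have fa : mu.-integrable setT (fun x => `|(f x)%:E|)%E by exact: integrable_abse fi.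
  rewrite integralZr// -[X in (X * _)%E]fineK; last exact: integrable_fin_num.
  by rewrite -EFinM ltry.
apply: eq_integral => x _; rewrite fineK//.
under eq_integral => y _ do rewrite /= normrM EFinM.
by rewrite integralZl//; exact: integrable_abse gi.
Qed.

Lemma ae_eq_Rintegral (f g : R -> R) : measurable_fun setT f -> measurable_fun setT g ->
  {ae mu, forall x, f x = g x} -> \int[mu]_x f x = \int[mu]_x g x.
Proof.
move=> mf mg fg; rewrite /Rintegral; congr fine; apply: ae_eq_integral => //.
- exact/measurable_EFinP.
- exact/measurable_EFinP.
- case: fg => N [mN N0 sub]; exists N; split => // x /= nfg.
  by apply: sub => /= fgx; apply: nfg => _; rewrite fgx.
Qed.

Variable f : R * R -> R.
Hypothesis fi : (mu \x mu)%E.-integrable setT (EFin \o f).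

Lemma measurable_Rintegral_fst : measurable_fun setT (fun y => \int[mu]_x f (x, y)).
Proof. by apply: measurableT_comp => //; exact: measurable_fubini_G fi. Qed.

Lemma measurable_Rintegral_snd : measurable_fun setT (fun x => \int[mu]_y f (x, y)).
Proof. by apply: measurableT_comp => //; exact: measurable_fubini_F fi. Qed.

Lemma Rintegral_prod_snd : \int[(mu \x mu)%E]_p f p = \int[mu]_y \int[mu]_x f (x, y).
Proof.
rewrite /Rintegral; congr fine; rewrite -(integral21_prod_meas1 fi).
apply: ae_eq_integral => //.
- exact: measurable_fubini_G fi.
- by have /measurable_EFinP := measurable_Rintegral_fst.
- move: (ae_integrable2 fi); apply: filterS => y iy _.
  by rewrite /fubini_G fineK//; exact: integrable_fin_num.
Qed.

Lemma Rintegral_prod_fst : \int[(mu \x mu)%E]_p f p = \int[mu]_x \int[mu]_y f (x, y).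
Proof.
rewrite /Rintegral; congr fine; rewrite -(integral12_prod_meas1 fi).
apply: ae_eq_integral => //.
- exact: measurable_fubini_F fi.
- by have /measurable_EFinP := measurable_Rintegral_snd.
- move: (ae_integrable1 fi); apply: filterS => y iy _.
  by rewrite /fubini_F fineK//; exact: integrable_fin_num.
Qed.

End plane_integration.

(** * Complex measurability and polynomials under Gaussian weights *)

Section complex_measurability.
Context {R : realType}.
Local Notation mu := (@lebesgue_measure R).

Definition cmeasurable d (T : measurableType d) (f : T -> R[i]) :=
  measurable_fun setT (fun x => complex.Re (f x)) /\
  measurable_fun setT (fun x => complex.Im (f x)).

Lemma cmeasurableM d (T : measurableType d) (f g : T -> R[i]) :
  cmeasurable f -> cmeasurable g -> cmeasurable (fun x => f x * g x).
Proof.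
move=> [f1 f2] [g1 g2]; split.
  rewrite (_ : (fun _ => _) = fun x => complex.Re (f x) * complex.Re (g x) -
    complex.Im (f x) * complex.Im (g x)); last by apply/funext => x; rewrite Re_mulc.
  by apply: measurable_funB; exact: measurable_funM.
rewrite (_ : (fun _ => _) = fun x => complex.Re (f x) * complex.Im (g x) +
    complex.Im (f x) * complex.Re (g x)); last by apply/funext => x; rewrite Im_mulc.
by apply: measurable_funD; exact: measurable_funM.
Qed.

Lemma cmeasurable_cmod d (T : measurableType d) (f : T -> R[i]) :
  cmeasurable f -> measurable_fun setT (fun x => cmod (f x)).
Proof. by move=> [? ?]; exact: measurable_cmod. Qed.

Lemma cmeasurable_entire (F : R[i] -> R[i]) (c d : R) : entire F ->
  cmeasurable (fun p : R * R => F (p.1 +i* (c * p.2 + d))).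
Proof.
move=> eF; have [mR mI] := entire_measurable eF.
have mp : measurable_fun setT (fun p : R * R => (p.1, c * p.2 + d)).
  apply: measurable_fun_pair; first exact: measurable_fst.
  by apply: measurable_funD => //; apply: measurable_funM => //; exact: measurable_snd.
by split; [exact: (measurableT_comp mR mp)|exact: (measurableT_comp mI mp)].
Qed.

Lemma cmeasurable_plane (F : R[i] -> R[i]) : entire F ->
  cmeasurable (fun p : R * R => F (p.1 +i* p.2)).
Proof. exact: entire_measurable. Qed.

Lemma measurable_gauss_fst (a : R) :
  measurable_fun setT (fun p : R * R => expR (- (a * p.1 ^+ 2))).
Proof. exact: (measurableT_comp (measurable_gauss a) measurable_fst). Qed.

Lemma measurable_gauss_snd (a : R) :
  measurable_fun setT (fun p : R * R => expR (- (a * p.2 ^+ 2))).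
Proof. exact: (measurableT_comp (measurable_gauss a) measurable_snd). Qed.

Lemma mul_le_half_sqr (u v : R) : u * v <= (u ^+ 2 + v ^+ 2) / 2.
Proof. by have := sqr_ge0 (u - v); rewrite sqrrB; lra. Qed.

Lemma scaled_expR2_le (K u v s t : R) : 0 <= K -> u + v <= s + t ->
  K * expR u * expR v <= K * expR s * expR t.
Proof. by move=> K0 uv; rewrite -!mulrA -!expRD ler_wpM2l// ler_expR. Qed.

Lemma plane_exponent_le (a b c d e x y : R) :
  0 <= e -> e <= a / 4 -> e * (8 * (c ^+ 2 + 1)) <= b ->
  2 * (e * (x ^+ 2 + (c * y + d) ^+ 2)) + (- (a * x ^+ 2) - b * y ^+ 2) <=
  4 * e * d ^+ 2 + (- (a / 2 * x ^+ 2) - b / 2 * y ^+ 2).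
Proof.
move=> e0 e1 e2.
have h1 := ler_wpM2r (sqr_ge0 x) e1; have h2 := ler_wpM2r (sqr_ge0 y) e2.
have h3 : (c * y + d) ^+ 2 <= 2 * c ^+ 2 * y ^+ 2 + 2 * d ^+ 2.
  have -> : 2 * c ^+ 2 * y ^+ 2 = 2 * (c * y) ^+ 2 by ring.
  by have := sqr_ge0 (c * y - d); nra.
have h4 := ler_wpM2l e0 h3.
have h5 : 0 <= e * y ^+ 2 by rewrite mulr_ge0// sqr_ge0.
lra.
Qed.

Lemma poly_line_integrable (Q : {poly R[i]}) (a d : R) : 0 < a ->
  mu.-integrable setT (EFin \o (fun x => cmod Q.[x +i* d] ^+ 2 * expR (- (a * x ^+ 2)))).
Proof.
move=> a0; have a40 : 0 < a / 4 by rewrite divr_gt0.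
have a20 : 0 < a / 2 by rewrite divr_gt0.
have [C C0 HC] := horner_cmod_le Q a40.
apply: (integrable_dominated _ _ _ (integrable_realZ (C ^+ 2 * expR (a / 2 * d ^+ 2))
  measurableT (integrable_gauss a20))) => //.
  apply: measurable_funM; last exact: measurable_gauss.
  apply: measurable_funX; have [c1 c2] := entire_horizontal_continuous d (entire_horner Q).
  by apply: measurable_cmod; exact: continuous_measurable_fun.
move=> x _; rewrite ger0_norm ?(mulr_ge0 (sqr_ge0 _) (expR_ge0 _))//.
have := ler_pM (cmod_ge0 _) (cmod_ge0 _) (HC (x +i* d)) (HC (x +i* d)); rewrite -!expr2.
move=> /(ler_wpM2r (expR_ge0 (- (a * x ^+ 2)))) H; apply: le_trans H _.
rewrite exprMn -expRM_natl sqr_cmod/=; apply: scaled_expR2_le; first exact: sqr_ge0.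
by rewrite le_eqVlt; apply/orP; left; apply/eqP; field.
Qed.

(** The affine ordinate c y + d covers every argument at which h_k is evaluated: z, its conjugate, x
    - 2iy, and z - 2iy with a fixed shift y. *)
Lemma poly_plane_integrable (Q : {poly R[i]}) (a b c d : R) : 0 < a -> 0 < b ->
  (mu \x mu)%E.-integrable setT (EFin \o (fun p : R * R =>
    cmod Q.[p.1 +i* (c * p.2 + d)] ^+ 2 *
    (expR (- (a * p.1 ^+ 2)) * expR (- (b * p.2 ^+ 2))))).
Proof.
move=> a0 b0; pose e := Num.min (a / 4) (b / (8 * (c ^+ 2 + 1))).
have c10 : 0 < c ^+ 2 + 1 by rewrite ltr_wpDl ?sqr_ge0.
have e0 : 0 < e by rewrite lt_min !divr_gt0// mulr_gt0.
have e1 : e <= a / 4 by rewrite ge_min lexx.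
have e2 : e * (8 * (c ^+ 2 + 1)) <= b.
  by rewrite -ler_pdivlMr ?mulr_gt0// ge_min lexx orbT.
have a20 : 0 < a / 2 by rewrite divr_gt0.
have b20 : 0 < b / 2 by rewrite divr_gt0.
have [C C0 HC] := horner_cmod_le Q e0.
apply: (integrable_dominated _ _ _ (integrable_realZ (C ^+ 2 * expR (4 * e * d ^+ 2))
  measurableT (integrable_prod (integrable_gauss a20) (integrable_gauss b20)))) => //.
  apply: measurable_funM.
    apply: measurable_funX; apply: cmeasurable_cmod.
    exact: (cmeasurable_entire c d (entire_horner Q)).
  by apply: measurable_funM; [exact: measurable_gauss_fst|exact: measurable_gauss_snd].
move=> [x y] _ /=; rewrite ger0_norm ?(mulr_ge0 (sqr_ge0 _) (mulr_ge0 (expR_ge0 _) (expR_ge0 _)))//.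
have := ler_pM (cmod_ge0 _) (cmod_ge0 _) (HC (x +i* (c * y + d))) (HC (x +i* (c * y + d))).
rewrite -!expr2.
move=> /(ler_wpM2r (mulr_ge0 (expR_ge0 (- (a * x ^+ 2))) (expR_ge0 (- (b * y ^+ 2))))) H.
apply: le_trans H _.
rewrite exprMn -expRM_natl sqr_cmod/= -!expRD.
apply: scaled_expR2_le; first exact: sqr_ge0.
exact: plane_exponent_le (ltW e0) e1 e2.
Qed.

End complex_measurability.

Section weighted_entire.
Context {R : realType}.
Local Notation mu := (@lebesgue_measure R).
Variables (F : R[i] -> R[i]) (a b : R).
Hypothesis eF : entire F.
Hypothesis iF : (mu \x mu)%E.-integrable setT (EFin \o (fun p : R * R =>
  cmod (F (p.1 +i* p.2)) ^+ 2 * (expR (- (a * p.1 ^+ 2)) * expR (- (b * p.2 ^+ 2))))).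

Let mF2 c d : measurable_fun setT (fun p : R * R =>
  cmod (F (p.1 +i* (c * p.2 + d))) ^+ 2 * (expR (- (a * p.1 ^+ 2)) * expR (- (b * p.2 ^+ 2)))).
Proof.
apply: measurable_funM.
  by apply: measurable_funX; apply: cmeasurable_cmod; exact: (cmeasurable_entire c d eF).
by apply: measurable_funM; [exact: measurable_gauss_fst|exact: measurable_gauss_snd].
Qed.

Let F2_ge0 (z : R[i]) (p : R * R) :
  0 <= cmod (F z) ^+ 2 * (expR (- (a * p.1 ^+ 2)) * expR (- (b * p.2 ^+ 2))).
Proof. exact: (mulr_ge0 (sqr_ge0 _) (mulr_ge0 (expR_ge0 _) (expR_ge0 _))). Qed.

Lemma reflect_plane_integrable : (mu \x mu)%E.-integrable setT (EFin \o (fun p : R * R =>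
  cmod (F (p.1 +i* - p.2)) ^+ 2 * (expR (- (a * p.1 ^+ 2)) * expR (- (b * p.2 ^+ 2))))).
Proof.
have m1 := mF2 1 0; have m2 := mF2 (- 1) 0.
have E1 : (fun p : R * R => cmod (F (p.1 +i* (1 * p.2 + 0))) ^+ 2 *
    (expR (- (a * p.1 ^+ 2)) * expR (- (b * p.2 ^+ 2)))) = (fun p : R * R =>
    cmod (F (p.1 +i* p.2)) ^+ 2 * (expR (- (a * p.1 ^+ 2)) * expR (- (b * p.2 ^+ 2)))).
  by apply/funext => p; rewrite mul1r addr0.
have E2 : (fun p : R * R => cmod (F (p.1 +i* (- 1 * p.2 + 0))) ^+ 2 *
    (expR (- (a * p.1 ^+ 2)) * expR (- (b * p.2 ^+ 2)))) = (fun p : R * R =>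
    cmod (F (p.1 +i* - p.2)) ^+ 2 * (expR (- (a * p.1 ^+ 2)) * expR (- (b * p.2 ^+ 2)))).
  by apply/funext => p; rewrite mulN1r addr0.
rewrite E1 in m1; rewrite E2 in m2.
apply/ge0_integrableP => //; move/ge0_integrableP : iF => /(_ m1 (fun _ => F2_ge0 _ _)).
have t1 := @fubini_tonelli1 _ _ _ _ _ mu mu _ ((measurable_EFinP _ _).2 m1).
have t2 := @fubini_tonelli1 _ _ _ _ _ mu mu _ ((measurable_EFinP _ _).2 m2).
rewrite t1; last by move=> p; rewrite lee_fin.
rewrite t2; last by move=> p; rewrite lee_fin.
apply: le_lt_trans; rewrite le_eqVlt; apply/orP; left; apply/eqP.
apply: eq_integral => x _; rewrite /fubini_F/=.
rewrite -[RHS]ge0_integral_reflect.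
- by apply: eq_integral => y _; rewrite /= sqrrN.
- by have := measurable_fun_pair2 x ((measurable_EFinP _ _).2 m1).
- by move=> y; rewrite lee_fin (F2_ge0 _ (x, y)).
Qed.

(** The arithmetic-geometric mean inequality bounds |F(z) F(conj z)| by half of |F(z)|^2 + |F(conj
    z)|^2, and the weight is even in y, so the entire extension of |F|^2 inherits plane
    integrability and the comparison with a nearby line applies. *)
Lemma real_line_sqr_integrable : mu.-integrable setT
  (EFin \o (fun x => cmod (F x%:C) ^+ 2 * expR (- (a * x ^+ 2)))).
Proof.
(* [H] is entire and equals |F x|^2 exp(-a x^2) on the real line. *)
pose H z := F z * ((F z^*)^*)%C * cexp ((- a)%:C * z ^+ 2).
have eH : entire H.
  have e1 : entire (fun z : R[i] => (- a)%:C * z ^+ 2) :=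
    entireM (entire_cst (- a)%:C) (entireX 2 entire_id).
  exact: (entireM (entireM eF (entire_reflect eF)) (entire_comp entire_cexp e1)).
(* The factor exp(-a z^2) has modulus exp(-a x^2 + a y^2); the exponent a + b restores exactly the
   weight exp(-a x^2 - b y^2). *)
have iH : (mu \x mu)%E.-integrable setT
    (EFin \o (fun p : R * R => cmod (H (p.1 +i* p.2)) * expR (- (a + b) * p.2 ^+ 2))).
  apply: (integrable_dominated _ _ _ (integrable_realZ 2^-1 measurableT
    (integrable_realD measurableT iF reflect_plane_integrable))) => //.
    apply: measurable_funM; first exact: cmeasurable_cmod (cmeasurable_plane eH).
    by under eq_fun do rewrite mulNr; exact: measurable_gauss_snd.
  move=> [x y] _ /=; rewrite ger0_norm ?mulr_ge0 ?cmod_ge0 ?expR_ge0//.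
  rewrite /H !cmodM cmod_conj cmod_cexp -[_ * expR _ * expR _]mulrA -expRD -mulrDl mulrA.
  have -> : expR (- (a * x ^+ 2)) * expR (- (b * y ^+ 2)) =
     expR (complex.Re ((- a)%:C * (x +i* y) ^+ 2) + - (a + b) * y ^+ 2).
    by rewrite -expRD; congr expR; rewrite /= expr2 /=; ring.
  apply: ler_wpM2r; first exact: expR_ge0.
  by rewrite [leRHS]mulrC; exact: mul_le_half_sqr.
have HE x : complex.Re (H (x +i* 0)) = cmod (F x%:C) ^+ 2 * expR (- (a * x ^+ 2)).
  rewrite /H (_ : (- a)%:C * (x +i* 0) ^+ 2 = (- (a * x ^+ 2))%:C); last first.
    by apply/eqP; rewrite eq_complex/=; apply/andP; split; apply/eqP; ring.
  rewrite (_ : ((x +i* 0)^*)%C = x +i* 0); last by rewrite /= oppr0.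
  rewrite cexp_real Re_mulc/= mulr0 subr0; congr (_ * _).
  by rewrite sqr_cmod Re_mulc Re_conjc Im_conjc; ring.
have := ge0_real_line_integrable eH iH.
rewrite (_ : (fun x => complex.Re (H (x +i* 0))) = fun x => cmod (F x%:C) ^+ 2 * expR (- (a * x ^+ 2))).
  by apply=> x; rewrite HE mulr_ge0 ?sqr_ge0 ?expR_ge0.
by apply/funext => x; exact: HE.
Qed.

End weighted_entire.

(** * Area pairing with one Hermite polynomial *)

Section hermite_area_coefficients.
Context {R : realType}.
Local Notation mu := (@lebesgue_measure R).
Variables (h : nat -> {poly R}) (theta : R).
Hypothesis hh : orthonormal_hermite h.
Hypothesis theta1 : 1 < theta.
Local Notation a := (2 / (theta + 1)).
Local Notation b := (2 / (theta - 1)).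
Variable F : R[i] -> R[i].
Hypothesis eF : entire F.
Hypothesis iF : (mu \x mu)%E.-integrable setT (EFin \o (fun p : R * R =>
  cmod (F (p.1 +i* p.2)) ^+ 2 * (expR (- (a * p.1 ^+ 2)) * expR (- (b * p.2 ^+ 2))))).
Variable k : nat.
Local Notation Q := (hermiteC h k).

Let t1 : 0 < theta + 1. Proof. by rewrite addr_gt0// (lt_trans ltr01). Qed.
Let t2 : 0 < theta - 1. Proof. by rewrite subr_gt0. Qed.
Let a0 : 0 < a. Proof. exact: divr_gt0. Qed.
Let b0 : 0 < b. Proof. exact: divr_gt0. Qed.
Let a1 : a <= 1. Proof. by rewrite ler_pdivrMr// mul1r -lerBlDr ltW// (_ : 2 - 1 = 1 :> R)//; ring. Qed.
Let ab : 0 < b - a.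
Proof. by rewrite subr_gt0 ltr_pM2l// ltf_pV2// ltrD2l (lt_trans _ ltr01)// oppr_lt0. Qed.

Let iFx := real_line_sqr_integrable eF iF.

Lemma Re_mulc_real (w : R[i]) (r : R) : complex.Re (w * r%:C) = complex.Re w * r.
Proof. by rewrite Re_mulc/= mulr0 subr0. Qed.

Lemma half_mix_le (A B e e' : R) : 0 <= A -> e <= e' ->
  (A + B) / 2 * e <= 2^-1 * (A * e' + B * e).
Proof. by move=> A0 ee; have := ler_wpM2l A0 ee; lra. Qed.

Lemma hermite_coef_integrable :
  mu.-integrable setT (EFin \o (fun x => complex.Re (F x%:C) * ((h k).[x] * expR (- x ^+ 2)))).
Proof.
have i2 := integrable_horner_gauss1 (h k ^+ 2).
apply: (integrable_dominated _ _ _ (integrable_realZ 2^-1 measurableT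
  (integrable_realD measurableT iFx i2))) => //.
  apply: measurable_funM.
    by apply: continuous_measurable_fun; exact: (entire_horizontal_continuous 0 eF).1.
  exact: (integrable_measurable_real (integrable_horner_gauss1 (h k))).
move=> x _; rewrite normrM [`|_ * expR _|]normrM [`|expR _|]ger0_norm ?expR_ge0//.
have Fx := Re_le_cmod (F x%:C).
apply: (@le_trans _ _ (cmod (F x%:C) * (`|(h k).[x]| * expR (- x ^+ 2)))).
  by apply: ler_wpM2r => //; rewrite mulr_ge0// expR_ge0.
rewrite horner_exp mulrA.
have H1 := ler_wpM2r (expR_ge0 (- x ^+ 2)) (mul_le_half_sqr (cmod (F x%:C)) `|(h k).[x]|).
apply: le_trans H1 _; rewrite real_normK ?num_real//.
apply: half_mix_le; first exact: sqr_ge0.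
by rewrite ler_expR lerN2 ler_piMl// sqr_ge0.
Qed.

(** Since h_k has real coefficients, its value at x - iy is the conjugate of its value at z. This
    form is the one that continues analytically off a horizontal line. *)
Let f (p : R * R) := complex.Re (F (p.1 +i* p.2) * Q.[p.1 +i* - p.2]) *
  (expR (- (a * p.1 ^+ 2)) * expR (- (b * p.2 ^+ 2))).

Lemma hermite_area_integrable : (mu \x mu)%E.-integrable setT (EFin \o f).
Proof.
have i2 := poly_plane_integrable Q (- 1) 0 a0 b0.
apply: (integrable_dominated _ _ _ (integrable_realZ 2^-1 measurableT
  (integrable_realD measurableT iF i2))) => //.
  apply: measurable_funM.
    have := cmeasurable_entire (- 1) 0 (entire_horner Q).
    under eq_fun do rewrite mulN1r addr0.
    by move=> cQ; have [] := cmeasurableM (cmeasurable_plane eF) cQ.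
  by apply: measurable_funM; [exact: measurable_gauss_fst|exact: measurable_gauss_snd].
move=> [x y] _; rewrite /f/= mulN1r addr0 normrM -mulrDl mulrA.
rewrite [`|_ * expR _|]ger0_norm ?(mulr_ge0 (expR_ge0 _) (expR_ge0 _))//.
apply: ler_wpM2r; first exact: mulr_ge0 (expR_ge0 _) (expR_ge0 _).
apply: le_trans (Re_le_cmod _) _; rewrite cmodM mulrC [leRHS]mulrC addrC.
exact: mul_le_half_sqr.
Qed.

Let g (p : R * R) := complex.Re (F p.1%:C * Q.[p.1 +i* (- (2 * p.2))] *
  cexp ((- a)%:C * (p.1 +i* - p.2) ^+ 2)) * expR (- (b * p.2 ^+ 2)).

Let entire_gauss : entire (fun z : R[i] => cexp ((- a)%:C * z ^+ 2)).
Proof.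
have e1 : entire (fun z : R[i] => (- a)%:C * z ^+ 2) :=
  entireM (entire_cst (- a)%:C) (entireX 2 entire_id).
exact: (entire_comp entire_cexp e1).
Qed.

(** The modulus of exp(-a (x - iy)^2) is exp(-a x^2 + a y^2), so the y-weight left is exp(-(b - a)
    y^2), still a decaying Gaussian. Integrability of |F|^2 on the real line enters here. *)
Let gi : (mu \x mu)%E.-integrable setT (EFin \o g).
Proof.
have i1 := integrable_prod iFx (integrable_gauss ab).
have i2 := poly_plane_integrable Q (- 2) 0 a0 ab.
apply: (integrable_dominated _ _ _ (integrable_realZ 2^-1 measurableT
  (integrable_realD measurableT i1 i2))) => //.
  apply: measurable_funM; last exact: measurable_gauss_snd.
  have c1 := cmeasurable_entire 0 0 eF.
  have c2 := cmeasurable_entire (- 2) 0 (entire_horner Q).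
  have c3 := cmeasurable_entire (- 1) 0 entire_gauss.
  have := (cmeasurableM (cmeasurableM c1 c2) c3).1; congr (measurable_fun _ _).
  by apply/funext => p; rewrite mul0r mulN1r mulNr !addr0.
move=> [x y] _; rewrite /g/= normrM mulNr addr0 [`|expR _|]ger0_norm ?expR_ge0//.
apply: le_trans (ler_wpM2r (expR_ge0 _) (Re_le_cmod _)) _.
rewrite !cmodM cmod_cexp.
have -> : 2^-1 * (cmod (F x%:C) ^+ 2 * expR (- (a * x ^+ 2)) * expR (- ((b - a) * y ^+ 2)) +
    cmod Q.[x +i* - (2 * y)] ^+ 2 * (expR (- (a * x ^+ 2)) * expR (- ((b - a) * y ^+ 2)))) =
  2^-1 * (cmod (F x%:C) ^+ 2 + cmod Q.[x +i* - (2 * y)] ^+ 2) *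
    (expR (- (a * x ^+ 2)) * expR (- ((b - a) * y ^+ 2))) by ring.
rewrite -[leLHS]mulrA -!expRD.
have -> : complex.Re ((- a)%:C * (x +i* - y) ^+ 2) + - (b * y ^+ 2) =
    - (a * x ^+ 2) - (b - a) * y ^+ 2 by rewrite expr2/=; ring.
apply: ler_wpM2r; first exact: expR_ge0.
by rewrite [leRHS]mulrC; exact: mul_le_half_sqr.
Qed.

Section fixed_ordinate.
Variable y : R.

(* On Im z = y this is exp(b y^2) f, on the real line exp(b y^2) g. *)
Let H z := F z * Q.[z + (0 +i* - (2 * y))] * cexp ((- a)%:C * (z + (0 +i* - y)) ^+ 2).

Let eH : entire H.
Proof.
have e1 (c : R[i]) : entire (fun z : R[i] => z + c) := entireD entire_id (entire_cst c).
exact: (entireM (entireM eF (entire_comp (entire_horner Q) (e1 _)))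
  (entire_comp entire_gauss (e1 _))).
Qed.

Let H_le x t : cmod (H (x +i* t)) <= 2^-1 *
  (cmod (F (x +i* t)) ^+ 2 + cmod Q.[x +i* (1 * t + - (2 * y))] ^+ 2) *
  expR (- (a * x ^+ 2) + a * (t - y) ^+ 2).
Proof.
rewrite /H !cmodM cmod_cexp.
have -> : (x +i* t) + (0 +i* - (2 * y)) = x +i* (1 * t + - (2 * y)).
  by rewrite mul1r; apply/eqP; rewrite eq_complex/= addr0 !eqxx.
have -> : complex.Re ((- a)%:C * (x +i* t + (0 +i* - y)) ^+ 2) =
  - (a * x ^+ 2) + a * (t - y) ^+ 2 by rewrite expr2/=; ring.
apply: ler_wpM2r; first exact: expR_ge0.
by rewrite [leRHS]mulrC; exact: mul_le_half_sqr.
Qed.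

(** As (t - y)^2 <= 2 t^2 + 2 y^2, the extra weight exp(-2a t^2) pays for the growth of the shifted
    Gaussian up to the constant exp(2a y^2). *)
Let iH : (mu \x mu)%E.-integrable setT
  (EFin \o (fun p : R * R => cmod (H (p.1 +i* p.2)) * expR (- (2 * a + b) * p.2 ^+ 2))).
Proof.
have i2 := poly_plane_integrable Q 1 (- (2 * y)) a0 b0.
apply: (integrable_dominated _ _ _ (integrable_realZ (expR (2 * a * y ^+ 2) / 2) measurableT
  (integrable_realD measurableT iF i2))) => //.
  apply: measurable_funM; first exact: cmeasurable_cmod (cmeasurable_plane eH).
  by under eq_fun do rewrite mulNr; exact: measurable_gauss_snd.
move=> [x t] _; rewrite /= ger0_norm ?(mulr_ge0 (cmod_ge0 _) (expR_ge0 _))//.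
apply: le_trans (ler_wpM2r (expR_ge0 _) (H_le _ _)) _.
rewrite -mulrDl.
set S := cmod (F _) ^+ 2 + _.
have S0 : 0 <= S / 2 by rewrite divr_ge0// addr_ge0// sqr_ge0.
have -> : expR (2 * a * y ^+ 2) / 2 * (S * (expR (- (a * x ^+ 2)) * expR (- (b * t ^+ 2)))) =
  S / 2 * expR (2 * a * y ^+ 2) * expR (- (a * x ^+ 2) - b * t ^+ 2).
  by rewrite -[in LHS]expRD; ring.
rewrite [2^-1 * S]mulrC; apply: scaled_expR2_le => //.
have := ler_wpM2l (ltW a0) (sqr_ge0 (t + y)); rewrite mulr0; nra.
Qed.

Let line0 : mu.-integrable setT (EFin \o (fun x => complex.Re (H (x +i* 0)))).
Proof.
have i2 := poly_line_integrable Q (- (2 * y)) a0.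
apply: (integrable_dominated _ _ _ (integrable_realZ (expR (a * y ^+ 2) / 2) measurableT
  (integrable_realD measurableT iFx i2))) => //.
  by apply: continuous_measurable_fun; exact: (entire_horizontal_continuous _ eH).1.
move=> x _; apply: le_trans (Re_le_cmod _) _; apply: le_trans (H_le _ _) _.
rewrite mulr0 add0r sub0r sqrrN expRD -mulrDl.
by rewrite le_eqVlt; apply/orP; left; apply/eqP; ring.
Qed.

(** By Fubini the integrability hypothesis holds for almost every y, which suffices under the outer
    integral. *)
Lemma hermite_area_line : mu.-integrable setT (EFin \o (fun x => f (x, y))) ->
  \int[mu]_x f (x, y) = \int[mu]_x g (x, y).
Proof.
have ee1 : expR (b * y ^+ 2) * expR (- (b * y ^+ 2)) = 1 by rewrite -expRD subrr expR0.
have HyE x : complex.Re (H (x +i* y)) = expR (b * y ^+ 2) * f (x, y).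
  rewrite /H /f /=.
  have -> : (x +i* y) + (0 +i* - (2 * y)) = x +i* - y.
    by apply/eqP; rewrite eq_complex/=; apply/andP; split; apply/eqP; ring.
  have -> : (- a)%:C * ((x +i* y) + (0 +i* - y)) ^+ 2 = (- (a * x ^+ 2))%:C.
    by apply/eqP; rewrite eq_complex expr2/=; apply/andP; split; apply/eqP; ring.
  rewrite cexp_real Re_mulc_real [RHS]mulrCA; congr (_ * _).
  by rewrite [RHS]mulrCA ee1 mulr1.
have H0E x : complex.Re (H (x +i* 0)) = expR (b * y ^+ 2) * g (x, y).
  rewrite /H /g /=.
  have -> : (x +i* 0) + (0 +i* - (2 * y)) = x +i* - (2 * y).
    by apply/eqP; rewrite eq_complex/=; apply/andP; split; apply/eqP; ring.
  have -> : (x +i* 0) + (0 +i* - y) = x +i* - y.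
    by apply/eqP; rewrite eq_complex/=; apply/andP; split; apply/eqP; ring.
  by rewrite [RHS]mulrCA ee1 mulr1.
move=> fy.
have e0 : expR (b * y ^+ 2) != 0 by rewrite gt_eqF// expR_gt0.
have i_y : mu.-integrable setT (EFin \o (fun x => complex.Re (H (x +i* y)))).
  have := integrable_realZ (expR (b * y ^+ 2)) measurableT fy.
  by congr (integrable _ _ _); apply/funext => x /=; rewrite HyE.
have gy : mu.-integrable setT (EFin \o (fun x => g (x, y))).
  have := integrable_realZ (expR (b * y ^+ 2))^-1 measurableT line0.
  by congr (integrable _ _ _); apply/funext => x; rewrite [LHS]/= H0E mulKf.
apply: (mulfI e0); rewrite -!RintegralZl//.
have -> : \int[mu]_x (expR (b * y ^+ 2) * f (x, y)) = \int[mu]_x complex.Re (H (x +i* y)).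
  by apply: eq_Rintegral => x _; rewrite HyE.
rewrite (contour_shift eH iH i_y line0).
by apply: eq_Rintegral => x _; rewrite H0E.
Qed.

End fixed_ordinate.

(** Fubini with y outside allows the shift in x on each line; Fubini in the other order then exposes
    the Mehler integral in y. *)
Lemma hermite_area_coef : \int[(mu \x mu)%E]_p f p = theta ^+ k * gauss_mass theta *
  \int[mu]_x (complex.Re (F x%:C) * ((h k).[x] * expR (- x ^+ 2))).
Proof.
rewrite (Rintegral_prod_snd hermite_area_integrable).
rewrite (@ae_eq_Rintegral _ _ (fun y => \int[mu]_x g (x, y))).
- rewrite -(Rintegral_prod_snd gi) (Rintegral_prod_fst gi).
  rewrite -RintegralZl//; last exact: hermite_coef_integrable.
  apply: eq_Rintegral => x _; rewrite [LHS](hermite_mehler hh theta1 x (F x%:C) k); ring.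
- exact: measurable_Rintegral_fst hermite_area_integrable.
- exact: measurable_Rintegral_fst gi.
- by move: (ae_integrable2 hermite_area_integrable); apply: filterS => y; exact: hermite_area_line.
Qed.

End hermite_area_coefficients.

(** * Bessel's inequality in the plane *)

Section hermite_area_bessel.
Context {R : realType}.
Local Notation mu := (@lebesgue_measure R).
Variables (h : nat -> {poly R}) (theta : R).
Hypothesis hh : orthonormal_hermite h.
Hypothesis theta1 : 1 < theta.
Local Notation a := (2 / (theta + 1)).
Local Notation b := (2 / (theta - 1)).

Lemma Re_mulc_conj (z : R[i]) : complex.Re (z * z^*%C) = cmod z ^+ 2.
Proof. by rewrite sqr_cmod Re_mulc Re_conjc Im_conjc; ring. Qed.

Definition area_weight (p : R * R) : R :=
  expR (- (2 / (theta + 1) * p.1 ^+ 2)) * expR (- (2 / (theta - 1) * p.2 ^+ 2)).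
Local Notation w := area_weight.

Definition area_integrable (F : R[i] -> R[i]) := (mu \x mu)%E.-integrable setT
  (EFin \o (fun p : R * R => cmod (F (p.1 +i* p.2)) ^+ 2 * w p)).

Let t1 : 0 < theta + 1. Proof. by rewrite addr_gt0// (lt_trans ltr01). Qed.
Let t2 : 0 < theta - 1. Proof. by rewrite subr_gt0. Qed.

Lemma area_weight_ge0 p : 0 <= w p.
Proof. exact: mulr_ge0 (expR_ge0 _) (expR_ge0 _). Qed.

Lemma measurable_area_weight : measurable_fun setT w.
Proof. by apply: measurable_funM; [exact: measurable_gauss_fst|exact: measurable_gauss_snd]. Qed.

Lemma area_integrable_scale (c : R[i]) F : area_integrable F ->
  area_integrable (fun z => c * F z).
Proof.
move=> /(integrable_realZ (cmod c ^+ 2) measurableT).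
congr (integrable _ _ _); apply/funext => p /=; congr EFin.
by rewrite cmodM exprMn mulrA.
Qed.

Lemma area_integrable_horner (Q : {poly R[i]}) : area_integrable (horner Q).
Proof.
have := poly_plane_integrable Q 1 0 (divr_gt0 (ltr0Sn R 1) t1) (divr_gt0 (ltr0Sn R 1) t2).
by congr (integrable _ _ _); apply/funext => p /=; rewrite mul1r addr0.
Qed.

Definition hermite_sum (c : nat -> R[i]) n : {poly R[i]} := \sum_(k < n) c k *: hermiteC h k.

Lemma hermite_sumS c n : hermite_sum c n.+1 = hermite_sum c n + c n *: hermiteC h n.
Proof. by rewrite /hermite_sum big_ord_recr. Qed.

Lemma hermiteC_conj k (z : R[i]) : ((hermiteC h k).[z]^*)%C = (hermiteC h k).[(z^*)%C].
Proof.
rewrite /hermiteC -[in RHS](_ : map_poly (@conjc R) (map_poly (real_complex R) (h k)) =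
  map_poly (real_complex R) (h k)) ?horner_map//.
rewrite -map_poly_comp; apply: eq_map_poly => r /=.
by rewrite /conjc/= oppr0.
Qed.

Section fixed_function.
Variable F : R[i] -> R[i].
Hypothesis eF : entire F.
Hypothesis iF : area_integrable F.

Lemma Re_hermite_integrable k : mu.-integrable setT
  (EFin \o (fun x => complex.Re (F x%:C) * (h k).[x] * expR (- x ^+ 2))).
Proof.
have := hermite_coef_integrable h theta1 eF iF k.
by congr (integrable _ _ _); apply/funext => x /=; rewrite mulrA.
Qed.

End fixed_function.

(** The statement on real parts, applied to -iF. *)
Lemma Im_hermite_integrable F k : entire F -> area_integrable F -> mu.-integrable setT
  (EFin \o (fun x => complex.Im (F x%:C) * (h k).[x] * expR (- x ^+ 2))).
Proof.
move=> eF iF.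
have := Re_hermite_integrable (entireM (entire_cst (0 +i* -1)) eF) (area_integrable_scale (0 +i* -1) iF) k.
by congr (integrable _ _ _); apply/funext => x /=; rewrite Re_mulc/= mul0r sub0r mulN1r opprK.
Qed.

Lemma Re_hermite_coef F (c : R[i]) k : entire F -> area_integrable F ->
  \int[mu]_x (complex.Re (c * F x%:C) * ((h k).[x] * expR (- x ^+ 2))) =
  complex.Re (c * hermite_coef h (fun x => F x%:C) k).
Proof.
move=> eF iF; rewrite Re_mulc /=.
have i1 := Re_hermite_integrable eF iF k; have i2 := Im_hermite_integrable k eF iF.
rewrite -!RintegralZl// -RintegralB//; [|exact: integrable_realZ..].
by apply: eq_Rintegral => x _; rewrite Re_mulc mulrBl !mulrA.
Qed.

Lemma hermite_sum_pairing F (c : nat -> R[i]) n : entire F -> area_integrable F ->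
  let f p := complex.Re (F (p.1 +i* p.2) * ((hermite_sum c n).[p.1 +i* p.2]^*)%C) * w p in
  (mu \x mu)%E.-integrable setT (EFin \o f) /\
  \int[(mu \x mu)%E]_p f p = gauss_mass theta * \sum_(k < n)
    theta ^+ k * complex.Re ((c k)^*%C * hermite_coef h (fun x => F x%:C) k).
Proof.
move=> eF iF f; rewrite {}/f; elim: n => [|n [IH1 IH2]].
  have E : (fun p : R * R => complex.Re (F (p.1 +i* p.2) *
      ((hermite_sum c 0).[p.1 +i* p.2]^*)%C) * w p) = cst 0.
    by apply/funext => p; rewrite /hermite_sum big_ord0 horner0 rmorph0 mulr0 mul0r.
  rewrite E big_ord0 mulr0; split; first exact: integrable0.
  by rewrite Rintegral_cst// mul0r.
(* Absorbing the conjugate coefficient into the entire function reduces the complex scalar to the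
   identity for real parts. *)
pose G z := ((c n)^*)%C * F z.
have eG : entire G := entireM (entire_cst _) eF.
have iG : area_integrable G := area_integrable_scale _ iF.
have E : (fun p : R * R => complex.Re (F (p.1 +i* p.2) *
    ((hermite_sum c n.+1).[p.1 +i* p.2]^*)%C) * w p) =
  (fun p : R * R => complex.Re (F (p.1 +i* p.2) * ((hermite_sum c n).[p.1 +i* p.2]^*)%C) * w p +
    complex.Re (G (p.1 +i* p.2) * (hermiteC h n).[p.1 +i* - p.2]) * w p).
  apply/funext => p; rewrite -mulrDl -Re_addc; congr (complex.Re _ * _).
  rewrite hermite_sumS hornerD hornerZ rmorphD rmorphM mulrDr; congr (_ + _).
  by rewrite -(hermiteC_conj n (p.1 +i* p.2)) /G mulrCA mulrA.
have i2 := hermite_area_integrable h theta1 eG iG n.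
rewrite E; split; first exact: integrable_realD.
rewrite RintegralD// IH2 big_ord_recr/= mulrDr; congr (_ + _).
by rewrite (hermite_area_coef hh theta1 eG iG n) Re_hermite_coef//; ring.
Qed.

Lemma hermite_coef_sum (c : nat -> R[i]) n k :
  hermite_coef h (fun x => (hermite_sum c n).[x%:C]) k = if (k < n)%N then c k else 0.
Proof.
have key (u : nat -> R) : \int[mu]_x ((\sum_(j < n) u j * (h j).[x]) * (h k).[x] * expR (- x ^+ 2)) =
    if (k < n)%N then u k else 0.
  have -> : \int[mu]_x ((\sum_(j < n) u j * (h j).[x]) * (h k).[x] * expR (- x ^+ 2)) =
      gauss_mean (\sum_(j < n) u j *: (h j * h k)).
    apply: eq_Rintegral => x _; congr (_ * _); rewrite horner_sum big_distrl/=.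
    by apply: eq_bigr => j _; rewrite hornerZ hornerM mulrA.
  have gm0 : gauss_mean (0 : {poly R}) = 0 by rewrite -(scale0r 0) gauss_meanZ mul0r.
  rewrite (big_morph _ (@gauss_meanD R) gm0).
  under eq_bigr do rewrite gauss_meanZ hermite_orthonormal//.
  case: ifPn => [kn|]; last first.
    rewrite -leqNgt => nk; apply: big1 => j _.
    by rewrite ltn_eqF ?mulr0// (leq_trans (ltn_ord j)).
  rewrite (bigD1 (Ordinal kn))//= eqxx mulr1 big1 ?addr0// => j /negPf jk.
  by rewrite (_ : (j == k :> nat) = false) ?mulr0//; move: jk; rewrite -val_eqE.
have horn (x : R) : (hermite_sum c n).[x%:C] = \sum_(j < n) c j * (h j).[x]%:C.
  by rewrite /hermite_sum horner_sum; apply: eq_bigr => j _; rewrite hornerZ horner_real.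
have ReE (x : R) : complex.Re (hermite_sum c n).[x%:C] = \sum_(j < n) complex.Re (c j) * (h j).[x].
  rewrite horn (big_morph (@complex.Re R) (@Re_addc R) (erefl _)).
  by apply: eq_bigr => j _; rewrite Re_mulc_real.
have ImE (x : R) : complex.Im (hermite_sum c n).[x%:C] = \sum_(j < n) complex.Im (c j) * (h j).[x].
  rewrite horn (big_morph (@complex.Im R) (@Im_addc R) (erefl _)).
  by apply: eq_bigr => j _; rewrite Im_mulc/= mulr0 add0r.
rewrite /hermite_coef; under eq_Rintegral do rewrite ReE.
under [X in _ +i* X]eq_Rintegral do rewrite ImE.
rewrite (key (fun j => complex.Re (c j))) (key (fun j => complex.Im (c j))).
by case: ifP => // _; case: (c k).
Qed.

(** The pairing of the sum with itself: orthogonality of the h_k in the plane is inherited from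
    orthonormality on the line. *)
Lemma hermite_sum_area_norm (c : nat -> R[i]) n :
  \int[(mu \x mu)%E]_p (cmod (hermite_sum c n).[p.1 +i* p.2] ^+ 2 * w p) =
  gauss_mass theta * \sum_(k < n) theta ^+ k * cmod (c k) ^+ 2.
Proof.
have [_ H] := hermite_sum_pairing c n (entire_horner (hermite_sum c n)) (area_integrable_horner _).
transitivity (gauss_mass theta * \sum_(k < n) theta ^+ k *
    complex.Re ((c k)^*%C * hermite_coef h (fun x => (hermite_sum c n).[x%:C]) k)).
  by rewrite -H; apply: eq_Rintegral => p _; rewrite Re_mulc_conj.
congr (_ * _); apply: eq_bigr => k _; congr (_ * _).
by rewrite hermite_coef_sum ltn_ord mulrC Re_mulc_conj.
Qed.

(** Expand 0 <= |F - S|^2 pointwise, S being the partial sum built from the coefficients of F on the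
    line, and integrate 2 Re(F conj S) - |S|^2 <= |F|^2. *)
Lemma hermite_bessel F n : entire F -> area_integrable F ->
  gauss_mass theta * \sum_(k < n) theta ^+ k * cmod (hermite_coef h (fun x => F x%:C) k) ^+ 2 <=
  \int[(mu \x mu)%E]_p (cmod (F (p.1 +i* p.2)) ^+ 2 * w p).
Proof.
move=> eF iF; pose c := hermite_coef h (fun x => F x%:C); pose S := hermite_sum c n.
have [i1 H1] := hermite_sum_pairing c n eF iF.
have iS : area_integrable (horner S) := area_integrable_horner S.
have -> : gauss_mass theta * \sum_(k < n) theta ^+ k * cmod (c k) ^+ 2 =
  \int[(mu \x mu)%E]_p (2 * (complex.Re (F (p.1 +i* p.2) * (S.[p.1 +i* p.2]^*)%C) * w p) -
    cmod S.[p.1 +i* p.2] ^+ 2 * w p).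
  rewrite RintegralB//; last exact: integrable_realZ.
  rewrite RintegralZl// H1 hermite_sum_area_norm.
  under eq_bigr => k _ do rewrite -Re_mulc_conj [c k * _]mulrC.
  by rewrite -/c; ring.
apply: le_Rintegral => //.
  by apply: integrable_realB => //; exact: integrable_realZ.
move=> p _; rewrite mulrA -mulrBl; apply: ler_wpM2r; first exact: area_weight_ge0.
rewrite !sqr_cmod Re_mulc Re_conjc Im_conjc.
move: (F _) S.[_] => [x y] [u v] /=.
by have := sqr_ge0 (x - u); have := sqr_ge0 (y - v); nra.
Qed.

End hermite_area_bessel.

(** * From entire functions to coefficient decay *)

Section entire_to_hermite.
Context {R : realType}.
Local Notation mu := (@lebesgue_measure R).

Lemma gauss_mass_gt0 (theta : R) : 1 < theta -> 0 < gauss_mass theta.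
Proof.
move=> theta1; rewrite /gauss_mass; set b := 4 / _.
have b0 : 0 < b by rewrite divr_gt0// subr_gt0 expr_gt1// ltW// (lt_trans ltr01).
have ig := integrable_gauss b0.
apply: (@lt_le_trans _ _ (expR (- b))); first exact: expR_gt0.
rewrite -lee_fin fineK; last exact: integrable_fin_num.
have mg : measurable_fun setT (fun t : R => (expR (- (b * t ^+ 2)))%:E).
  by have /measurable_EFinP := measurable_gauss b.
apply: (@le_trans _ _ (\int[mu]_(t in `[0%R, 1%R]) (expR (- (b * t ^+ 2)))%:E)%E); last first.
  by apply: ge0_subset_integral => // t _; rewrite lee_fin expR_ge0.
apply: (@le_trans _ _ (\int[mu]_(t in `[0%R, 1%R]) (expR (- b))%:E)%E).
  by rewrite integral_cst//= lebesgue_measure_itv/= lte_fin ltr01 sube0 mule1.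
apply: ge0_le_integral => //.
- exact: measurable_funTS.
- move=> t /=; rewrite in_itv/= => /andP[t0 t1]; rewrite lee_fin ler_expR lerN2.
  by rewrite ler_piMr ?(ltW b0)// exprn_ile1.
Qed.

Lemma ae_imply (P Q : R -> Prop) : {ae mu, forall x, P x} -> (forall x, P x -> Q x) ->
  {ae mu, forall x, Q x}.
Proof.
move=> [N [mN N0 sub]] PQ; exists N; split => // x /= nQ.
by apply: sub => /= Px; apply: nQ; exact: PQ.
Qed.

Lemma nneseries_bounded (u : nat -> R) (M : R) : (forall k, 0 <= u k) ->
  (forall n, \sum_(k < n) u k <= M) -> (\sum_(0 <= k <oo) (u k)%:E < +oo)%E.
Proof.
move=> u0 uM; apply: le_lt_trans (ltry M); apply: lime_le.
  by apply: is_cvg_nneseries => k _ _; rewrite lee_fin.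
by apply: nearW => n; rewrite sumEFin lee_fin big_mkord; exact: uM.
Qed.

Lemma weighted_area_integrable (theta : R) (F : R[i] -> R[i]) : entire F ->
  (weighted_area_integral theta F < +oo)%E -> area_integrable theta F.
Proof.
move=> eF; rewrite /weighted_area_integral => iF.
apply/ge0_integrableP.
- apply: measurable_funM; last exact: measurable_area_weight.
  by apply: measurable_funX; exact: cmeasurable_cmod (cmeasurable_plane eF).
- by move=> p; exact: mulr_ge0 (sqr_ge0 _) (area_weight_ge0 _ _).
apply: le_lt_trans iF; rewrite le_eqVlt; apply/orP; left; apply/eqP.
apply: eq_integral => p _; congr ((_ * _)%:E); rewrite /area_weight -expRD.
by congr expR; ring.
Qed.

Lemma measurable_cfunE (f : R -> R[i]) : measurable_cfun f -> cmeasurable f.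
Proof. by []. Qed.

Lemma entire_real_measurable (F : R[i] -> R[i]) : entire F -> cmeasurable (fun x : R => F x%:C).
Proof.
move=> eF; have [c1 c2] := entire_horizontal_continuous 0 eF.
by split; exact: continuous_measurable_fun.
Qed.

Lemma hermite_coef_ae (h : nat -> {poly R}) (f g : R -> R[i]) k :
  cmeasurable f -> cmeasurable g -> {ae mu, forall x, f x = g x} ->
  hermite_coef h f k = hermite_coef h g k.
Proof.
move=> [f1 f2] [g1 g2] fg.
have mw := @measurable_gauss1 R.
have mh := measurable_horner (h k).
rewrite /hermite_coef; congr (_ +i* _); apply: ae_eq_Rintegral.
- by do 2 apply: measurable_funM => //.
- by do 2 apply: measurable_funM => //.
- have PQ : forall x, f x = g x -> complex.Re (f x) * (h k).[x] * expR (- x ^+ 2) =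
    complex.Re (g x) * (h k).[x] * expR (- x ^+ 2) by move=> x ->.
  exact: ae_imply fg PQ.
- by do 2 apply: measurable_funM => //.
- by do 2 apply: measurable_funM => //.
- have PQ : forall x, f x = g x -> complex.Im (f x) * (h k).[x] * expR (- x ^+ 2) =
    complex.Im (g x) * (h k).[x] * expR (- x ^+ 2) by move=> x ->.
  exact: ae_imply fg PQ.
Qed.

(** As a <= 1, square integrability against exp(-a x^2) implies it against exp(-x^2). The bound from
    Bessel's inequality does not depend on the number of terms. *)
Lemma entire_hermite_decay (h : nat -> {poly R}) (theta : R) (f : R -> R[i]) (F : R[i] -> R[i]) :
  orthonormal_hermite h -> 1 < theta -> measurable_cfun f -> entire F ->
  (weighted_area_integral theta F < +oo)%E -> {ae mu, forall x, f x = F x%:C} ->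
  gaussian_L2 f /\
  (\sum_(0 <= k <oo) (cmod (hermite_coef h f k) ^+ 2 * theta ^+ k)%:E < +oo)%E.
Proof.
move=> hh theta1 mf eF wF fF; have iF := weighted_area_integrable eF wF.
have mF := entire_real_measurable eF; have mfE := measurable_cfunE mf.
split.
  split=> //.
  have iFx := real_line_sqr_integrable eF iF.
  have mw := @measurable_gauss1 R.
  have m1 : measurable_fun setT (fun x : R => (cmod (f x) ^+ 2 * expR (- x ^+ 2))%:E).
    apply/measurable_EFinP; apply: measurable_funM => //.
    by apply: measurable_funX; exact: cmeasurable_cmod.
  have m2 : measurable_fun setT (fun x : R => (cmod (F x%:C) ^+ 2 * expR (- x ^+ 2))%:E).
    apply/measurable_EFinP; apply: measurable_funM => //.
    by apply: measurable_funX; exact: cmeasurable_cmod.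
  rewrite (@ae_eq_integral _ _ _ mu setT (fun x : R => (cmod (F x%:C) ^+ 2 * expR (- x ^+ 2))%:E))//; last first.
    case: fF => N [mN N0 sub]; exists N; split => // x /= nfg.
    by apply: sub => /= fgx; apply: nfg => _; rewrite fgx.
  have m3 := integrable_measurable_real iFx.
  move/(ge0_integrableP _ m3) : iFx => /(_ (fun x => mulr_ge0 (sqr_ge0 _) (expR_ge0 _))).
  apply: le_lt_trans; apply: ge0_le_integral => //.
  - by move=> x _; rewrite lee_fin (mulr_ge0 (sqr_ge0 _) (expR_ge0 _)).
  - exact/measurable_EFinP.
  - move=> x _; rewrite lee_fin; apply: ler_wpM2l; first exact: sqr_ge0.
    rewrite ler_expR lerN2 ler_piMl// ?sqr_ge0// ler_pdivrMr ?mul1r; lra.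
have gm := gauss_mass_gt0 theta1.
pose M := \int[(mu \x mu)%E]_p (cmod (F (p.1 +i* p.2)) ^+ 2 * area_weight theta p).
apply: (@nneseries_bounded _ (M / gauss_mass theta)).
  by move=> k; rewrite mulr_ge0 ?sqr_ge0// exprn_ge0// ltW// (lt_trans ltr01).
move=> n; rewrite ler_pdivlMr// mulrC.
apply: le_trans (hermite_bessel hh theta1 n eF iF); rewrite ler_pM2l//.
rewrite le_eqVlt; apply/orP; left; apply/eqP; apply: eq_bigr => k _.
by rewrite mulrC (hermite_coef_ae _ _ mfE mF fF).
Qed.

End entire_to_hermite.

(** * Hermite series *)

Section hermite_growth.
Context {R : realType}.
Local Notation al := (@hermite_alpha R).

Lemma hermite_alphaS_gt0 k : 0 < al k.+1.
Proof. by rewrite sqrtr_gt0 divr_gt0. Qed.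

Lemma hermite_alpha_le k : al k <= al k.+1.
Proof. by rewrite ler_wsqrtr// ler_wpM2r// ler_nat. Qed.

(** As the alphas tend to infinity, the recurrence approaches x_{k+1} <= x_{k-1}, hence growth
    slower than any rho^k. D does not depend on the sequence x, which gives uniformity in z; the
    forcing C rho^k admits derivatives and difference quotients. *)
Lemma hermite_recurrence_growth (rho M C : R) : 1 < rho -> 0 <= M -> 0 <= C ->
  exists2 D : R, 0 <= D & forall x : nat -> R, x 0%N <= C ->
    (forall k, x k.+1 <= (M * x k + C * rho ^+ k) / al k.+1 + x k.-1) ->
    forall k, x k <= D * rho ^+ k.
Proof.
move=> rho1 M0 C0.
have rho0 : 0 <= rho by rewrite ltW// (lt_trans ltr01).
pose P := fix P k : R * R :=
  if k is j.+1 then ((M * (P j).1 + C * rho ^+ j) / al j.+1 + (P j).2, (P j).1) else (C, C).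
(* [y] solves the recurrence with equality; for k large, [al k.+1] exceeds [B] and the growth
   factor drops below [rho]. *)
pose y k := (P k).1.
have yS k : y k.+1 = (M * y k + C * rho ^+ k) / al k.+1 + y k.-1 by case: k.
have ial k : 0 <= (al k.+1)^-1 by rewrite invr_ge0 ltW// hermite_alphaS_gt0.
have y0 k : 0 <= y k.
  suff : 0 <= y k /\ 0 <= y k.-1 by case.
  elim: k => [//|k [h1 h2]]; split => //; rewrite yS addr_ge0// mulr_ge0//.
  by rewrite addr_ge0// mulr_ge0// exprn_ge0.
have rho21 : 0 < rho ^+ 2 - 1 by rewrite subr_gt0 expr_gt1.
(* The condition (M + 1) rho <= al (rho^2 - 1) is what the step from rho^m and rho^(m+1) to
   rho^(m+2) requires. It holds once (k+1)/2 >= B^2, whence K. *)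
pose B := (M + 1) * rho / (rho ^+ 2 - 1).
have B0 : 0 <= B by rewrite divr_ge0 ?(ltW rho21)// mulr_ge0// addr_ge0.
pose K := Num.bound (2 * B ^+ 2).
have alK k : (K <= k)%N -> B <= al k.+1.
  move=> Kk; rewrite -[B]ger0_norm// -sqrtr_sqr; apply: ler_wsqrtr.
  rewrite ler_pdivlMr// mulrC; apply: le_trans (ltW (archi_boundP _)) _.
    by rewrite mulr_ge0// sqr_ge0.
  by rewrite ler_nat (leq_trans Kk).
(* The finite sum takes care of the indices before the induction step becomes valid. *)
pose D := C + \sum_(k < K.+2) y k.
have D0 : 0 <= D by rewrite addr_ge0// sumr_ge0.
have CD : C <= D by rewrite lerDl sumr_ge0.
have rhok k : 1 <= rho ^+ k by rewrite exprn_ege1// ltW.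
have yD k : y k <= D * rho ^+ k.
  suff : forall j, (j <= k)%N -> y j <= D * rho ^+ j by apply.
  elim: k => [|k IH] j.
    rewrite leqn0 => /eqP ->; rewrite expr0 mulr1; exact: CD.
  rewrite leq_eqVlt => /predU1P[->|]; last exact: IH.
  have [kK|] := ltnP k.+1 K.+2.
    apply: le_trans (_ : D <= _); last by rewrite ler_peMr.
    rewrite /D (bigD1 (Ordinal kK))//= addrCA lerDl addr_ge0// sumr_ge0//.
  rewrite ltnS => Kk; case: k Kk IH => [//|m] Km IH.
  have IH1 := IH _ (leqnn _); have IH2 := IH _ (leqnSn _).
  rewrite yS /=.
  have a0 := hermite_alphaS_gt0 m.+1.
  have aB : (M + 1) * rho <= al m.+2 * (rho ^+ 2 - 1).
    by rewrite -ler_pdivrMr//; apply: alK; exact: leqW.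
  have rm : 0 <= rho ^+ m by rewrite exprn_ge0.
  apply: (@le_trans _ _ ((M * (D * rho ^+ m.+1) + D * rho ^+ m.+1) / al m.+2 + D * rho ^+ m)).
    apply: lerD => //; apply: ler_wpM2r => //; apply: lerD; first exact: ler_wpM2l.
    by apply: ler_wpM2r => //; rewrite exprn_ge0.
  have -> : D * rho ^+ m.+2 = D * rho ^+ m * (rho ^+ 2 - 1) + D * rho ^+ m.
    by rewrite !exprS expr0; ring.
  rewrite lerD2r ler_pdivrMr//.
  have -> : M * (D * rho ^+ m.+1) + D * rho ^+ m.+1 = D * rho ^+ m * ((M + 1) * rho).
    by rewrite exprS; ring.
  rewrite -[leRHS]mulrA; apply: ler_wpM2l; first exact: mulr_ge0.
  by rewrite [leRHS]mulrC.
exists D => // x x0 xS k; apply: le_trans (yD k).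
suff : x k <= y k /\ x k.-1 <= y k.-1 by case.
elim: k => [//|k [h1 h2]]; split => //; rewrite yS; apply: le_trans (xS k) _.
apply: lerD => //; apply: ler_wpM2r => //; rewrite lerD2r; exact: ler_wpM2l.
Qed.

Lemma three_term_cmod_le k (X A Y : R[i]) :
  (al k.+1)%:C * X = A - (al k)%:C * Y -> cmod X <= cmod A / al k.+1 + cmod Y.
Proof.
move=> E; have a0 := hermite_alphaS_gt0 k.
rewrite -(ler_pM2l a0) mulrDr mulrCA divff ?gt_eqF// mulr1.
have := congr1 (@cmod R) E; rewrite cmodM cmod_real ger0_norm ?(ltW a0)// => ->.
apply: le_trans (cmodB_le _ _) _; rewrite lerD2l cmodM cmod_real ger0_norm ?sqrtr_ge0//.
by apply: ler_wpM2r; [exact: cmod_ge0|exact: hermite_alpha_le].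
Qed.

Variable h : nat -> {poly R}.
Hypothesis hh : orthonormal_hermite h.
Local Notation H k := (hermiteC h k).

Let HS k z : (al k.+1)%:C * (H k.+1).[z] = z * (H k).[z] - (al k)%:C * (H k.-1).[z].
Proof.
have := congr1 (horner^~ z) (hermiteC_recurrence hh k).
by rewrite hornerM hornerX hornerD !hornerZ => ->; rewrite addrK.
Qed.

Let GS k z : (al k.+1)%:C * (H k.+1)^`().[z] =
  (z * (H k)^`().[z] + (H k).[z]) - (al k)%:C * (H k.-1)^`().[z].
Proof.
have := congr1 (fun p : {poly R[i]} => p^`().[z]) (hermiteC_recurrence hh k).
rewrite derivM derivX derivD !derivZ !hornerD !hornerZ hornerM hornerM hornerX hornerC mul1r.
by move=> E; rewrite addrC [_ + (H k).[z]]addrC E addrC addrK.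
Qed.

Let H0E : exists c : R[i], H 0%N = c%:P.
Proof.
have /size_poly1P[c _ hc] : size (h 0%N) == 1%N by case: hh => ->.
by exists c%:C; rewrite /hermiteC hc map_polyC.
Qed.

(** The quadratic Taylor remainder is bounded directly, uniformly in k, so that the series can be
    differentiated term by term without Cauchy estimates. The bounds are derived on the radius M + 1
    to accommodate z + w. *)
Lemma hermite_locally_bounded (rho M : R) : 1 < rho -> 0 <= M ->
  exists2 D : R, 0 <= D & forall z w : R[i], cmod z <= M -> cmod w <= 1 -> forall k,
    [/\ cmod (H k).[z] <= D * rho ^+ k, cmod (H k)^`().[z] <= D * rho ^+ k &
      cmod ((H k).[z + w] - (H k).[z] - w * (H k)^`().[z]) <= D * rho ^+ k * cmod w ^+ 2].
Proof.
move=> rho1 M0; have [c cE] := H0E.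
have rho0 : 0 < rho by rewrite (lt_trans ltr01).
have rk k : 0 <= rho ^+ k by rewrite exprn_ge0// ltW.
have M10 : 0 <= M + 1 by rewrite addr_ge0.
have ial k : 0 <= (al k.+1)^-1 by rewrite invr_ge0 ltW// hermite_alphaS_gt0.
have [D1 D10 HD1] := hermite_recurrence_growth rho1 M10 (cmod_ge0 c).
have [D2 D20 HD2] := hermite_recurrence_growth rho1 M10 D10.
have [D3 D30 HD3] := hermite_recurrence_growth rho1 M10 D20.
have bH z : cmod z <= M + 1 -> forall k, cmod (H k).[z] <= D1 * rho ^+ k.
  move=> zM; apply: (HD1 (fun k => cmod (H k).[z])) => [|k]; first by rewrite cE hornerC.
  apply: le_trans (three_term_cmod_le (HS k z)) _; rewrite lerD2r.
  apply: ler_wpM2r => //; rewrite cmodM -[leLHS]addr0; apply: lerD.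
    by apply: ler_wpM2r => //; exact: cmod_ge0.
  by rewrite mulr_ge0// cmod_ge0.
have bG z : cmod z <= M + 1 -> forall k, cmod (H k)^`().[z] <= D2 * rho ^+ k.
  move=> zM; apply: (HD2 (fun k => cmod (H k)^`().[z])) => [|k].
    by rewrite cE derivC horner0 cmod0.
  apply: le_trans (three_term_cmod_le (GS k z)) _; rewrite lerD2r.
  apply: ler_wpM2r => //; apply: le_trans (cmodD_le _ _) _; rewrite cmodM; apply: lerD.
    by apply: ler_wpM2r => //; exact: cmod_ge0.
  exact: bH.
exists (D1 + D2 + D3); first by rewrite !addr_ge0.
move=> z w zM w1 k; have zM1 : cmod z <= M + 1 by rewrite (le_trans zM)// lerDl.
have zwM : cmod (z + w) <= M + 1 by apply: le_trans (cmodD_le _ _) _; exact: lerD.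
have [->|w0] := eqVneq w 0.
  rewrite addr0 subrr mul0r subr0 cmod0 expr0n/= mulr0; split => //.
    by apply: le_trans (bH z zM1 k) _; rewrite ler_wpM2r//; lra.
  by apply: le_trans (bG z zM1 k) _; rewrite ler_wpM2r//; lra.
(* The first and second difference quotients [d] and [e] satisfy the recurrence of the [H j],
   with an inhomogeneous term that is already bounded. *)
pose d j := ((H j).[z + w] - (H j).[z]) / w.
have dS j : (al j.+1)%:C * d j.+1 = ((z + w) * d j + (H j).[z]) - (al j)%:C * d j.-1.
  by rewrite /d [LHS]mulrA [_ * (_ - _) in LHS]mulrBr !HS; field.
have bd j : cmod (d j) <= D2 * rho ^+ j.
  apply: (HD2 (fun j => cmod (d j))) => [|i].
    by rewrite /d cE !hornerC subrr mul0r cmod0.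
  apply: le_trans (three_term_cmod_le (dS i)) _; rewrite lerD2r.
  apply: ler_wpM2r => //; apply: le_trans (cmodD_le _ _) _; rewrite cmodM; apply: lerD.
    by apply: ler_wpM2r => //; exact: cmod_ge0.
  exact: bH.
pose e j := (d j - (H j)^`().[z]) / w.
have eS j : (al j.+1)%:C * e j.+1 = (z * e j + d j) - (al j)%:C * e j.-1.
  by rewrite /e [LHS]mulrA [_ * (_ - _) in LHS]mulrBr dS GS; field.
have be j : cmod (e j) <= D3 * rho ^+ j.
  apply: (HD3 (fun j => cmod (e j))) => [|i].
    by rewrite /e /d cE !hornerC derivC horner0 subrr mul0r subr0 mul0r cmod0.
  apply: le_trans (three_term_cmod_le (eS i)) _; rewrite lerD2r.
  apply: ler_wpM2r => //; apply: le_trans (cmodD_le _ _) _; rewrite cmodM; apply: lerD.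
    by apply: ler_wpM2r => //; exact: cmod_ge0.
  exact: bd.
split.
- by apply: le_trans (bH z zM1 k) _; rewrite ler_wpM2r//; lra.
- by apply: le_trans (bG z zM1 k) _; rewrite ler_wpM2r//; lra.
have -> : (H k).[z + w] - (H k).[z] - w * (H k)^`().[z] = e k * w ^+ 2.
  by rewrite /e /d; field.
rewrite cmodM expr2 cmodM -expr2; apply: ler_wpM2r; first exact: sqr_ge0.
by apply: le_trans (be k) _; rewrite ler_wpM2r//; lra.
Qed.

End hermite_growth.

(** * Convergence of complex series *)

Section complex_series.
Context {R : realType}.

Definition complex_cvg (p : nat -> R[i]) (s : R[i]) :=
  complex.Re (p n) @[n --> \oo] --> complex.Re s /\
  complex.Im (p n) @[n --> \oo] --> complex.Im s.

Lemma complex_cvgB p q s t : complex_cvg p s -> complex_cvg q t ->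
  complex_cvg (fun n => p n - q n) (s - t).
Proof.
move=> [p1 p2] [q1 q2]; split.
  under eq_fun do rewrite Re_addc Re_oppc; rewrite Re_addc Re_oppc; exact: cvgB.
by under eq_fun do rewrite Im_addc Im_oppc; rewrite Im_addc Im_oppc; exact: cvgB.
Qed.

Lemma complex_cvgMl w p s : complex_cvg p s -> complex_cvg (fun n => w * p n) (w * s).
Proof.
move=> [p1 p2]; split.
  under eq_fun do rewrite Re_mulc; rewrite Re_mulc.
  by apply: cvgB; apply: cvgMr.
under eq_fun do rewrite Im_mulc; rewrite Im_mulc.
by apply: cvgD; apply: cvgMr.
Qed.

Lemma complex_cvg_sqr_cmod p s : complex_cvg p s ->
  cmod (p n) ^+ 2 @[n --> \oo] --> cmod s ^+ 2.
Proof.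
move=> [p1 p2]; under eq_fun do rewrite sqr_cmod; rewrite sqr_cmod.
by apply: cvgD; rewrite expr2; under eq_fun do rewrite expr2; exact: cvgM.
Qed.

Lemma complex_cvg_cmod_le p s B : 0 <= B -> complex_cvg p s -> (forall n, cmod (p n) <= B) ->
  cmod s <= B.
Proof.
move=> B0 ps pB; rewrite -(ler_pXn2r (n := 2))// ?nnegrE ?cmod_ge0//.
have c2 := complex_cvg_sqr_cmod ps.
rewrite -(cvg_lim _ c2)//; apply: limr_le; first by apply/cvg_ex; eexists; exact: c2.
by apply: nearW => n; rewrite ler_pXn2r// ?nnegrE ?cmod_ge0.
Qed.

Lemma real_series_cvg (u b : nat -> R) (B : R) : (forall k, `|u k| <= b k) ->
  (forall n, \sum_(k < n) b k <= B) -> exists s : R, (\sum_(k < n) u k : R) @[n --> \oo] --> s.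
Proof.
move=> ub bB; have : cvgn (series u).
  apply: normed_cvg; apply: nondecreasing_is_cvgn.
    apply/nondecreasing_seqP => n; by rewrite /normed_series_of/= seriesSr lerDl.
  exists B => _ [n _ <-]; rewrite /normed_series_of/= seriesEord/=; apply: le_trans (bB n).
  exact: ler_sum.
move=> /cvg_ex[s us]; exists s; move: us; rewrite /series.
by under eq_fun do rewrite big_mkord.
Qed.

Lemma complex_series_cvg (u : nat -> R[i]) (b : nat -> R) (B : R) :
  (forall k, cmod (u k) <= b k) -> (forall n, \sum_(k < n) b k <= B) ->
  exists s, complex_cvg (fun n => \sum_(k < n) u k) s.
Proof.
move=> ub bB.
have [s sE] := real_series_cvg (fun k => le_trans (Re_le_cmod (u k)) (ub k)) bB.
have [t tE] := real_series_cvg (fun k => le_trans (Im_le_cmod (u k)) (ub k)) bB.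
exists (s +i* t); split => /=.
  by under eq_fun do rewrite (big_morph (@complex.Re R) (@Re_addc R) (erefl _)).
by under eq_fun do rewrite (big_morph (@complex.Im R) (@Im_addc R) (erefl _)).
Qed.

Lemma cmod_sum_le n (u : nat -> R[i]) : cmod (\sum_(k < n) u k) <= \sum_(k < n) cmod (u k).
Proof.
elim: n => [|n IH]; first by rewrite !big_ord0 cmod0.
by rewrite !big_ord_recr/=; apply: le_trans (cmodD_le _ _) _; rewrite lerD2r.
Qed.

Lemma geometric_sum_le (q : R) n : 0 <= q -> q < 1 -> \sum_(k < n) q ^+ k <= (1 - q)^-1.
Proof.
move=> q0 q1; have q10 : 0 < 1 - q by rewrite subr_gt0.
rewrite -[leRHS]mul1r ler_pdivlMr//.
suff -> : (\sum_(k < n) q ^+ k) * (1 - q) = 1 - q ^+ n by rewrite gerBl exprn_ge0.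
elim: n => [|n IH]; first by rewrite big_ord0 mul0r expr0 subrr.
by rewrite big_ord_recr/= mulrDl IH exprS; ring.
Qed.

End complex_series.

(** * Entire sums of Hermite series *)

Section hermite_series.
Context {R : realType}.
Local Notation mu := (@lebesgue_measure R).
Variables (h : nat -> {poly R}) (theta : R).
Hypothesis hh : orthonormal_hermite h.
Hypothesis theta1 : 1 < theta.

Lemma coef_geometric_bound (c : nat -> R[i]) (S : R) :
  (forall n, \sum_(k < n) cmod (c k) ^+ 2 * theta ^+ k <= S) ->
  exists rho B, 1 < rho /\ forall n, \sum_(k < n) cmod (c k) * rho ^+ k <= B.
Proof.
(* Here rho = theta^(1/4). The term |c_k| rho^k is the product of |c_k| theta^(k/2) and
   theta^(-k/4), hence at most half of |c_k|^2 theta^k + theta^(-k/2), and the last term is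
   geometric. *)
move=> cS; pose s := Num.sqrt theta; pose rho := Num.sqrt s.
have theta0 : 0 <= theta by rewrite ltW// (lt_trans ltr01).
have s1 : 1 < s by rewrite -sqrtr1 ltr_sqrt// (lt_trans ltr01).
have s0 : 0 < s by rewrite (lt_trans ltr01).
have rho1 : 1 < rho by rewrite -sqrtr1 ltr_sqrt.
have rho0 : 0 < rho by rewrite (lt_trans ltr01).
have s2 : s ^+ 2 = theta by rewrite sqr_sqrtr.
have rho2 : rho ^+ 2 = s by rewrite sqr_sqrtr// ltW.
exists rho, ((S + (1 - s^-1)^-1) / 2); split => // n.
have q1 : s^-1 < 1 by rewrite invf_lt1.
have q0 : 0 <= s^-1 by rewrite invr_ge0 ltW.
apply: (@le_trans _ _ (\sum_(k < n) (cmod (c k) ^+ 2 * theta ^+ k + s^-1 ^+ k) / 2)).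
  apply: ler_sum => k _.
  have -> : cmod (c k) * rho ^+ k = (cmod (c k) * s ^+ k) * (rho ^+ k / s ^+ k).
    by field; rewrite expf_neq0// gt_eqF.
  have := mul_le_half_sqr (cmod (c k) * s ^+ k) (rho ^+ k / s ^+ k).
  rewrite !exprMn exprVn -!exprM [(k * 2)%N]mulnC !exprM s2 rho2.
  congr (_ <= (_ + _) / 2); field; by rewrite expf_neq0// gt_eqF.
rewrite -mulr_suml ler_wpM2r ?invr_ge0// big_split/=; apply: lerD; first exact: cS.
exact: geometric_sum_le.
Qed.

Lemma hermite_sum_horner c n (z : R[i]) :
  (hermite_sum h c n).[z] = \sum_(k < n) c k * (hermiteC h k).[z].
Proof. by rewrite /hermite_sum horner_sum; apply: eq_bigr => k _; rewrite hornerZ. Qed.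

(** The derivative is the sum of the termwise derivatives: summing the quadratic remainders against
    |c_k| rho^k leaves an error of at most D B |w|^2. *)
Lemma hermite_series_entire (c : nat -> R[i]) (S : R) :
  (forall n, \sum_(k < n) cmod (c k) ^+ 2 * theta ^+ k <= S) ->
  exists F, entire F /\ forall z, complex_cvg (fun n => (hermite_sum h c n).[z]) (F z).
Proof.
move=> /coef_geometric_bound[rho [B [rho1 cB]]].
have rho0 : 0 < rho by rewrite (lt_trans ltr01).
have B0 : 0 <= B by have := cB 0%N; rewrite big_ord0.
have cvg (f : nat -> R[i]) D : 0 <= D -> (forall k, cmod (f k) <= D * rho ^+ k) ->
    exists s, complex_cvg (fun n => \sum_(k < n) c k * f k) s.
  move=> D0 fD; apply: (@complex_series_cvg R (fun k => c k * f k) (fun k => D * (cmod (c k) * rho ^+ k)) (D * B)).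
    move=> k; rewrite cmodM mulrCA; apply: ler_wpM2l; [exact: cmod_ge0|exact: fD].
  by move=> n; rewrite -mulr_sumr; apply: ler_wpM2l.
have /choice[F HF] : forall z, exists s, complex_cvg (fun n => (hermite_sum h c n).[z]) s.
  move=> z; have [D D0 HD] := hermite_locally_bounded hh rho1 (cmod_ge0 z).
  have [s sE] := cvg (fun k => (hermiteC h k).[z]) D D0
    (fun k => ltac:(by case: (HD z 0 (lexx _) (ltac:(by rewrite cmod0)) k))).
  by exists s; under eq_fun do rewrite hermite_sum_horner.
exists F; split => //; apply/entireP => z.
have [D D0 HD] := hermite_locally_bounded hh rho1 (cmod_ge0 z).
have [l lE] := cvg (fun k => (hermiteC h k)^`().[z]) D D0
    (fun k => ltac:(by case: (HD z 0 (lexx _) (ltac:(by rewrite cmod0)) k))).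
exists l => e e0.
have DB : 0 < D * B + 1 by rewrite ltr_wpDl// mulr_ge0.
exists (Num.min 1 (e / (D * B + 1))); first by rewrite lt_min ltr01 divr_gt0.
move=> w; rewrite lt_min => /andP[w1 we].
have : cmod (F (z + w) - F z - l * w) <= D * B * cmod w ^+ 2.
  have := complex_cvgB (complex_cvgB (HF (z + w)) (HF z)) (complex_cvgMl w lE).
  rewrite [w * l]mulrC => /complex_cvg_cmod_le; apply.
    exact: mulr_ge0 (mulr_ge0 D0 B0) (sqr_ge0 _).
  move=> n; rewrite !hermite_sum_horner mulr_sumr -!sumrB.
  apply: le_trans (cmod_sum_le _ (fun k => c k * (hermiteC h k).[z + w] -
     c k * (hermiteC h k).[z] - w * (c k * (hermiteC h k)^`().[z]))) _.
  apply: (@le_trans _ _ (\sum_(k < n) (cmod (c k) * rho ^+ k) * (D * cmod w ^+ 2))).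
    apply: ler_sum => k _; have [_ _ Hk] := HD z w (lexx _) (ltW w1) k.
    have -> : c k * (hermiteC h k).[z + w] - c k * (hermiteC h k).[z] -
      w * (c k * (hermiteC h k)^`().[z]) =
      c k * ((hermiteC h k).[z + w] - (hermiteC h k).[z] - w * (hermiteC h k)^`().[z]) by ring.
    rewrite cmodM -mulrA; apply: ler_wpM2l; first exact: cmod_ge0.
    by rewrite mulrCA mulrA.
  rewrite -mulr_suml [leRHS](_ : _ = B * (D * cmod w ^+ 2)); last by ring.
  by apply: ler_wpM2r => //; exact: mulr_ge0 D0 (sqr_ge0 _).
move=> /le_trans; apply; rewrite expr2 mulrA; apply: ler_wpM2r; first exact: cmod_ge0.
apply: (@le_trans _ _ ((D * B + 1) * (e / (D * B + 1)))).
  by apply: ler_pM; rewrite ?mulr_ge0 ?cmod_ge0 ?lerDl// ltW.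
by rewrite mulrC divfK// gt_eqF.
Qed.

(** P is arbitrary because the bound serves twice: for S_n with limit F, and for S_{m+n} - S_n with
    limit F - S_n. *)
Lemma area_fatou (P : nat -> {poly R[i]}) F (K : R) : entire F ->
  (forall z, complex_cvg (fun n => (P n).[z]) (F z)) ->
  (forall n, \int[(mu \x mu)%E]_p (cmod (P n).[p.1 +i* p.2] ^+ 2 * area_weight theta p) <= K) ->
  area_integrable theta F /\
  \int[(mu \x mu)%E]_p (cmod (F (p.1 +i* p.2)) ^+ 2 * area_weight theta p) <= K.
Proof.
move=> eF PF PK.
have mG G : entire G -> measurable_fun setT
    (fun p : R * R => cmod (G (p.1 +i* p.2)) ^+ 2 * area_weight theta p).
  move=> eG; apply: measurable_funM; last exact: measurable_area_weight.
  by apply: measurable_funX; exact: cmeasurable_cmod (cmeasurable_plane eG).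
have G0 (G : R[i] -> R[i]) (p : R * R) : 0 <= cmod (G (p.1 +i* p.2)) ^+ 2 * area_weight theta p.
  exact: mulr_ge0 (sqr_ge0 _) (area_weight_ge0 _ _).
have H : (\int[(mu \x mu)%E]_p (cmod (F (p.1 +i* p.2)) ^+ 2 * area_weight theta p)%:E <= K%:E)%E.
  have ft := @fatou _ _ R (mu \x mu)%E setT measurableT
    (fun n (p : R * R) => (cmod (P n).[p.1 +i* p.2] ^+ 2 * area_weight theta p)%:E)
    (fun n => (measurable_EFinP _ _).2 (mG _ (entire_horner (P n))))
    (fun n p _ => ltac:(by rewrite lee_fin (G0 (horner (P n)) p))).
  apply: le_trans (le_trans ft _).
    rewrite le_eqVlt; apply/orP; left; apply/eqP; apply: eq_integral => p _.
    have cp : (cmod (P n).[p.1 +i* p.2] ^+ 2 * area_weight theta p)%:E @[n --> \oo] -->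
        (cmod (F (p.1 +i* p.2)) ^+ 2 * area_weight theta p)%:E.
      apply: cvg_EFin; first by near=> n.
      by apply: cvgMl; exact: complex_cvg_sqr_cmod (PF _).
    by rewrite (cvg_limn_einf_sup cp).1.
  rewrite limn_einf_lim; apply: lime_le; first exact: is_cvg_einfs.
  apply: nearW => n; apply: (@le_trans _ _ (\int[(mu \x mu)%E]_p
    (cmod (P n).[p.1 +i* p.2] ^+ 2 * area_weight theta p)%:E)%E).
    by apply: ereal_inf_lbound; exists n => //=.
  have iP := area_integrable_horner theta1 (P n).
  rewrite -[leLHS]fineK ?lee_fin; first exact: PK.
  by apply: (integrable_fin_num _ iP).
have iF : area_integrable theta F.
  by apply/ge0_integrableP => //; [exact: mG|exact: le_lt_trans H (ltry _)].
split=> //; rewrite -lee_fin fineK//; exact: integrable_fin_num.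
Unshelve. all: by end_near. Qed.

End hermite_series.

(** * An entire function with prescribed Hermite coefficients *)

Section hermite_to_entire.
Context {R : realType}.
Local Notation mu := (@lebesgue_measure R).
Variables (h : nat -> {poly R}) (theta : R).
Hypothesis hh : orthonormal_hermite h.
Hypothesis theta1 : 1 < theta.

Lemma hermite_coefB F G k : entire F -> entire G -> area_integrable theta F ->
  area_integrable theta G ->
  hermite_coef h (fun x => F x%:C - G x%:C) k =
  hermite_coef h (fun x => F x%:C) k - hermite_coef h (fun x => G x%:C) k.
Proof.
move=> eF eG iF iG.
have [rF rG] := (Re_hermite_integrable h theta1 eF iF k, Re_hermite_integrable h theta1 eG iG k).
have [mF mG] := (Im_hermite_integrable h theta1 k eF iF, Im_hermite_integrable h theta1 k eG iG).
rewrite /hermite_coef.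
transitivity ((\int[mu]_x (complex.Re (F x%:C) * (h k).[x] * expR (- x ^+ 2)) -
    \int[mu]_x (complex.Re (G x%:C) * (h k).[x] * expR (- x ^+ 2))) +i*
  (\int[mu]_x (complex.Im (F x%:C) * (h k).[x] * expR (- x ^+ 2)) -
    \int[mu]_x (complex.Im (G x%:C) * (h k).[x] * expR (- x ^+ 2)))) => //.
rewrite -!RintegralB//; congr (_ +i* _); apply: eq_Rintegral => x _.
  by rewrite Re_addc Re_oppc !mulrBl.
by rewrite Im_addc Im_oppc !mulrBl.
Qed.

(** Zeroing the first n coefficients makes the tail itself a Hermite sum, so that the norm formula
    applies to it. *)
Lemma hermite_sum_tail (c : nat -> R[i]) n m :
  hermite_sum h (fun k => if (k < n)%N then 0 else c k) (m + n) =
  hermite_sum h c (m + n) - hermite_sum h c n.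
Proof.
elim: m => [|m IH].
  rewrite add0n subrr /hermite_sum big1// => k _.
  by rewrite ltn_ord scale0r.
by rewrite addSn !hermite_sumS IH ltnNge leq_addl/= addrAC.
Qed.

Lemma partial_sum_tail (c : nat -> R[i]) n m :
  \sum_(k < m + n) theta ^+ k * cmod (if (k < n)%N then 0 else c k) ^+ 2 =
  \sum_(k < m + n) cmod (c k) ^+ 2 * theta ^+ k - \sum_(k < n) cmod (c k) ^+ 2 * theta ^+ k.
Proof.
elim: m => [|m IH].
  rewrite add0n subrr big1// => k _.
  by rewrite ltn_ord cmod0 expr0n mulr0.
by rewrite addSn !big_ord_recr/= IH ltnNge leq_addl/= addrAC [_ * cmod _ ^+ 2]mulrC.
Qed.

Lemma complex_cvg_shift (p : nat -> R[i]) s n : complex_cvg p s ->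
  complex_cvg (fun m => p (m + n)%N) s.
Proof.
by move=> [p1 p2]; split; [apply: cvg_comp p1|apply: cvg_comp p2]; exact: cvg_addnr.
Qed.

Lemma hermite_interpolation (c : nat -> R[i]) (S : R) :
  (forall n, \sum_(k < n) cmod (c k) ^+ 2 * theta ^+ k <= S) ->
  exists F, [/\ entire F, area_integrable theta F &
    forall k, hermite_coef h (fun x => F x%:C) k = c k].
Proof.
move=> cS; have [F [eF PF]] := hermite_series_entire hh theta1 cS.
have gm := gauss_mass_gt0 theta1.
have theta0 : 0 <= theta by rewrite ltW// (lt_trans ltr01).
pose u n := \sum_(k < n) cmod (c k) ^+ 2 * theta ^+ k.
have iF : area_integrable theta F.
  apply: (proj1 (area_fatou (K := gauss_mass theta * S) theta1 eF PF _)) => n.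
  rewrite hermite_sum_area_norm// ler_pM2l//; apply: le_trans (cS n).
  by apply: ler_sum => k _; rewrite mulrC.
exists F; split=> // k.
have u_incr : {homo u : n m / (n <= m)%N >-> n <= m}.
  apply/nondecreasing_seqP => n; rewrite /u big_ord_recr/= lerDl.
  exact: mulr_ge0 (sqr_ge0 _) (exprn_ge0 _ theta0).
have u_cvg : cvgn u.
  by apply: nondecreasing_is_cvgn => //; exists S => _ [n _ <-]; exact: cS.
have uT n : u n <= limn u by exact: nondecreasing_cvgn_le.
set d := hermite_coef _ _ _.
(* Bessel's inequality for F - S_n, whose norm is controlled by the tail of the series. *)
have dT n : (k < n)%N -> cmod (d - c k) ^+ 2 <= limn u - u n.
  move=> kn; pose P m := hermite_sum h (fun j => if (j < n)%N then 0 else c j) (m + n).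
  pose G z := F z - (hermite_sum h c n).[z].
  have eS : entire (horner (hermite_sum h c n)) := entire_horner _.
  have iS := area_integrable_horner theta1 (hermite_sum h c n).
  have eG : entire G := entireD eF (entireN eS).
  have PG z : complex_cvg (fun m => (P m).[z]) (G z).
    rewrite /P; under eq_fun do rewrite hermite_sum_tail hornerD hornerN.
    apply: complex_cvgB; first exact: (complex_cvg_shift n (PF z)).
    by split; exact: cvg_cst.
  have [iG nG] : area_integrable theta G /\
    \int[(mu \x mu)%E]_p (cmod (G (p.1 +i* p.2)) ^+ 2 * area_weight theta p) <=
      gauss_mass theta * (limn u - u n).
    apply: (area_fatou theta1 eG PG) => m.
    rewrite hermite_sum_area_norm// ler_pM2l// partial_sum_tail lerD2r; exact: uT.
  (* The sum with k + 1 terms contains the k-th one, and theta^k >= 1 lets its weight be dropped. *)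
  have := le_trans (hermite_bessel hh theta1 k.+1 eG iG) nG.
  rewrite ler_pM2l//; apply: le_trans.
  have dE : hermite_coef h (fun x => G x%:C) k = d - c k.
    by rewrite /G hermite_coefB// hermite_coef_sum// kn.
  rewrite big_ord_recr/= dE.
  apply: (@le_trans _ _ (theta ^+ k * cmod (d - c k) ^+ 2)).
    by apply: ler_peMl; [exact: sqr_ge0|rewrite exprn_ege1// ltW].
  rewrite lerDr; apply: sumr_ge0 => j _.
  exact: mulr_ge0 (exprn_ge0 _ theta0) (sqr_ge0 _).
have c0 : limn u - u n @[n --> \oo] --> (0 : R).
  by rewrite -(subrr (limn u)); apply: cvgB => //; exact: cvg_cst.
have : cmod (d - c k) ^+ 2 <= 0.
  rewrite -(cvg_lim _ c0)//; apply: limr_ge; first by apply/cvg_ex; eexists; exact: c0.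
  by near=> n; apply: dT; near: n; exact: nbhs_infty_gt.
by rewrite real_exprn_even_le0 ?num_real//= cmod_eq0 subr_eq0 => /eqP.
Unshelve. all: by end_near. Qed.

Lemma area_integrable_weighted F : area_integrable theta F ->
  (weighted_area_integral theta F < +oo)%E.
Proof.
move=> /integrableP[_]; apply: le_lt_trans.
rewrite le_eqVlt; apply/orP; left; apply/eqP; apply: eq_integral => p _.
rewrite /= ger0_norm ?(mulr_ge0 (sqr_ge0 _) (area_weight_ge0 _ _))//.
congr ((_ * _)%:E); rewrite /area_weight -expRD; congr expR; ring.
Qed.

End hermite_to_entire.

(** * Completeness of the Hermite polynomials *)

Section dominated_vanishing.
Context {R : realType}.
Local Notation mu := (@lebesgue_measure R).

Lemma Rintegral_dominated_eq0 (u : nat -> R -> R) (f G : R -> R) :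
  (forall n, measurable_fun setT (u n)) -> (forall x, u n x @[n --> \oo] --> f x) ->
  mu.-integrable setT (EFin \o G) -> (forall n x, `|u n x| <= G x) ->
  (forall n, \int[mu]_x u n x = 0) -> \int[mu]_x f x = 0.
Proof.
move=> mu_ uf iG uG u0.
have cu := @dominated_cvg _ (measurableTypeR R) R mu setT measurableT
  (fun n x => (u n x)%:E) (EFin \o f) (EFin \o G)
  (fun n => (measurable_EFinP _ _).2 (mu_ n)).
have {}cu : (\int[mu]_x (u n x)%:E @[n --> \oo] --> \int[mu]_x (f x)%:E)%E.
  apply: cu => //.
    by move=> x _; apply: cvg_EFin; [near=> n|exact: uf].
  by move=> n x _; rewrite lee_fin; exact: uG.
have uE n : (\int[mu]_x (u n x)%:E = 0)%E.
  rewrite -[LHS]fineK; first by have := u0 n; rewrite /Rintegral => ->.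
  have iu : mu.-integrable setT (EFin \o u n).
    exact: (@integrable_dominated R _ (measurableTypeR R) mu setT (u n) G measurableT (mu_ n) (fun x _ => uG n x) iG).
  exact: integrable_fin_num iu.
rewrite /Rintegral (_ : (\int[mu]_x (f x)%:E = 0)%E)//.
rewrite -(cvg_lim _ cu)//; under eq_fun do rewrite uE.
exact: lim_cst.
Unshelve. all: by end_near. Qed.

End dominated_vanishing.

Section exponential_bounds.
Context {R : realType}.

Lemma exp_series_norm_le (t : R) n : `|series (exp_coeff t) n| <= expR `|t|.
Proof.
apply: (@le_trans _ _ (series (exp_coeff `|t|) n)).
  rewrite /series/=; apply: le_trans (ler_norm_sum _ _ _) _.
  by apply: ler_sum => i _; rewrite /exp_coeff/= normrM normrX normfV [`|_%:R|]ger0_norm.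
apply: nondecreasing_cvgn_le; last exact: is_cvg_series_exp_coeff.
apply/nondecreasing_seqP => k; rewrite seriesSr lerDl.
exact: exp_coeff_ge0.
Qed.

Lemma expR_split_sqr (x : R) : expR (- (2 / 3 * x ^+ 2)) =
  expR (- (2^-1 * x ^+ 2)) * expR (- (6^-1 * x ^+ 2)).
Proof. by rewrite -expRD; congr expR; field. Qed.

Lemma half_amgm (G P e k : R) : 0 <= e -> 0 <= k ->
  `|G * P * (e * k)| <= 2^-1 * (G ^+ 2 * e ^+ 2 + P ^+ 2 * k ^+ 2).
Proof.
move=> e0 k0; have -> : G * P * (e * k) = (G * e) * (P * k) by ring.
rewrite normrM; have := mul_le_half_sqr `|G * e| `|P * k|.
by rewrite !real_normK ?num_real// !exprMn; lra.
Qed.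

End exponential_bounds.

(** * Vanishing moments under Gaussian weights *)

Section gaussian_moments.
Context {R : realType}.
Local Notation mu := (@lebesgue_measure R).
Variable g : R -> R.
Hypothesis mg : measurable_fun setT g.
Hypothesis ig : mu.-integrable setT (EFin \o (fun x => g x ^+ 2 * expR (- x ^+ 2))).

(** The rate 2/3 exceeds 1/2, so splitting it as 1/2 + 1/6 bounds the product by g^2 exp(-x^2) and
    p^2 exp(-x^2/3). It is also below 1, which leaves x^2/3 to absorb exp((x - y)^2/4). *)
Lemma moment_integrable (p : {poly R}) :
  mu.-integrable setT (EFin \o (fun x => g x * p.[x] * expR (- (2 / 3 * x ^+ 2)))).
Proof.
have i3 : (0 : R) < 3^-1 by rewrite invr_gt0.
apply: (integrable_dominated _ _ _ (integrable_realZ 2^-1 measurableT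
  (integrable_realD measurableT ig (integrable_horner_gauss (p ^+ 2) i3)))) => //.
  apply: measurable_funM; last exact: measurable_gauss.
  by apply: measurable_funM => //; exact: measurable_horner.
move=> x _; rewrite expR_split_sqr.
apply: le_trans (half_amgm (g x) p.[x] (expR_ge0 _) (expR_ge0 _)) _.
rewrite horner_exp -!expRM_natl le_eqVlt; apply/orP; left; apply/eqP.
by congr (_ * (_ * expR _ + _ * expR _)); field.
Qed.

Lemma moment_integrable1 (p : {poly R}) :
  mu.-integrable setT (EFin \o (fun x => g x * p.[x] * expR (- x ^+ 2))).
Proof.
apply: (integrable_dominated _ _ _ (integrable_abse (moment_integrable p))) => //.
  apply: measurable_funM; last exact: measurable_gauss1.
  by apply: measurable_funM => //; exact: measurable_horner.
move=> x _; rewrite [leLHS]normrM [leRHS]normrM; apply: ler_wpM2l => //.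
rewrite !ger0_norm ?expR_ge0// ler_expR lerN2; have := sqr_ge0 x; lra.
Qed.

Section vanishing_moments.
Variable h : nat -> {poly R}.
Hypothesis hh : orthonormal_hermite h.
Hypothesis g0 : forall k, \int[mu]_x (g x * (h k).[x] * expR (- x ^+ 2)) = 0.

Lemma moment_eq0 (p : {poly R}) : \int[mu]_x (g x * p.[x] * expR (- x ^+ 2)) = 0.
Proof.
have [sz lc _] := hh.
have: (size p <= size p)%N by []; move: {2}(size p) => n.
elim: n p => [|n IH] p.
  rewrite leqn0 size_poly_eq0 => /eqP ->.
  under eq_Rintegral do rewrite horner0 mulr0 mul0r.
  by rewrite Rintegral_cst// mul0r.
move=> pn; pose c := p`_n / lead_coef (h n).
have rn : (size (p - c *: h n)%R <= n)%N.
  apply/leq_sizeP => j; rewrite leq_eqVlt coefB coefZ => /orP[/eqP <-|nj].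
    by rewrite /c -[(h n)`_n]/((h n)`_(n.+1.-1)) -sz divfK ?subrr// gt_eqF.
  by rewrite !nth_default ?mulr0 ?subr0// ?sz// (leq_trans pn).
rewrite -[RHS](addr0 0) -{1}(IH _ rn) -[in RHS](mulr0 c) -(g0 n).
rewrite -RintegralZl//; last exact: moment_integrable1.
rewrite -RintegralD//; last 2 first.
- exact: moment_integrable1.
- exact: (integrable_realZ _ _ (moment_integrable1 _)).
by apply: eq_Rintegral => x _; rewrite hornerD hornerN hornerZ; ring.
Qed.

Variable y : R.
Let q (x : R) := (x - y) ^+ 2 / 4.
Let W j (x : R) := expR (- x ^+ 2) * expR (- (j%:R * q x)).
Let Q : {poly R} := - 4^-1 *: ('X - y%:P) ^+ 2.

Let QE x : Q.[x] = - q x.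
Proof. by rewrite /Q hornerZ horner_exp hornerXsubC /q mulNr mulrC. Qed.

Let q0 x : 0 <= q x. Proof. by rewrite /q divr_ge0// sqr_ge0. Qed.

Let mq : measurable_fun setT q.
Proof.
apply: measurable_funM => //; apply: measurable_funX.
exact: measurable_funB.
Qed.

Let mW j : measurable_fun setT (W j).
Proof.
apply: measurable_funM; first exact: measurable_gauss1.
by apply: measurableT_comp => //; apply: measurableT_comp => //; exact: measurable_funM.
Qed.

Let weight_exp_le j x : W j x * expR (q x) <= expR (y ^+ 2) * expR (- (2 / 3 * x ^+ 2)).
Proof.
rewrite /W -!expRD ler_expR.
have : 0 <= j%:R * q x by rewrite mulr_ge0.
(* Indeed y^2 + x^2/3 - (x - y)^2/4 = (x + 3y)^2/12. *)
have := sqr_ge0 (x + 3 * y); rewrite /q; nra.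
Qed.

Let WS j x : W j.+1 x = W j x * expR (Q.[x]).
Proof. by rewrite /W QE -!expRD; congr expR; rewrite -natr1; ring. Qed.

Let exp_partial n : {poly R} := \sum_(i < n) (i`!%:R)^-1 *: Q ^+ i.

Let exp_partialE n x : (exp_partial n).[x] = series (exp_coeff Q.[x]) n.
Proof.
rewrite /exp_partial horner_sum /series/= big_mkord; apply: eq_bigr => i _.
by rewrite hornerZ horner_exp mulrC.
Qed.

Let mul3_norm (a b c : R) : 0 <= c -> `|a * b * c| = `|a * b| * c.
Proof. by move=> c0; rewrite normrM (ger0_norm c0). Qed.

(* Multiplying the weight by exp(-(x-y)^2/4) preserves the vanishing of all moments: expand
   the factor in its power series, dominated by exp((x-y)^2/4), which the weight absorbs. *)
Lemma gauss_moment_eq0 j (p : {poly R}) : \int[mu]_x (g x * p.[x] * W j x) = 0.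
Proof.
elim: j p => [|j IH] p.
  rewrite -[RHS](moment_eq0 p); apply: eq_Rintegral => x _.
  by rewrite /W mul0r oppr0 expR0 mulr1.
have iG := integrable_realZ (expR (y ^+ 2)) measurableT (integrable_abse (moment_integrable p)).
apply: (Rintegral_dominated_eq0 (u := fun n x => g x * (p * exp_partial n).[x] * W j x) _ _ iG).
- move=> n; apply: measurable_funM => //; apply: measurable_funM => //; exact: measurable_horner.
- move=> x; rewrite WS.
  have -> : g x * p.[x] * (W j x * expR Q.[x]) = g x * p.[x] * W j x * expR Q.[x] by ring.
  under eq_fun => n.
    have -> : g x * (p * exp_partial n).[x] * W j x =
      g x * p.[x] * W j x * series (exp_coeff Q.[x]) n by rewrite hornerM exp_partialE; ring.
    over.
  by apply: cvgMr; exact: is_cvg_series_exp_coeff.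
- move=> n x; rewrite hornerM exp_partialE.
  have Wj0 : 0 <= W j x by rewrite mulr_ge0// expR_ge0.
  have -> : g x * (p.[x] * series (exp_coeff Q.[x]) n) * W j x =
    g x * p.[x] * (W j x * series (exp_coeff Q.[x]) n) by ring.
  rewrite normrM [`|W j x * _|]normrM (ger0_norm Wj0).
  have E := exp_series_norm_le Q.[x] n.
  have Qq : `|Q.[x]| = q x by rewrite QE normrN ger0_norm.
  rewrite {}Qq in E.
  have H := le_trans (ler_wpM2l Wj0 E) (weight_exp_le j x).
  apply: le_trans (ler_wpM2l (normr_ge0 _) H) _.
  by rewrite mul3_norm ?expR_ge0// mulrCA.
- by move=> n; exact: IH.
Qed.

End vanishing_moments.
End gaussian_moments.

(** * Indicators as limits of polynomials *)

Section bump_limit.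
Context {R : realType}.

Lemma bernoulli_le (a : R) m : 0 <= a <= 1 -> 1 - m%:R * a <= (1 - a) ^+ m.
Proof.
move=> /andP[a0 a1]; elim: m => [|m IH]; first by rewrite mul0r subr0 expr0.
have a10 : 0 <= 1 - a by rewrite subr_ge0.
rewrite exprS; apply: le_trans (ler_wpM2l a10 IH).
have m0 : 0 <= m%:R :> R by [].
have := mulr_ge0 m0 (sqr_ge0 a); rewrite -natr1; nra.
Qed.

(** With s = sqrt t, n s^n is at most the sum of s^k over k < n, which is bounded; the remaining
    factor s^n tends to 0. *)
Lemma natmul_expr_cvg0 (t : R) : 0 <= t < 1 -> n%:R * t ^+ n @[n --> \oo] --> (0 : R).
Proof.
move=> /andP[t0 t1]; pose s := Num.sqrt t.
have s0 : 0 <= s by exact: sqrtr_ge0.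
have s1 : s < 1 by rewrite -sqrtr1 ltr_sqrt.
have ss : t = s * s by rewrite -expr2 sqr_sqrtr.
have ns n : n%:R * s ^+ n <= (1 - s)^-1.
  apply: le_trans (geometric_sum_le n s0 s1).
  rewrite -[n in n%:R]card_ord -sum1_card natr_sum mulr_suml; apply: ler_sum => i _.
  rewrite mul1r; apply: ler_wiXn2l => //; first exact: ltW.
  exact: ltnW.
have c0 : (1 - s)^-1 * s ^+ n @[n --> \oo] --> (0 : R).
  rewrite -[X in _ --> X](mulr0 (1 - s)^-1); apply: cvgMr.
  by apply: cvg_expr; rewrite ger0_norm.
apply: (squeeze_cvgr _ (cvg_cst 0) c0); apply: nearW => n.
rewrite mulr_ge0 ?exprn_ge0//= ss exprMn mulrA; apply: ler_wpM2r; [exact: exprn_ge0|exact: ns].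
Qed.

(* The exponent n 2^n, rather than 2^n, makes the limit 0 also at v = 1/2. *)
Lemma bump_cvg (v : R) : 0 <= v <= 1 ->
  (1 - v ^+ n) ^+ (n * 2 ^ n) @[n --> \oo] --> (if v < 2^-1 then 1 else 0 : R).
Proof.
move=> /andP[v0 v1].
have vn n : 0 <= v ^+ n <= 1 by rewrite exprn_ge0//= exprn_ile1.
have b0 n : 0 <= 1 - v ^+ n by rewrite subr_ge0; case/andP: (vn n).
have b1 n : 1 - v ^+ n <= 1 by rewrite gerBl; case/andP: (vn n).
(* This product decides both cases. For v < 1/2 it tends to 0 and Bernoulli's inequality bounds the
   power below; for v >= 1/2 it is at least n, and the power is at most exp(-n). *)
have E n : (n * 2 ^ n)%:R * v ^+ n = n%:R * (2 * v) ^+ n :> R.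
  by rewrite natrM natrX exprMn mulrA.
case: ifPn => [vlt|]; last first.
  rewrite -leNgt => vge.
  have e1 : `|expR (- 1) : R| < 1 by rewrite ger0_norm ?expR_ge0// expR_lt1 oppr_lt0.
  apply: (squeeze_cvgr _ (cvg_cst 0) (cvg_expr e1)); apply: nearW => n.
  rewrite exprn_ge0//=.
  have H : 1 - v ^+ n <= expR (- v ^+ n) by exact: expR_ge1Dx.
  apply: le_trans (_ : expR (- v ^+ n) ^+ (n * 2 ^ n) <= _).
    by apply: lerXn2r; rewrite ?nnegrE ?expR_ge0.
  rewrite -!expRM_natl ler_expR mulrN mulrN1 lerN2 E ler_peMr//.
  by rewrite exprn_ege1//; lra.
have c1 : 1 - n%:R * (2 * v) ^+ n @[n --> \oo] --> (1 : R).
  rewrite -[X in _ --> X](subr0 1); apply: cvgB; first exact: cvg_cst.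
  by apply: natmul_expr_cvg0; lra.
have c2 : (fun=> 1 : R) @ \oo --> (1 : R) by exact: cvg_cst.
apply: (squeeze_cvgr _ c1 c2); apply: nearW => n.
by rewrite -E bernoulli_le//= exprn_ile1.
Qed.

End bump_limit.

Section completeness.
Context {R : realType}.
Local Notation mu := (@lebesgue_measure R).
Variables (g : R -> R) (h : nat -> {poly R}).
Hypothesis mg : measurable_fun setT g.
Hypothesis ig : mu.-integrable setT (EFin \o (fun x => g x ^+ 2 * expR (- x ^+ 2))).
Hypothesis hh : orthonormal_hermite h.
Hypothesis g0 : forall k, \int[mu]_x (g x * (h k).[x] * expR (- x ^+ 2)) = 0.

Let G x := g x * expR (- x ^+ 2).

Let mG : measurable_fun setT G.
Proof. by apply: measurable_funM => //; exact: measurable_gauss1. Qed.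

Let iG : mu.-integrable setT (EFin \o G).
Proof.
have := moment_integrable1 mg ig 1; congr (integrable _ _ _).
by apply/funext => x /=; rewrite hornerC mulr1.
Qed.

Let v N (y x : R) := expR (- (N%:R * ((x - y) ^+ 2 / 4))).

Let v01 N y x : 0 <= v N y x <= 1.
Proof.
rewrite expR_ge0/= -[leRHS]expR0 ler_expR oppr_le0.
by rewrite mulr_ge0// divr_ge0// sqr_ge0.
Qed.

Let mv N y : measurable_fun setT (v N y).
Proof.
apply: measurableT_comp => //; apply: measurableT_comp => //.
apply: measurable_funM => //; apply: measurable_funM => //; apply: measurable_funX.
exact: measurable_funB.
Qed.

Let vX N y x k : v N y x ^+ k = v (k * N) y x.
Proof. by rewrite /v -expRM_natl natrM; congr expR; ring. Qed.

Let bounded_norm (a b : R) : 0 <= b <= 1 -> `|a * b| <= `|a|.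
Proof. by move=> /andP[b0 b1]; rewrite normrM (ger0_norm b0) ler_piMr. Qed.

Let bounded_integrable (b : R -> R) : measurable_fun setT b -> (forall x, 0 <= b x <= 1) ->
  mu.-integrable setT (EFin \o (fun x => G x * b x)).
Proof.
move=> mb b01.
apply: (integrable_dominated _ _ _ (integrable_abse iG)) => //.
  exact: measurable_funM.
by move=> x _; exact: bounded_norm.
Qed.

Let bump01 N y n M x : 0 <= (1 - v N y x ^+ n) ^+ M <= 1.
Proof.
have /andP[a0 a1] := v01 N y x.
have b0 : 0 <= 1 - v N y x ^+ n by rewrite subr_ge0 exprn_ile1.
by rewrite exprn_ge0//= exprn_ile1// gerBl exprn_ge0.
Qed.

Let bump_integrable N y k n M : mu.-integrable setT
  (EFin \o (fun x => G x * (v N y x ^+ k * (1 - v N y x ^+ n) ^+ M))).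
Proof.
apply: bounded_integrable.
  apply: measurable_funM; apply: measurable_funX => //.
  by apply: measurable_funB => //; exact: measurable_funX.
move=> x; have /andP[b0 b1] := bump01 N y n M x; have /andP[a0 a1] := v01 N y x.
have c0 : 0 <= v N y x ^+ k by exact: exprn_ge0.
have c1 : v N y x ^+ k <= 1 by exact: exprn_ile1.
by apply/andP; split; [exact: mulr_ge0|exact: mulr_ile1].
Qed.

(** Powers of v are again Gaussian factors, against which G has integral 0; expanding one factor 1 -
    v^n at a time extends this to the bumps. *)
Lemma bump_moment_eq0 N y n M k :
  \int[mu]_x (G x * (v N y x ^+ k * (1 - v N y x ^+ n) ^+ M)) = 0.
Proof.
elim: M k => [|M IH] k.
  rewrite -[RHS](gauss_moment_eq0 mg ig hh g0 y (k * N) 1); apply: eq_Rintegral => x _.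
  by rewrite expr0 mulr1 vX hornerC mulr1 /G mulrA.
rewrite -[RHS](subrr 0) -{1}(IH k) -(IH (k + n)%N) -RintegralB//; [|exact: bump_integrable..].
by apply: eq_Rintegral => x _; rewrite exprS exprD; ring.
Qed.

(** One minus the bumps are polynomials in v with values in [0, 1], converging pointwise to the
    indicator of v >= 1/2, which is an interval about y for N > 0. *)
Lemma level_set_integral_eq0 N y :
  \int[mu]_x (G x * (if v N y x < 2^-1 then 0 else 1)) = 0.
Proof.
apply: (Rintegral_dominated_eq0
  (u := fun n x => G x * (1 - (1 - v N y x ^+ n) ^+ (n * 2 ^ n))) _ _ (integrable_abse iG)).
- move=> n; apply: measurable_funM => //; apply: measurable_funB => //.
  by apply: measurable_funX; apply: measurable_funB => //; exact: measurable_funX.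
- move=> x; apply: cvgMr.
  have -> : (if v N y x < 2^-1 then 0 else 1) = 1 - (if v N y x < 2^-1 then 1 else 0) :> R.
    by case: ifP; rewrite ?subrr ?subr0.
  by apply: cvgB; [exact: cvg_cst|exact: bump_cvg].
- move=> n x; apply: bounded_norm; have /andP[b0 b1] := bump01 N y n (n * 2 ^ n) x.
  by rewrite subr_ge0 b1 gerBl.
- move=> n.
  have E1 := bump_moment_eq0 N y 0 0 0.
  have E2 := bump_moment_eq0 N y n (n * 2 ^ n) 0.
  rewrite -[RHS](subrr 0) -{1}E1 -E2 -RintegralB//; [|exact: bump_integrable..].
  by apply: eq_Rintegral => x _; rewrite !expr0 !mul1r mulrBr mulr1.
Qed.

(* [r n] is the radius for which v_(n.+1^2) >= 1/2 is the interval of centre [y]. *)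
Let r n : R := 2 * Num.sqrt (ln 2) / n.+1%:R.

Let ln2 : 0 < ln (2 : R). Proof. by apply: ln_gt0; rewrite ltr1n. Qed.

Let r0 n : 0 < r n.
Proof. by rewrite /r divr_gt0// mulr_gt0// sqrtr_gt0. Qed.

Let level_set n (y x : R) : (v (n.+1 ^ 2) y x < 2^-1) = (x \notin `[y - r n, y + r n]).
Proof.
rewrite in_itv/= -ler_distl -ltNge.
have -> : 2^-1 = expR (- ln 2) :> R by rewrite expRN lnK// posrE.
rewrite ltr_expR ltrN2 -[in RHS]ltr_sqr ?nnegrE ?(ltW (r0 n))//.
rewrite real_normK ?num_real// /r !exprMn sqr_sqrtr ?(ltW ln2)// exprVn natrX.
have n0 : 0 < n.+1%:R ^+ 2 :> R by rewrite exprn_gt0.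
move: n0; set m := _ ^+ 2; set d := _ ^+ 2; set L := ln 2 => n0.
by rewrite ltr_pdivrMr// mulrA ltr_pdivlMr// -natrX [L * _]mulrC [d * _]mulrC.
Qed.

Lemma interval_integral_eq0 n y : (\int[mu]_(x in `[(y - r n)%R, (y + r n)%R]) (G x)%:E = 0)%E.
Proof.
have E : (\int[mu]_(x in `[(y - r n)%R, (y + r n)%R]) (G x)%:E =
    \int[mu]_x (G x * (if v (n.+1 ^ 2) y x < 2^-1 then 0 else 1))%:E)%E.
  rewrite integral_mkcond; apply: eq_integral => x _.
  rewrite patchE level_set; case: ifPn => [|].
    by rewrite inE/= => -> /=; rewrite mulr1.
  by move=> /negP; rewrite inE/= => /negP -> /=; rewrite mulr0.
have ii : mu.-integrable `[(y - r n)%R, (y + r n)%R] (EFin \o G).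
  exact: integrableS iG.
rewrite -[LHS]fineK; last exact: integrable_fin_num ii.
by rewrite E; have := level_set_integral_eq0 (n.+1 ^ 2) y; rewrite /Rintegral => ->.
Qed.

(** G has mean zero over intervals centred at any y and shrinking to y, so Lebesgue differentiation
    gives G = 0 almost everywhere; the Gaussian factor is then divided out. *)
Lemma hermite_complete : {ae mu, forall x, g x = 0}.
Proof.
pose E y n : set R := `[(y - r n)%R, (y + r n)%R]%classic.
have hE y : nicely_shrinking y (E y).
  split; first by move=> n; exact: measurable_itv.
  have r20 n : 0 < 2 * r n by rewrite mulr_gt0.
  (* The open ball of radius 2 r_n contains the closed interval of radius r_n and has twice its
     length. *)
  exists (2, fun n => PosNum (r20 n)); split => //=.
  - have -> : (fun n => 2 * r n) = (fun n => (4 * Num.sqrt (ln 2)) * n.+1%:R^-1).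
      by apply/funext => n; rewrite /r; ring.
    rewrite -[X in _ --> X](mulr0 (4 * Num.sqrt (ln 2))); apply: cvgMr.
    exact: cvg_harmonic.
  - move=> n x; rewrite /E/= in_itv/= -ler_distl /ball/= distrC => /le_lt_trans; apply.
    by rewrite ltr_pMl// ltr1n.
  - move=> n; rewrite lebesgue_measure_ball; last exact: ltW.
    rewrite /E lebesgue_measure_itv/= lte_fin.
    have H : y - r n < y + r n by have := r0 n; lra.
    rewrite H -EFinB -EFinM lee_fin; lra.
have lG : locally_integrable setT G := open_integrable_locally openT iG.
apply: ae_imply (lebesgue_differentiation lG) _ => y Ly.
have c := nice_lebesgue_differentiation hE lG Ly.
have {}c : (0%E : \bar R) @[_ --> \oo] --> (G y)%:E.
  apply: cvg_trans c; apply: near_eq_cvg; apply: nearW => n.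
  by rewrite interval_integral_eq0 mule0.
have [/eqP] : (G y)%:E = 0%E.
  by rewrite -(cvg_lim _ c)//; exact: lim_cst.
by rewrite /G mulf_eq0 [expR _ == 0]gt_eqF ?expR_gt0// orbF => /eqP.
Qed.

End completeness.

(** * Uniqueness of coefficients and the converse inclusion *)

Section decay_to_entire.
Context {R : realType}.
Local Notation mu := (@lebesgue_measure R).
Variable h : nat -> {poly R}.
Hypothesis hh : orthonormal_hermite h.

Let L2 (g : R -> R) := mu.-integrable setT (EFin \o (fun x => g x ^+ 2 * expR (- x ^+ 2))).

Lemma gaussian_L2_Re_Im (f : R -> R[i]) : gaussian_L2 f ->
  L2 (fun x => complex.Re (f x)) /\ L2 (fun x => complex.Im (f x)).
Proof.
move=> [mf f2]; have mfE := measurable_cfunE mf; have [mRe mIm] := mf.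
have i2 : mu.-integrable setT (EFin \o (fun x => cmod (f x) ^+ 2 * expR (- x ^+ 2))).
  apply/ge0_integrableP => //.
    apply: measurable_funM; last exact: measurable_gauss1.
    by apply: measurable_funX; exact: cmeasurable_cmod.
  by move=> x; exact: mulr_ge0 (sqr_ge0 _) (expR_ge0 _).
split; apply: (integrable_dominated _ _ _ i2) => //.
- by apply: measurable_funM; [exact: measurable_funX|exact: measurable_gauss1].
- move=> x _; rewrite normrM !ger0_norm ?expR_ge0 ?sqr_ge0//.
  by apply: ler_wpM2r; rewrite ?expR_ge0// sqr_cmod lerDl sqr_ge0.
- by apply: measurable_funM; [exact: measurable_funX|exact: measurable_gauss1].
- move=> x _; rewrite normrM !ger0_norm ?expR_ge0 ?sqr_ge0//.
  by apply: ler_wpM2r; rewrite ?expR_ge0// sqr_cmod lerDr sqr_ge0.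
Qed.

Lemma ae_and (P Q : R -> Prop) : {ae mu, forall x, P x} -> {ae mu, forall x, Q x} ->
  {ae mu, forall x, P x /\ Q x}.
Proof.
move=> [N [mN N0 sN]] [M [mM M0 sM]]; exists (N `|` M); split.
- exact: measurableU.
- exact: (@null_set_setU _ (measurableTypeR R) R mu).
- move=> x /= nPQ; apply: contrapT => /not_orP[nN nM].
  by apply: nPQ; split; apply: contrapT => /= H; [apply: nN; exact: sN|apply: nM; exact: sM].
Qed.

Lemma weighted_sqrB_le (a b e : R) : 0 <= e ->
  (a - b) ^+ 2 * e <= 2 * (a ^+ 2 * e) + 2 * (b ^+ 2 * e).
Proof. by move=> e0; have := mulr_ge0 (sqr_ge0 (a + b)) e0; nra. Qed.

Lemma hermite_coef_inj (g1 g2 : R -> R) :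
  measurable_fun setT g1 -> measurable_fun setT g2 -> L2 g1 -> L2 g2 ->
  (forall k, \int[mu]_x (g1 x * (h k).[x] * expR (- x ^+ 2)) =
             \int[mu]_x (g2 x * (h k).[x] * expR (- x ^+ 2))) ->
  {ae mu, forall x, g1 x = g2 x}.
Proof.
move=> m1 m2 i1 i2 E.
have : {ae mu, forall x, g1 x - g2 x = 0}.
  apply: (hermite_complete (h := h)) => //.
  - exact: measurable_funB.
  - have iD := integrable_realD measurableT (integrable_realZ 2 measurableT i1)
      (integrable_realZ 2 measurableT i2).
    apply: (integrable_dominated _ _ _ iD) => //.
      apply: measurable_funM; last exact: measurable_gauss1.
      by apply: measurable_funX; exact: measurable_funB.
    move=> x _; rewrite normrM !ger0_norm ?expR_ge0 ?sqr_ge0//.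
    exact: weighted_sqrB_le (expR_ge0 _).
  - move=> k; rewrite -[RHS](subrr (\int[mu]_x (g2 x * (h k).[x] * expR (- x ^+ 2)))) -{1}E.
    rewrite -RintegralB//; [|exact: moment_integrable1..].
    by apply: eq_Rintegral => x _; rewrite !mulrBl.
by move=> H; apply: ae_imply H _ => x /eqP; rewrite subr_eq0 => /eqP.
Qed.

Lemma hermite_decay_entire (theta : R) (f : R -> R[i]) : 1 < theta -> gaussian_L2 f ->
  (\sum_(0 <= k <oo) (cmod (hermite_coef h f k) ^+ 2 * theta ^+ k)%:E < +oo)%E ->
  exists F, [/\ entire F, (weighted_area_integral theta F < +oo)%E &
    {ae mu, forall x, f x = F x%:C}].
Proof.
move=> theta1 f2; set c := hermite_coef h f; pose u k := (cmod (c k) ^+ 2 * theta ^+ k)%:E.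
rewrite -[X in (X < _)%E]/(\sum_(0 <= k <oo) u k)%E => sfin.
have u0 k : (0 <= u k)%E.
  by rewrite lee_fin mulr_ge0 ?sqr_ge0// exprn_ge0// ltW// (lt_trans ltr01).
have [F [eF iF cF]] : exists F, [/\ entire F, area_integrable theta F &
    forall k, hermite_coef h (fun x => F x%:C) k = c k].
  apply: (hermite_interpolation hh theta1 (S := fine (\sum_(0 <= k <oo) u k)%E)) => n.
  rewrite -lee_fin fineK; last by rewrite ge0_fin_numE// nneseries_ge0.
  rewrite -sumEFin -(big_mkord xpredT u); apply: nneseries_lim_ge => k _ _; exact: u0.
exists F; have wF := area_integrable_weighted iF; split => //.
have mF := entire_real_measurable eF.
have FF : {ae mu, forall x, F x%:C = F x%:C} by exact: nearW.
(* The opposite inclusion, applied to F itself, puts its restriction in the Gaussian L^2 space, as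
   uniqueness of the coefficients requires. *)
have [F2 _] := entire_hermite_decay hh theta1 mF eF wF FF.
have [[m1 m2] [m3 m4]] := (f2.1, mF).
have [f2r f2i] := gaussian_L2_Re_Im f2; have [F2r F2i] := gaussian_L2_Re_Im F2.
have aR := hermite_coef_inj m1 m3 f2r F2r (fun k => esym (congr1 (@complex.Re R) (cF k))).
have aI := hermite_coef_inj m2 m4 f2i F2i (fun k => esym (congr1 (@complex.Im R) (cF k))).
by apply: ae_imply (ae_and aR aI) _ => x; case: (f x) (F _) => [a b] [a' b'] /= [-> ->].
Qed.

End decay_to_entire.

Theorem theorem1 (R : realType) (h : nat -> {poly R})
    (hh : orthonormal_hermite h) (theta : R) (htheta : 1 < theta) :
  [set f : R -> R[i] | gaussian_L2 f /\
     (\sum_(0 <= k <oo)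
        (cmod (hermite_coef h f k) ^+ 2 * theta ^+ k)%:E < +oo)%E] =
  [set f : R -> R[i] | measurable_cfun f /\
     exists F : R[i] -> R[i],
       [/\ entire F,
           (weighted_area_integral theta F < +oo)%E &
           {ae @lebesgue_measure R, forall x : R, f x = F x%:C}]].
Proof.
apply/seteqP; split => f /=.
  by move=> [f2 fS]; split; [exact: f2.1|exact: hermite_decay_entire fS].
by move=> [mf [F [eF wF fF]]]; exact: entire_hermite_decay fF.
Qed.
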